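(* Suppose the constrained Markov decision process described in the context satisfies conditions (G), (SU) and (M) stated there. Let $\{(\rho_n,h_n,\beta_n)\}_{n\ge0}$ be a maximizing sequence of the dual program (P$^*$) defined in the context, and let $\beta_{n,j}$ denote the $j$th component of $\beta_n$. Then the following hold: (i) The sequence $\{\beta_{n,j}\}_{n\ge0}$ is bounded for every $j\in\mathcal{J}^{(0)}$. (ii) For $1\le j\le d$, $\lim_{n\to\infty}\beta_{n,j}=0$ if $J_j(\mu^*,p^* )<\kappa_j$ for some stationary optimal pair $(\mu^*,p^* )$ of the constrained MDP. (iii) Suppose there exists $(\pi,\zeta)\in\Pi\times\mathcal{P}(\mathbb{X})$ such that $J_j(\pi,\zeta)<\kappa_j$ for all $j\in\mathcal{J}^{(1)}$ and $J_j(\pi,\zeta)<\infty$ for all $j\in\mathcal{J}^{(0)}\cup\{0\}$. Then the sequence $\{\beta_n\}_{n\ge0}$ is bounded.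
   Context: MDP model. $\mathbb{X}$ (state space) is a Borel space, i.e., a separable metrizable space homeomorphic to a Borel subset of a Polish space. $\mathbb{A}$ (action space) is a countable set with the discrete topology. For a topological space $X$, $\mathcal{B}(X)$ is its Borel $\sigma$-algebra and $\mathcal{P}(X)$ the set of Borel probability measures; for $X$ a Borel space, $\mathcal{P}(X)$ carries the topology of weak convergence. Each $x\in\mathbb{X}$ has a nonempty set $A(x)\subset\mathbb{A}$ of admissible actions, and $\Gamma=\{(x,a): x\in\mathbb{X}, a\in A(x)\}$ is a Borel subset of $\mathbb{X}\times\mathbb{A}$. The state transition kernel $q(dy\,|\,x,a)$ is a Borel measurable stochastic kernel on $\mathbb{X}$ given $\mathbb{X}\times\mathbb{A}$ (i.e., a Borel measurable map into $\mathcal{P}(\mathbb{X})$). The one-stage cost functions $c_0,c_1,\ldots,c_d:\mathbb{X}\times\mathbb{A}\to[0,+\infty]$ are Borel measurable, finite on $\Gamma$ and equal to $+\infty$ outside $\Gamma$. $\kappa=(\kappa_1,\ldots,\kappa_d)\ge0$ is a given vector of upper limits in $\mathbb{R}^d$. Policies and average costs. A policy is a sequence $\pi=(\mu_0,\mu_1,\ldots)$ where $\mu_n(da_n\,|\,x_0,a_0,\ldots,a_{n-1},x_n)$ is a Borel measurable stochastic kernel on $\mathbb{A}$ given $(\mathbb{X}\times\mathbb{A})^n\times\mathbb{X}$ with $\mu_n(A(x_n)\,|\,x_0,a_0,\ldots,a_{n-1},x_n)=1$ everywhere; $\Pi$ is the set of all policies. A stationary policy is one of the form $(\mu,\mu,\ldots)$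 with $\mu(da\,|\,x)$ a Borel measurable stochastic kernel on $\mathbb{A}$ given $\mathbb{X}$ with $\mu(A(x)\,|\,x)=1$; it is denoted by $\mu$. A policy $\pi$ and an initial distribution $\zeta\in\mathcal{P}(\mathbb{X})$, together with $q$, determine the law of the process $\{(x_n,a_n)\}_{n\ge0}$, with expectation $\mathbf{E}^\pi_\zeta$. For $0\le i\le d$, $J_i(\pi,\zeta)=\limsup_{n\to\infty} n^{-1}\mathbf{E}^\pi_\zeta\big[\sum_{k=0}^{n-1}c_i(x_k,a_k)\big]$. Constrained problem. The feasible set is $\mathcal{S}=\{(\pi,\zeta)\in\Pi\times\mathcal{P}(\mathbb{X}): J_0(\pi,\zeta)<\infty,\ J_i(\pi,\zeta)\le\kappa_i,\ i=1,\ldots,d\}$, and $\rho_c^*=\inf_{(\pi,\zeta)\in\mathcal{S}}J_0(\pi,\zeta)$. A stationary optimal pair is a pair $(\mu^*,p^* )\in\mathcal{S}$ with $J_0(\mu^*,p^* )=\rho_c^*$ such that $\mu^*$ is a stationary policy and $p^*$ is an invariant probability measure of the Markov chain on $\mathbb{X}$ induced by $\mu^*$. Define $\mathcal{J}^{(0)}=\{i: 1\le i\le d,\ \exists\,(\pi,\zeta)\in\mathcal{S}\text{ such that }J_i(\pi,\zeta)<\kappa_i\}$ and $\mathcal{J}^{(1)}=\{1,2,\ldots,d\}\setminus\mathcal{J}^{(0)}$. Conditions. (G) $\mathcal{S}\ne\varnothing$. (SU) There is a nondecreasing sequence of compact sets $\Gamma_j\uparrow\Gamma$ such that for some $0\le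 i\le d$, $\lim_{j\to\infty}\inf_{(x,a)\in\Gamma_j^c}c_i(x,a)=+\infty$ (complement in $\mathbb{X}\times\mathbb{A}$). (M) With $\Gamma_j$ as in (SU), for each compact set $K\in\{\mathrm{proj}_{\mathbb{X}}(\Gamma_j)\}$ (projections of the $\Gamma_j$ on $\mathbb{X}$) there exist an open set $O\supset K$, a closed set $D\subset\mathbb{X}$ (possibly empty) and a finite measure $\nu$ on $\mathcal{B}(\mathbb{X})$, all possibly depending on $K$, such that $q\big((O\setminus D)\cap B\,|\,x,a\big)\le\nu(B)$ for all $B\in\mathcal{B}(\mathbb{X})$ and $(x,a)\in\Gamma$, and such that, restricted to $D\times\mathbb{A}$, the kernel $q(dy\,|\,x,a)$ is continuous (as a map into $\mathcal{P}(\mathbb{X})$) and all the functions $c_i$, $0\le i\le d$, are lower semicontinuous. Dual program. $\mathbb{F}_b(\mathbb{X})$ is the set of bounded real-valued Borel measurable functions on $\mathbb{X}$. (P$^*$): maximize $\rho+\sum_{i=1}^d\beta_i\kappa_i$ over $(\rho,h,\beta)\in\mathbb{R}\times\mathbb{F}_b(\mathbb{X})\times\mathbb{R}^d$ subject to $\rho+h(x)-\int_{\mathbb{X}}h(y)\,q(dy\,|\,x,a)+\sum_{i=1}^d\beta_ic_i(x,a)\le c_0(x,a)$ for all $(x,a)\in\Gamma$, and $\beta\le0$ (componentwise). Its optimal value is $\sup(\mathrm{P}^* )$. A maximizing sequence of (P$^*$) is a sequence $\{(\rho_n,h_n,\beta_n)\}$ of feasible solutions of (P$^*$) with $\rho_n+\sum_{i=1}^d\beta_{n,i}\kappa_i\uparrow\sup(\mathrm{P}^*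 )$. *)

(* Defs.v *)
From HB Require Import structures.
From mathcomp Require Import all_boot all_order all_algebra.
From mathcomp Require Import all_classical all_reals all_analysis.
From mathcomp Require Import measurable_realfun.

Set Implicit Arguments.
Unset Strict Implicit.
Unset Printing Implicit Defensive.
Import Order.TTheory GRing.Theory Num.Theory.
Import numFieldNormedType.Exports.

Local Open Scope classical_set_scope.
Local Open Scope ring_scope.
Local Open Scope ereal_scope.

HB.mixin Record Measurable_isBorel d T & Measurable d T & Topological T := {
  measurable_borelE : @measurable d T = <<s [set U : set T | open U] >> }.

#[short(type="borelMeasurableType")]
HB.structure Definition BorelMeasurable d :=
  { T of Measurable d T & Topological T & Measurable_isBorel d T }.

#[short(type="discreteBorelMeasurableType")]
HB.structure Definition DiscreteBorelMeasurable d :=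
  { T of BorelMeasurable d T & Discrete_ofNbhs T }.

Definition polish (R : realType) (P : completePseudoMetricType R) : Prop :=
  hausdorff_space P /\ exists2 S : set P, countable S & dense S.

(** [f] and [g] are mutually inverse homeomorphisms between [X] and the Borel
    subset [B] of the Polish space [P]. *)
Definition borel_space (R : realType) (X : topologicalType) : Prop :=
  exists (P : completePseudoMetricType R) (B : set P) (f : X -> P) (g : P -> X),
    [/\ polish P, <<s [set U : set P | open U] >> B,
        continuous f /\ (forall x, B (f x)),
        {within B, continuous g} &
        (forall x, g (f x) = x) /\ (forall y, B y -> f (g y) = y)].

Section weak_convergence.
Context (R : realType) (d : measure_display) (X : borelMeasurableType d).

Definition bounded_continuous : Type :=
  {f : X -> R | continuous f /\ bounded_fun f}.

Definition integrals (mu : probability X R) :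
    {ptws bounded_continuous -> R} :=
  fun f => Rintegral mu setT (sval f).

(** The topology of weak convergence: the coarsest one that makes
    [mu |-> \int f dmu] continuous for every bounded continuous [f]. *)
Definition weak_probability : Type := initial_topology integrals.

HB.instance Definition _ := Topological.on weak_probability.

End weak_convergence.

(** The value at [x] of a probability kernel, as a bundled probability. *)
Section kernel_value.
Context d d' (X : measurableType d) (Y : measurableType d') (R : realType).
Variable k : R.-pker X ~> Y.

Definition kernel_value (x : X) : set Y -> \bar R := k x.

HB.instance Definition _ x := Measure.on (kernel_value x).
HB.instance Definition _ x :=
  Measure_isProbability.Build _ _ _ (kernel_value x) (@prob_kernel _ _ _ _ _ k x).

End kernel_value.

Section mdp.
Context (R : realType) (dX dA : measure_display)
  (X : borelMeasurableType dX) (A : discreteBorelMeasurableType dA).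

(** A constrained MDP with cost functions [c_0, ..., c_d]; the constrained ones
    are [cost (lift ord0 i)] for [i : 'I_d], with upper limits [kappa ord0 i].
    [X * A] carries the product sigma-algebra; for a second-countable [X] and a
    countable discrete [A] it is the Borel sigma-algebra of [X * A]. *)
Record cmdp (d : nat) := Cmdp {
  adm : X -> set A ;
  adm_neq0 : forall x, adm x !=set0 ;
  measurable_adm : measurable [set z : X * A | adm z.1 z.2] ;
  transition : R.-pker (X * A) ~> X ;
  cost : 'I_d.+1 -> X * A -> \bar R ;
  cost_ge0 : forall i z, 0 <= cost i z ;
  measurable_cost : forall i, measurable_fun [set: X * A] (cost i) ;
  cost_fin_num : forall i z, adm z.1 z.2 -> cost i z \is a fin_num ;
  cost_pinfty : forall i z, ~ adm z.1 z.2 -> cost i z = +oo ;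
  kappa : 'rV[R]_d ;
  kappa_ge0 : forall i, (0 <= kappa ord0 i)%R
}.

(** [((x_0, a_0), ..., (x_{n-1}, a_{n-1})), x_n] *)
Definition history (n : nat) : Type := (n.-tuple (X * A) * X)%type.

HB.instance Definition _ n := Measurable.on (history n).

Definition init_history (x : X) : history 0 := ([tuple], x).

Definition extend_history n (w : history n) (a : A) (y : X) : history n.+1 :=
  ([tuple of rcons w.1 (w.2, a)], y).

Section fixed_mdp.
Context (d : nat) (M : cmdp d).

Record policy := Policy {
  decision :> forall n, R.-pker (history n) ~> A ;
  decision_adm : forall n (w : history n), decision n w (adm M w.2) = 1
}.

Lemma measurable_init_history : measurable_fun [set: X] init_history.
Proof. exact: measurable_fun_pair. Qed.

Lemma measurable_extend_history n : measurable_fun [set: (history n * A) * X]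
  (fun z => extend_history z.1.1 z.1.2 z.2).
Proof.
have m1 : measurable_fun [set: (history n * A) * X] (fun z => z.1.1 : history n).
  by apply: measurableT_comp => //; exact: measurable_fst.
apply: measurable_fun_pair; last exact: measurable_snd.
apply/measurable_fun_tnthP => i.
have [lt_in|le_ni] := ltnP i n.
  rewrite (_ : _ \o _ =
      (fun z : (history n * A) * X => tnth z.1.1.1 (Ordinal lt_in))); last first.
    apply/funext => -[[[t x] a] y] /=.
    rewrite (tnth_nth (x, a)) /= nth_rcons size_tuple lt_in.
    by rewrite (tnth_nth (x, a)).
  apply: (@measurableT_comp _ _ _ _ _ _
    (fun t : n.-tuple (X * A) => tnth t (Ordinal lt_in))).
    exact: measurable_tnth.
  exact: (measurableT_comp measurable_fst m1).
rewrite (_ : _ \o _ = (fun z : (history n * A) * X => (z.1.1.2, z.1.2))).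
  apply: measurable_fun_pair.
    exact: (measurableT_comp measurable_snd m1).
  by apply: measurableT_comp => //; exact: measurable_fst.
apply/funext => -[[[t x] a] y] /=.
have -> : i = ord_max.
  by apply/val_inj/eqP; rewrite eqn_leq /= le_ni -ltnS ltn_ord.
by rewrite (tnth_nth (x, a)) /= nth_rcons size_tuple ltnn eqxx.
Qed.

Section init.

Definition init_law (zeta : probability X R) : set (history 0) -> \bar R :=
  fun B => zeta [set x | B (init_history x)].

Let measurable_init (B : set (history 0)) :
  measurable B -> measurable [set x | B (init_history x)].
Proof.
by move=> mB; rewrite -[X in measurable X]setTI; exact: measurable_init_history.
Qed.

Let init0 zeta : init_law zeta set0 = 0.
Proof. exact: measure0. Qed.

Let init_ge0 zeta B : 0 <= init_law zeta B.
Proof. exact: measure_ge0. Qed.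

Let init_sigma_additive zeta : semi_sigma_additive (init_law zeta).
Proof.
move=> F mF tF mUF; rewrite /init_law.
rewrite (_ : [set x | _] = \bigcup_k [set x | F k (init_history x)]); last by [].
apply: measure_semi_sigma_additive.
- by move=> k; exact: measurable_init.
- apply/trivIsetP => i j _ _ ij; apply/seteqP; split => // y [Fi Fj].
  by move/trivIsetP : tF => /(_ i j Logic.I Logic.I ij) /seteqP[h _];
    exact: (h _ (conj Fi Fj)).
- by apply: bigcup_measurable => k _; exact: measurable_init.
Qed.

HB.instance Definition _ zeta := isMeasure.Build _ _ _ (init_law zeta)
  (init0 zeta) (init_ge0 zeta) (@init_sigma_additive zeta).

Let init_setT zeta : init_law zeta setT = 1.
Proof. exact: (probability_setT zeta). Qed.

HB.instance Definition _ zeta :=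
  Measure_isProbability.Build _ _ _ (init_law zeta) (init_setT zeta).

End init.

Section stage.
Context (n : nat).

(** The law of the history at time [n + 1], given the history [w] at time [n]
    and the action [a]: a Dirac mass on [(w, a)] times [q(dy | x_n, a)]. *)
Definition stage_fun (z : history n * A) : set (history n.+1) -> \bar R :=
  fun B => transition M (z.1.2, z.2) [set y | B (extend_history z.1 z.2 y)].

Let preimage_extend (B : set (history n.+1)) :
  measurable B ->
  measurable ((fun z : (history n * A) * X =>
                 extend_history z.1.1 z.1.2 z.2) @^-1` B).
Proof.
by move=> mB; rewrite -[X in measurable X]setTI;
  exact: measurable_extend_history.
Qed.

Let measurable_section (z : history n * A) (B : set (history n.+1)) :
  measurable B -> measurable [set y | B (extend_history z.1 z.2 y)].
Proof.
move=> /preimage_extend /(measurable_xsection z); congr measurable.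
by apply/seteqP; split => y; rewrite /xsection /= inE.
Qed.

Let stage0 z : stage_fun z set0 = 0.
Proof. exact: measure0. Qed.

Let stage_ge0 z B : 0 <= stage_fun z B.
Proof. exact: measure_ge0. Qed.

Let stage_sigma_additive z : semi_sigma_additive (stage_fun z).
Proof.
move=> F mF tF mUF; rewrite /stage_fun.
rewrite (_ : [set y | _] =
  \bigcup_k [set y | F k (extend_history z.1 z.2 y)]); last by [].
apply: measure_semi_sigma_additive.
- by move=> k; exact: measurable_section.
- apply/trivIsetP => i j _ _ ij; apply/seteqP; split => // y [Fi Fj].
  by move/trivIsetP : tF => /(_ i j Logic.I Logic.I ij) /seteqP[h _];
    exact: (h _ (conj Fi Fj)).
- by apply: bigcup_measurable => k _; exact: measurable_section.
Qed.

HB.instance Definition _ z := isMeasure.Build _ _ _ (stage_fun z)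
  (stage0 z) (stage_ge0 z) (@stage_sigma_additive z).

Definition stage_kernel :
  history n * A -> {measure set (history n.+1) -> \bar R} := stage_fun.

Let state_action (z : history n * A) : X * A := (z.1.2, z.2).

Let measurable_state_action : measurable_fun [set: history n * A] state_action.
Proof.
apply: measurable_fun_pair; last exact: measurable_snd.
apply: (@measurableT_comp _ _ _ _ _ _ (fun w : history n => w.2)).
  exact: measurable_snd.
exact: measurable_fst.
Qed.

Let next_state (z : history n * A) : {measure set X -> \bar R} :=
  transition M (state_action z).

Let measurable_next_state U : measurable U ->
  measurable_fun [set: history n * A] (next_state ^~ U).
Proof.
move=> mU; exact: (measurableT_comp (measurable_kernel (transition M) U mU)
  measurable_state_action).
Qed.

HB.instance Definition _ :=
  isKernel.Build _ _ _ _ R next_state measurable_next_state.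

Let next_state_setT z : next_state z setT = 1.
Proof. exact: prob_kernel. Qed.

HB.instance Definition _ :=
  Kernel_isProbability.Build _ _ _ _ R next_state next_state_setT.

Let measurable_stage B : measurable B ->
  measurable_fun [set: history n * A] (stage_kernel ^~ B).
Proof.
move=> /preimage_extend; rewrite -inE.
move=> /(measurable_fun_xsection_finite_kernel next_state).
congr measurable_fun; apply/funext => z; congr (transition M _ _).
by apply/seteqP; split => y; rewrite /xsection /= inE.
Qed.

HB.instance Definition _ :=
  isKernel.Build _ _ _ _ R stage_kernel measurable_stage.

Let stage_setT z : stage_kernel z setT = 1.
Proof. exact: prob_kernel. Qed.

HB.instance Definition _ :=
  Kernel_isProbability.Build _ _ _ _ R stage_kernel stage_setT.

End stage.

Section next.
Context (pi : policy) (n : nat).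

Definition next_law (P : probability (history n) R) :
    set (history n.+1) -> \bar R :=
  fun B => \int[P]_w \int[pi n w]_a stage_kernel (w, a) B.

Let measurable_next B : measurable B ->
  measurable_fun [set: history n]
    (fun w => \int[pi n w]_a stage_kernel (w, a) B).
Proof.
exact: (measurable_kernel (pi n \; (@stage_kernel n))).
Qed.

Let next0 P : next_law P set0 = 0.
Proof.
by rewrite /next_law integral0_eq => // w _; rewrite integral0_eq.
Qed.

Let next_ge0 P B : 0 <= next_law P B.
Proof. by apply: integral_ge0 => w _; exact: integral_ge0. Qed.

Let next_sigma_additive P : semi_sigma_additive (next_law P).
Proof.
move=> F mF tF mUF.
rewrite [X in _ --> X](_ : _ = \int[P]_w (\sum_(k <oo)
    \int[pi n w]_a stage_kernel (w, a) (F k))); last first.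
  apply: eq_integral => w _; apply/esym/cvg_lim => //.
  exact: (@measure_semi_sigma_additive _ _ _
    (mkcomp (pi n) (@stage_kernel n) w) F mF tF mUF).
apply/cvg_closeP; split.
  by apply: is_cvg_nneseries => k _ _; exact: next_ge0.
rewrite closeE// integral_nneseries//; first by move=> k; exact: measurable_next.
by move=> k w _; exact: integral_ge0.
Qed.

HB.instance Definition _ P := isMeasure.Build _ _ _ (next_law P)
  (next0 P) (next_ge0 P) (@next_sigma_additive P).

Let next_setT P : next_law P setT = 1.
Proof.
rewrite /next_law (eq_integral (cst 1)).
  by rewrite integral_cst// mul1e; exact: (probability_setT P).
move=> w _; rewrite (eq_integral (cst 1)) => [|a _]; last exact: prob_kernel.
by rewrite integral_cst// mul1e prob_kernel.
Qed.

HB.instance Definition _ P :=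
  Measure_isProbability.Build _ _ _ (next_law P) (next_setT P).

End next.

(** The law of [((x_0, a_0), ..., (x_{n-1}, a_{n-1})), x_n] under the policy [pi]
    and the initial distribution [zeta]. *)
Fixpoint history_law (pi : policy) (zeta : probability X R) (n : nat) :
    probability (history n) R :=
  match n with
  | 0 => init_law zeta
  | m.+1 => next_law pi (history_law pi zeta m)
  end.

Definition expected_cost (i : 'I_d.+1) (pi : policy) (zeta : probability X R)
    (n : nat) : \bar R :=
  \int[history_law pi zeta n]_w (\sum_(k < n) cost M i (tnth w.1 k)).

Definition average_cost (i : 'I_d.+1) (pi : policy) (zeta : probability X R) :
    \bar R :=
  limn_esup (fun n => (n%:R^-1)%:E * expected_cost i pi zeta n).

Definition constrained_cost (i : 'I_d) := average_cost (lift ord0 i).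

Definition feasible : set (policy * probability X R) :=
  [set s | average_cost ord0 s.1 s.2 < +oo /\
    forall i, constrained_cost i s.1 s.2 <= (kappa M ord0 i)%:E].

Definition optimal_cost : \bar R :=
  ereal_inf [set average_cost ord0 s.1 s.2 | s in feasible].

(** [pi = (mu, mu, ...)]; that [mu x] is carried by [adm M x] follows from
    [decision_adm] at time [0]. *)
Definition stationary_of (mu : R.-pker X ~> A) (pi : policy) : Prop :=
  forall n (w : history n) B, measurable B -> pi n w B = mu w.2 B.

Definition invariant_measure (mu : R.-pker X ~> A) (p : probability X R) : Prop :=
  forall B, measurable B ->
    p B = \int[p]_x \int[mu x]_a transition M (x, a) B.

Definition stationary_optimal_pair (pi : policy) (p : probability X R) : Prop :=
  [/\ feasible (pi, p), average_cost ord0 pi p = optimal_cost &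
      exists2 mu : R.-pker X ~> A, stationary_of mu pi & invariant_measure mu p].

Definition J0set : set 'I_d :=
  [set i | exists2 s, feasible s &
    constrained_cost i s.1 s.2 < (kappa M ord0 i)%:E].

Definition J1set : set 'I_d := ~` J0set.

Definition adm_graph : set (X * A) := [set z | adm M z.1 z.2].

Definition cond_SU (Gam : nat -> set (X * A)) : Prop :=
  [/\ forall j, compact (Gam j), nondecreasing_seq Gam,
      \bigcup_j Gam j = adm_graph &
      exists i : 'I_d.+1,
        ereal_inf [set cost M i z | z in ~` Gam j] @[j --> \oo] --> +oo].

Definition cond_M (Gam : nat -> set (X * A)) : Prop :=
  forall K : set X, (exists j, K = fst @` Gam j) ->
  exists (O D : set X) (nu : {finite_measure set X -> \bar R}),
    [/\ open O /\ K `<=` O,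
        closed D,
        forall B z, measurable B -> adm_graph z ->
          transition M z ((O `\` D) `&` B) <= nu B,
        {within D `*` [set: A],
          continuous (kernel_value (transition M) : X * A -> weak_probability R X)} &
        forall i, lower_semicontinuous
          (cost M i : subspace (D `*` [set: A]) -> \bar R)].

Definition dual_feasible (rho : R) (h : X -> R) (beta : 'rV[R]_d) : Prop :=
  [/\ measurable_fun [set: X] h, bounded_fun h,
      forall i, (beta ord0 i <= 0)%R &
      forall z, adm_graph z ->
        rho%:E + (h z.1)%:E - (\int[transition M z]_y (h y)%:E)
          + \sum_(i < d) (beta ord0 i)%:E * cost M (lift ord0 i) z
        <= cost M ord0 z].

Definition dual_objective (rho : R) (beta : 'rV[R]_d) : R :=
  (rho + \sum_(i < d) beta ord0 i * kappa M ord0 i)%R.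

Definition dual_value : \bar R :=
  ereal_sup [set v | exists rho h beta,
    dual_feasible rho h beta /\ v = (dual_objective rho beta)%:E].

Definition maximizing_sequence (rho : nat -> R) (h : nat -> X -> R)
    (beta : nat -> 'rV[R]_d) : Prop :=
  let v n := dual_objective (rho n) (beta n) in
  [/\ forall n, dual_feasible (rho n) (h n) (beta n),
      nondecreasing_seq v & (v n)%:E @[n --> \oo] --> dual_value].

End fixed_mdp.
End mdp.

Arguments feasible {R dX dA X A d} M.

(* Main.v *)
Require Import Defs.
From HB Require Import structures.
From mathcomp Require Import all_boot all_order all_algebra.
From mathcomp Require Import all_classical all_reals all_analysis.
From mathcomp Require Import measurable_realfun.
From mathcomp Require Import ring lra.

Set Implicit Arguments.
Unset Strict Implicit.
Unset Printing Implicit Defensive.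
Import Order.TTheory GRing.Theory Num.Theory.
Import numFieldNormedType.Exports.

Local Open Scope classical_set_scope.
Local Open Scope ring_scope.
Local Open Scope ereal_scope.

(**
Every admissible dual triple [(rho, h, beta)] gives a lower bound on the average
costs of every policy: integrating the dual constraint along the first [n] stages
makes [h] telescope, so that after division by [n] only a bounded multiple of
[1 / n] is left of it ([weak_duality]). In terms of the slacks
[kappa_j - J_j(pi, zeta)] this reads
[rho + sum_j beta_j kappa_j <= J_0 + sum_j beta_j (kappa_j - J_j)]
([dual_objective_le]). As [beta <= 0], a pair with a positive slack in the
coordinate [j] and finite costs bounds [- beta_{n,j}], provided that the other
terms of the sum are bounded above. They are nonpositive when the pair is feasible,
which gives the first claim; in the third one those with index in [J0set] are
bounded by the first.

In the second claim the pair is optimal. If the optimal cost is at most the value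
of the dual program, then the same inequality squeezes [beta_{n,j}] between [0] and
the gap of the [n]-th dual solution divided by [- slack]. The absence of a duality gap
([no_duality_gap]) is where the conditions on the model enter, in four steps.

- A sublinear functional on all bounded functions on [X * A] is built from the
  dual certificates; a linear functional [L] below it
  ([linear_below_sublinear]) is a finitely additive state-action frequency that is
  invariant and whose costs are at most the dual value and [kappa]
  ([finitely_additive_solution]).
- From [L] a countably additive measure [gamma] is obtained, which is below [L] on
  open sets and above it on compact sets ([exists_frequency]). Since some cost is
  unbounded off the compact sets [Gam j], the finitely additive frequency is tight,
  so [gamma] is a probability measure and is above [L] on closed sets.
- [gamma] is again invariant with the same cost bounds ([invariant_frequency]).
  The costs and the kernel are regular on a closed set [D]. Off [D] and near the
  projection of [Gam j], invariance turns the majorization of the kernel into a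
  majorization of the marginal of [L] by a finite measure [nu], which makes [L]
  inner regular there. This is enough to compare the integrals of semicontinuous
  functions under [L] and [gamma] ([relax]).
- [gamma] is disintegrated into a marginal [p] and a randomized stationary policy
  ([exists_disintegration]). As [p] is invariant, the average costs of this policy
  are the integrals of the costs ([stationary_average_cost]): the policy is feasible
  and costs at most the dual value.
*)

(** * Linear functionals below sublinear ones *)

Section sublinear.
Local Open Scope ring_scope.
Context (R : realType) (V : lmodType R) (D : set V).
Hypotheses (D0 : D 0) (DD : forall x y, D x -> D y -> D (x + y))
  (DZ : forall a x, D x -> D (a *: x)).

(** Linearity is relative to a subspace [D], so that the bounded functions can
    be dealt with inside of the space of all functions. *)
Definition sublinear_on (q : V -> R) :=
  (forall x y, D x -> D y -> q (x + y) <= q x + q y) /\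
  (forall a x, 0 <= a -> D x -> q (a *: x) = a * q x).

Definition linear_on (q : V -> R) :=
  (forall x y, D x -> D y -> q (x + y) = q x + q y) /\
  (forall a x, D x -> q (a *: x) = a * q x).

Let DN x : D x -> D (- x).
Proof. by move=> Dx; rewrite -scaleN1r; exact: DZ. Qed.

Lemma sublinear_on0 q : sublinear_on q -> q 0 = 0.
Proof. by case=> _ /(_ 0 0 (lexx _) D0); rewrite scale0r mul0r. Qed.

Lemma sublinear_on_opp q x : sublinear_on q -> D x -> - q (- x) <= q x.
Proof.
move=> sq Dx; have := sublinear_on0 sq; have := sq.1 x (- x) Dx (DN Dx).
by rewrite subrr => + e; rewrite e; lra.
Qed.

(** [q'] is the infimum of [q (x + t *: x0) - t * q x0] over [t >= 0], which lowers
    [q] as much as possible in the direction [- x0]. Pinning the values off [D]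
    makes the minimality used below an equality of functions. *)
Lemma sublinear_on_directional q x0 : sublinear_on q -> D x0 ->
  exists q', [/\ sublinear_on q', (forall x, D x -> q' x <= q x),
    q' (- x0) <= - q x0 & forall x, ~ D x -> q' x = 0].
Proof.
move=> sq Dx0.
pose S x := [set q (x + t *: x0) - t * q x0 | t in [set t | 0 <= t]].
have Dt t x : D x -> D (x + t *: x0) by move=> Dx; apply: DD => //; exact: DZ.
have lbS x : D x -> lbound (S x) (- q (- x)).
  move=> Dx _ [t /= t0 <-].
  have := sq.1 (x + t *: x0) (- x) (Dt _ _ Dx) (DN Dx).
  by rewrite addrAC subrr add0r (sq.2 t x0 t0 Dx0); lra.
have S0 x : S x !=set0 by exists (q (x + 0 *: x0) - 0 * q x0); exists 0 => //=.
have hS x : D x -> has_inf (S x).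
  by move=> Dx; split => //; exists (- q (- x)); exact: lbS.
have infS x t : D x -> 0 <= t -> inf (S x) <= q (x + t *: x0) - t * q x0.
  move=> Dx t0; apply: ge_inf; first by case: (hS x Dx).
  by exists t.
pose q' x := if `[< D x >] then inf (S x) else 0.
have q'E x : D x -> q' x = inf (S x) by move=> Dx; rewrite /q' asboolT.
have sub x y : D x -> D y -> inf (S (x + y)) <= inf (S x) + inf (S y).
  move=> Dx Dy; rewrite -lerBlDr; apply: lb_le_inf => // _ [t /= t0 <-].
  rewrite lerBlDr -lerBlDl; apply: lb_le_inf => // _ [s /= s0 <-].
  rewrite lerBlDr; apply: le_trans (infS _ (t + s) (DD Dx Dy) _) _.
    exact: addr_ge0.
  have -> : x + y + (t + s) *: x0 = (x + t *: x0) + (y + s *: x0).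
    by rewrite scalerDl addrACA.
  by have := sq.1 _ _ (Dt t _ Dx) (Dt s _ Dy); lra.
have hom a x : 0 < a -> D x -> inf (S (a *: x)) <= a * inf (S x).
  move=> a0 Dx; rewrite -ler_pdivrMl//; apply: lb_le_inf => // _ [t /= t0 <-].
  rewrite ler_pdivrMl//; have := infS (a *: x) (a * t) (DZ a Dx).
  rewrite (mulr_ge0 (ltW a0) t0) => /(_ isT) /le_trans; apply.
  by rewrite -scalerA -scalerDr (sq.2 a _ (ltW a0) (Dt t x Dx)); lra.
have inf0 : inf (S 0) = 0.
  apply/eqP; rewrite eq_le; apply/andP; split.
    have := infS 0 0 D0 (lexx 0).
    by rewrite scale0r addr0 (sublinear_on0 sq) mul0r subr0.
  apply: lb_le_inf => // _ [t /= t0 <-].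
  by rewrite add0r (sq.2 t x0 t0 Dx0) subrr.
exists q'; split.
- split=> [x y Dx Dy|a x a0 Dx].
    by rewrite !q'E//; [exact: sub|exact: DD].
  rewrite !q'E//; last exact: DZ.
  move: a0; rewrite le_eqVlt => /predU1P[<-|a0].
    by rewrite scale0r mul0r inf0.
  apply/eqP; rewrite eq_le hom//=.
  have : 0 < a^-1 by rewrite invr_gt0.
  move=> /(hom _ (a *: x)) /(_ (DZ a Dx)).
  by rewrite scalerA mulVf ?gt_eqF// scale1r -ler_pdivrMl ?invr_gt0// invrK.
- move=> x Dx; rewrite q'E//; have := infS x 0 Dx (lexx 0).
  by rewrite scale0r addr0 mul0r subr0.
- rewrite q'E; last exact: DN.
  have := infS (- x0) 1 (DN Dx0) ler01.
  by rewrite scale1r addNr (sublinear_on0 sq) mul1r sub0r.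
- by move=> x Dx; rewrite /q' asboolF.
Qed.

(** The Hahn-Banach theorem. Chains of sublinear functionals are bounded below by
    their pointwise infimum, so Zorn's lemma gives a minimal sublinear functional
    below [p]; by [sublinear_on_directional] it is odd, hence linear. *)
Lemma linear_below_sublinear p : sublinear_on p ->
  exists2 L, linear_on L & forall x, D x -> L x <= p x.
Proof.
move=> sp.
pose T := {q : V -> R | [/\ sublinear_on q, forall x, D x -> q x <= p x
  & forall x, ~ D x -> q x = 0]}.
pose le_T (q q' : T) := `[< forall x, sval q' x <= sval q x >].
have lbp (q : T) x : D x -> - p (- x) <= sval q x.
  case: q => q [sq qp _] /= Dx; apply: le_trans (sublinear_on_opp sq Dx).
  by rewrite lerN2; apply: qp; exact: DN.
have [||||q qmin] := @Zorn T le_T.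
- by move=> q; apply/asboolP.
- move=> q r s /asboolP qr /asboolP rs; apply/asboolP => x.
  exact: le_trans (rs x) (qr x).
- move=> [q hq] [r hr] /asboolP /= rq /asboolP /= qr.
  have qrE : q = r by apply/funext => x; apply/eqP; rewrite eq_le rq qr.
  by rewrite qrE in hq *; congr exist; exact: Prop_irrelevance.
- move=> C totC; have [->|/set0P[q0 Cq0]] := eqVneq C set0.
    pose p0 x := if `[< D x >] then p x else 0.
    have p0E x : D x -> p0 x = p x by move=> Dx; rewrite /p0 asboolT.
    suff p0T : [/\ sublinear_on p0, forall x, D x -> p0 x <= p x
      & forall x, ~ D x -> p0 x = 0] by exists (exist _ p0 p0T).
    split.
    + split=> [x y Dx Dy|a x a0 Dx].
        by rewrite !p0E//; [exact: sp.1|exact: DD].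
      by rewrite !p0E//; [exact: sp.2|exact: DZ].
    + by move=> x Dx; rewrite p0E.
    + by move=> x Dx; rewrite /p0 asboolF.
  pose S x := [set sval q x | q in C].
  have S0 x : S x !=set0 by exists (sval q0 x); exists q0.
  pose q x := if `[< D x >] then inf (S x) else 0.
  have qE x : D x -> q x = inf (S x) by move=> Dx; rewrite /q asboolT.
  have infS x (r : T) : D x -> C r -> inf (S x) <= sval r x.
    move=> Dx Cr; apply: ge_inf; last by exists r.
    by exists (- p (- x)) => _ [s _ <-]; exact: lbp.
  suff qT : [/\ sublinear_on q, forall x, D x -> q x <= p x
      & forall x, ~ D x -> q x = 0].
    exists (exist _ q qT) => r Cr; apply/asboolP => x /=.
    have [Dx|Dx] := pselect (D x); first by rewrite qE//; exact: infS.
    by rewrite /q asboolF//; case: (r) => r' [? ? h0] /=; rewrite h0.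
  split; last by move=> x Dx; rewrite /q asboolF.
  + split=> [x y Dx Dy|a x a0 Dx].
      rewrite !qE//; last exact: DD.
      rewrite -lerBlDr; apply: lb_le_inf => // _ [r Cr <-].
      rewrite lerBlDr -lerBlDl; apply: lb_le_inf => // _ [s Cs <-].
      rewrite lerBlDr.
      have [/asboolP rs|/asboolP sr] := totC r s Cr Cs.
        apply: le_trans (infS _ s (DD Dx Dy) Cs) _.
        case: (s) rs => s' [ss ? ?] rs /=.
        by apply: le_trans (ss.1 _ _ Dx Dy) _; have := rs x => /=; lra.
      apply: le_trans (infS _ r (DD Dx Dy) Cr) _.
      case: (r) sr => s' [ss ? ?] sr /=.
      by apply: le_trans (ss.1 _ _ Dx Dy) _; have := sr y => /=; lra.
    have homC (r : T) : sval r (a *: x) = a * sval r x.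
      by case: r => r [sr ? ?] /=; exact: sr.2.
    rewrite !qE//; last exact: DZ.
    move: a0; rewrite le_eqVlt => /predU1P[a0|a0].
      rewrite -a0 scale0r mul0r (_ : S 0 = [set 0]) ?inf1//.
      apply/seteqP; split => [_ [r Cr <-]|_ ->].
        by case: (r) => r' [sr ? ?] /=; exact: sublinear_on0.
      by exists q0 => //; case: (q0) => r' [sr ? ?] /=; exact: sublinear_on0.
    apply/eqP; rewrite eq_le; apply/andP; split.
      rewrite -ler_pdivrMl//; apply: lb_le_inf => // _ [r Cr <-].
      by rewrite ler_pdivrMl// -homC; apply: infS => //; exact: DZ.
    apply: lb_le_inf => // _ [r Cr <-].
    by rewrite homC ler_pM2l//; exact: infS.
  + move=> x Dx; rewrite qE//; apply: le_trans (infS _ q0 Dx Cq0) _.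
    by case: (q0) => r [? + ?]; exact.
case: q qmin => q [sq qp q0] /= qmin.
have qN x : D x -> q (- x) = - q x.
  move=> Dx; have [q' [sq' q'q q'x q'0]] := sublinear_on_directional sq Dx.
  have q'T : [/\ sublinear_on q', forall x, D x -> q' x <= p x
      & forall x, ~ D x -> q' x = 0].
    by split => // y Dy; exact: le_trans (q'q _ Dy) (qp _ Dy).
  have /(congr1 sval) /= q'E : exist _ q' q'T = exist _ q (And3 sq qp q0) :> T.
    apply: qmin; apply/asboolP => y /=.
    by have [/q'q//|Dy] := pselect (D y); rewrite q0// q'0.
  apply/eqP; rewrite eq_le; apply/andP; split; first by rewrite -[in leLHS]q'E.
  by have := sublinear_on_opp sq Dx; lra.
exists q => //; split => [x y Dx Dy|a x Dx].
  apply/eqP; rewrite eq_le sq.1//=.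
  have := sq.1 _ _ (DN Dx) (DN Dy).
  by rewrite -opprD !qN//; [lra|exact: DD].
have [a0|a0] := leP 0 a; first exact: sq.2.
have := sq.2 (- a) x; rewrite oppr_ge0 => /(_ (ltW a0) Dx).
by rewrite scaleNr qN; [lra|exact: DZ].
Qed.

End sublinear.

(** * Measures from contents *)

Section compact_separation.
Context (T : topologicalType).
Hypothesis hT : hausdorff_space T.

Lemma compact_point_separation (K : set T) y : compact K -> ~ K y ->
  exists2 V, nbhs y V & K `<=` ~` closure V.
Proof.
move=> /compact_near_coveringP cK Ky.
pose P V := K `<=` ~` closure V.
have nP U V : U `<=` V -> P V -> P U.
  by move=> UV KV x Kx /(closureS UV); exact: KV.
apply: (iffLR (near_powerset_filter_fromP _ nP)).
apply: (cK _ (powerset_filter_from (nbhs y)) (fun V x => (~` closure V) x)).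
move=> x Kx.
have xy : x != y by apply: contra_notN Ky => /eqP <-.
have := hT; rewrite open_hausdorff => /(_ x y xy)[[A B]] /=.
rewrite !inE => -[Ax By] [oA oB AB0].
exists (A, [set V | V `<=` B]) => /=.
  split; first exact: open_nbhs_nbhs.
  apply/near_powerset_filter_fromP; first by move=> U V UV /(subset_trans UV).
  by exists B => //; exact: open_nbhs_nbhs.
move=> [x' V] [/= Ax' VB] clVx'.
have /clVx'[z [Vz Az]] : nbhs x' A by exact: open_nbhs_nbhs.
by have : (A `&` B) z; [split => //; exact: VB|rewrite AB0].
Qed.

(** Points of a compact set are replaced one at a time by the whole set: the set
    neighbourhoods of [K1] play the part of the neighbourhoods of the point. *)
Lemma compact_separation (K1 K2 : set T) : compact K1 -> compact K2 ->
    K1 `&` K2 = set0 ->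
  exists U1 U2, [/\ open U1, open U2, K1 `<=` U1, K2 `<=` U2 & U1 `&` U2 = set0].
Proof.
have [->|/set0P K1n0] := eqVneq K1 set0.
  by move=> _ _ _; exists set0, setT; split => //;
    [exact: open0|exact: openT|rewrite set0I].
have FK1 := set_nbhs_pfilter K1n0.
move=> cK1 /compact_near_coveringP cK2 K120.
pose P V := K2 `<=` ~` closure V.
have nP U V : U `<=` V -> P V -> P U.
  by move=> UV KV x Kx /(closureS UV); exact: KV.
have [U] : exists2 U, set_nbhs K1 U & K2 `<=` ~` closure U.
  apply: (iffLR (near_powerset_filter_fromP _ nP)).
  apply: (cK2 _ (powerset_filter_from (set_nbhs K1))
    (fun V x => (~` closure V) x)).
  move=> x K2x; have nK1x : ~ K1 x.
    by move=> K1x; have : (K1 `&` K2) x by []; rewrite K120.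
  have [V Vx K1V] := compact_point_separation cK1 nK1x.
  exists (V°, [set U | U `<=` ~` closure V]) => /=.
    split; first exact: nbhs_interior.
    apply/near_powerset_filter_fromP; first by move=> W U WU /(subset_trans WU).
    exists (~` closure V) => //; apply/set_nbhsP; exists (~` closure V).
    by split => //; apply: closed_openC; exact: closed_closure.
  move=> [x' W] [/= Vx' WV] clWx'; have [z [Wz Vz]] := clWx' _ (nbhs_interior Vx').
  by apply: (WV _ Wz); apply: subset_closure; exact: interior_subset.
move=> /set_nbhsP[U1 [oU1 K1U1 U1U]] K2U.
exists U1, (~` closure U); split => //.
  by apply: closed_openC; exact: closed_closure.
by apply/disjoints_subset; rewrite setCK; apply: subset_trans U1U _;
  exact: subset_closure.
Qed.

(** A compact set covered by two open sets is cut along the disjoint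
    neighbourhoods of the two remainders. *)
Lemma compact_split (K G1 G2 : set T) : compact K -> open G1 -> open G2 ->
    K `<=` G1 `|` G2 ->
  exists K1 K2, [/\ compact K1, compact K2, K1 `<=` G1, K2 `<=` G2 &
    K = K1 `|` K2].
Proof.
move=> cK oG1 oG2 KG.
have cKD G : open G -> compact (K `\` G).
  move=> oG; rewrite setDE; apply: compact_closedI => //.
  exact: open_closedC.
have [|||U1 [U2 [oU1 oU2 K1U1 K2U2 U120]]] :=
    @compact_separation (K `\` G1) (K `\` G2).
- exact: cKD.
- exact: cKD.
- by apply/seteqP; split => // x [[/KG[]]] // ? ? [].
exists (K `\` U1), (K `\` U2); split; [exact: cKD|exact: cKD| | |].
- by move=> x [Kx U1x]; apply: contrapT => G1x; apply: U1x; exact: K1U1.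
- by move=> x [Kx U2x]; apply: contrapT => G2x; apply: U2x; exact: K2U2.
- by rewrite -setDIr U120 setD0.
Qed.

End compact_separation.

(** The regular measure attached to a content. Countable additivity is recovered
    from a merely finitely additive [m] because only its values on compact sets
    are used, and a compact set meets a countable open cover in a finite one. *)
Section measure_of_content.
Context (R : realType) (T : topologicalType) (m : set T -> R).
Hypotheses (hT : hausdorff_space T)
  (m_le : forall E F, E `<=` F -> (m E <= m F)%R)
  (mU : forall E F, E `&` F = set0 -> (m (E `|` F) = m E + m F)%R).

Let m0 : m set0 = 0%R.
Proof. by have := mU (set0I set0); rewrite setU0; lra. Qed.

Let m_leU E F : (m (E `|` F) <= m E + m F)%R.
Proof.
have -> : E `|` F = E `|` (F `\` E) by rewrite setUDr setDv setD0.
rewrite mU; last by rewrite setDE setICA setICr setI0.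
by rewrite lerD2l; apply: m_le; exact: subDsetl.
Qed.

Definition inner_content (G : set T) : \bar R :=
  ereal_sup [set (m K)%:E | K in [set K | compact K /\ K `<=` G]].

Definition outer_content (E : set T) : \bar R :=
  ereal_inf [set inner_content G | G in [set G | open G /\ E `<=` G]].

Let inner_ge0 G : 0 <= inner_content G.
Proof.
apply: ereal_sup_ubound; exists set0; last by rewrite m0.
by split; [exact: compact0|].
Qed.

Let inner_ge K G : compact K -> K `<=` G -> (m K)%:E <= inner_content G.
Proof. by move=> cK KG; apply: ereal_sup_ubound; exists K. Qed.

Let inner_leP G x : (forall K, compact K -> K `<=` G -> (m K)%:E <= x) ->
  inner_content G <= x.
Proof. by move=> h; apply: ge_ereal_sup => _ [K [cK KG] <-]; exact: h. Qed.

Let inner_le G H : G `<=` H -> inner_content G <= inner_content H.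
Proof.
move=> GH; apply: inner_leP => K cK KG; apply: inner_ge => //.
exact: subset_trans GH.
Qed.

Let inner_le_m G : inner_content G <= (m G)%:E.
Proof. by apply: inner_leP => K cK KG; rewrite lee_fin; exact: m_le. Qed.

Let inner_fin G : inner_content G \is a fin_num.
Proof. by rewrite ge0_fin_numE// (le_lt_trans (inner_le_m G)) ?ltry. Qed.

Let outer_ge0 E : 0 <= outer_content E.
Proof. by apply: le_ereal_inf_tmp => _ [G _ <-]. Qed.

Let outer_le_inner E G : open G -> E `<=` G -> outer_content E <= inner_content G.
Proof. by move=> oG EG; apply: ereal_inf_lbound; exists G. Qed.

Let outerE G : open G -> outer_content G = inner_content G.
Proof.
move=> oG; apply/eqP; rewrite eq_le outer_le_inner//=.
by apply: le_ereal_inf_tmp => _ [H [oH GH] <-]; exact: inner_le.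
Qed.

Let outer_le E F : E `<=` F -> outer_content E <= outer_content F.
Proof.
move=> EF; apply: ereal_inf_le_tmp => _ [G [oG FG] <-].
by exists G => //; split => //; exact: subset_trans FG.
Qed.

Let outer_fin E : outer_content E \is a fin_num.
Proof.
by rewrite ge0_fin_numE// (le_lt_trans (outer_le (@subsetT _ E)))//
  outerE ?ltey_eq ?inner_fin//; exact: openT.
Qed.

Let outer_near E (e : R) : (0 < e)%R ->
  exists G, [/\ open G, E `<=` G & inner_content G <= outer_content E + e%:E].
Proof.
move=> e0; have [_ [G [oG EG] <-] /ltW Ge] := lb_ereal_inf_adherent e0 (outer_fin E).
by exists G.
Qed.

Let inner_near G (e : R) : (0 < e)%R ->
  exists K, [/\ compact K, K `<=` G & inner_content G <= (m K + e)%:E].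
Proof.
move=> e0; have [_ [K [cK KG] <-] /ltW Ge] := ub_ereal_sup_adherent e0 (inner_fin G).
by exists K; split => //; rewrite EFinD -leeBlDr.
Qed.

(** Finitely many of the open sets cover a given compact set, and [compact_split]
    distributes the compact set among them. *)
Let inner_sub (G : (set T)^nat) : (forall n, open (G n)) ->
  inner_content (\bigcup_n G n) <= \sum_(n <oo) inner_content (G n).
Proof.
move=> oG; apply: inner_leP => K cK KG.
have [n Kn] : exists n, K `<=` \big[setU/set0]_(i < n) G i.
  have [|n _ /(_ n (leqnn n))] := (compact_near_coveringP K).1 cK nat \oo
    (fun n x => (\big[setU/set0]_(i < n) G i) x) _.
    move=> x /KG[k _ Gkx]; exists (G k, [set n | (k < n)%N]) => /=.
      by split; [exact: open_nbhs_nbhs|exists k.+1].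
    move=> [y n] [/= Gky kn]; rewrite -bigcup_mkord; exists k => //.
  by move=> Kn; exists n.
apply: le_trans (nneseries_lim_ge n _) => //.
elim: n K cK {KG} Kn => [|n IHn] K cK.
  by rewrite big_ord0 subset0 => ->; rewrite m0 big_mkord big_ord0.
rewrite big_ord_recr/= => KG.
have [||K1 [K2 [cK1 cK2 K1G K2G ->]]] := compact_split hT cK _ _ KG.
- by rewrite -bigcup_mkord; apply: bigcup_open => i _.
- by [].
rewrite big_nat_recr//=; apply: (@le_trans _ _ ((m K1)%:E + (m K2)%:E)).
  by rewrite -EFinD lee_fin.
by apply: leeD; [exact: IHn|exact: inner_ge].
Qed.

Let outer0 : outer_content set0 = 0.
Proof.
apply/eqP; rewrite eq_le outer_ge0 andbT outerE; last exact: open0.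
by rewrite (le_trans (inner_le_m _))// m0.
Qed.

Let outer_sub : sigma_subadditive outer_content.
Proof.
move=> E; apply/lee_addgt0Pr => e e0.
have e2 n : (0 < e / (2 ^ n.+1)%:R)%R by rewrite divr_gt0// ltr0n expn_gt0.
have [G hG] := choice (fun n => @outer_near (E n) _ (e2 n)).
apply: le_trans (epsilon_trick _ _ (ltW e0)) => //.
apply: (@le_trans _ _ (inner_content (\bigcup_n G n))).
  apply: outer_le_inner; first by apply: bigcup_open => n _; have [] := hG n.
  by apply: subset_bigcup => n _; have [] := hG n.
apply: le_trans (inner_sub _) _; first by move=> n; have [] := hG n.
by apply: lee_nneseries => // n _; case: (hG n).
Qed.

HB.instance Definition _ := isOuterMeasure.Build R T outer_content
  outer0 outer_ge0 outer_le outer_sub.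

(** For [U] open around [E], a compact [K] nearly exhausts [U `&` G] and a compact
    [L] nearly exhausts the open set [U `\` K], which contains [E `\` G]; as [K] and
    [L] are disjoint, their contents add up to at most that of [U]. *)
Let outer_open G : open G -> outer_content.-caratheodory G.
Proof.
move=> oG; apply: le_caratheodory_measurable => E.
apply/lee_addgt0Pr => e e0.
have e3 : (0 < e / 3)%R by lra.
have [U [oU EU Ue]] := outer_near E e3.
have [K [cK KU Ke]] := inner_near (U `&` G) e3.
have oUK : open (U `\` K).
  rewrite setDE; apply: openI => //; apply: closed_openC.
  exact: compact_closed.
have [L [cL LU Le]] := inner_near (U `\` K) e3.
have h1 : outer_content (E `&` G) <= (m K + e / 3)%:E.
  by apply: le_trans Ke; apply: outer_le_inner; [exact: openI|exact: setSI].
have h2 : outer_content (E `&` ~` G) <= (m L + e / 3)%:E.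
  apply: le_trans Le; apply: outer_le_inner => //.
  by move=> x [/EU Ux Gx]; split => // /KU[].
have h3 : (m K + m L)%:E <= outer_content E + (e / 3)%:E.
  apply: le_trans Ue; rewrite -mU.
    apply: inner_ge; first exact: compactU.
    by move=> x [/KU[]|/LU[]].
  by apply/seteqP; split => // x [Kx /LU[]].
apply: le_trans (leeD h1 h2) _.
rewrite -EFinD (_ : _ + _ + _ = (m K + m L) + (e / 3 + e / 3))%R; last by ring.
rewrite EFinD; apply: le_trans (leeD h3 (lexx _)) _.
by rewrite -addeA -EFinD leeD2l// lee_fin; lra.
Qed.

(** Borel sets are measurable in the sense of Caratheodory, since open sets are. *)
Lemma outer_content_borel B : <<s @open T >> B -> outer_content.-caratheodory B.
Proof.
have : sigma_algebra setT outer_content.-caratheodory.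
  split; first exact: caratheodory_measurable_set0.
  - by move=> A mA; rewrite setTD; exact: caratheodory_measurable_setC.
  - by move=> F mF; exact: caratheodory_measurable_bigcup.
by move=> /smallest_sub h; apply: h => G; exact: outer_open.
Qed.

Lemma outer_content_sigma_additive (t0 : T) (F : (set T)^nat) :
  (forall n, <<s @open T >> (F n)) -> trivIset setT F ->
  (\sum_(0 <= i < n) outer_content (F i)) @[n --> \oo] -->
    outer_content (\bigcup_n F n).
Proof.
move=> bF tF; pose T' : pointedType := HB.pack (T : choiceType) (isPointed.Build T t0).
apply: (@caratheodory_measure_sigma_additive R T' outer_content).
- by move=> n; exact: outer_content_borel.
- by [].
- by apply: caratheodory_measurable_bigcup => n; exact: outer_content_borel.
Qed.

Lemma outer_content_open G : open G -> outer_content G <= (m G)%:E.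
Proof. by move=> oG; rewrite outerE//; exact: inner_le_m. Qed.

Lemma outer_content_compact K : compact K -> (m K)%:E <= outer_content K.
Proof.
by move=> cK; apply: le_ereal_inf_tmp => _ [G [oG KG] <-]; exact: inner_ge.
Qed.

Lemma outer_content0 : outer_content set0 = 0.
Proof. exact: outer0. Qed.

Lemma outer_content_ge0 E : 0 <= outer_content E.
Proof. exact: outer_ge0. Qed.

End measure_of_content.

(** * Open sets of Borel spaces *)

Section borel_space_topology.
Context (R : realType).

(** [phi] is the distance to the complement of [V], truncated at [1] as it is
    infinite when [V] is the whole space. *)
Lemma pseudometric_cozero (P : pseudoMetricType R) (V : set P) : open V ->
  exists2 phi : P -> R, continuous phi &
    forall y, (0 <= phi y <= 1)%R /\ (V y <-> (0 < phi y)%R).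
Proof.
move=> oV; pose dV := @edist_inf R P (~` V).
pose phi y := fine (mine (dV y) 1).
have dV0 y : 0 <= dV y by exact: edist_inf_ge0.
have phiE y : (phi y)%:E = mine (dV y) 1.
  rewrite fineK// ge0_fin_numE ?le_min ?dV0 ?lee01//.
  by rewrite (@le_lt_trans _ _ 1) ?ge_min ?lexx ?orbT// ltry.
exists phi.
  have lip y z (e : R) : (0 < e)%R -> ball y e z -> (phi y <= e + phi z)%R.
    move=> e0 yez; rewrite -lee_fin EFinD !phiE.
    have : dV y <= e%:E + dV z.
      apply: le_trans (edist_inf_triangle _ _ z) _; rewrite leeD2r//.
      exact: (@edist_fin _ _ e (y, z)).
    move=> dyz; have [z1|z1] := leP (dV z) 1.
      by rewrite ge_min dyz.
    by rewrite ge_min; apply/orP; right; rewrite leeDr// lee_fin ltW.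
  move=> y; apply/cvgrPdist_le => e e0.
  near=> z; have yez : ball y e z by near: z; exact: nbhsx_ballx.
  have := lip _ _ _ e0 yez; have := lip _ _ _ e0 (ball_sym yez).
  by rewrite ler_norml; lra.
move=> y; split.
  rewrite -!lee_fin phiE le_min dV0 lee01/=.
  by rewrite ge_min lexx orbT.
rewrite -lte_fin phiE lt_min lte01 andbT; split => [Vy|].
  have /nbhs_ballP[e /= e0 yeV] : nbhs y V by exact: open_nbhs_nbhs.
  apply: (@lt_le_trans _ _ e%:E); first by rewrite lte_fin.
  apply: le_ereal_inf_tmp => _ [a Va <-]; rewrite leNgt.
  by apply/negP => /edist_lt_ball /yeV.
by apply: contraPP => Vy; rewrite /dV edist_inf0// ltxx.
Unshelve. all: by end_near. Qed.

Context (X : topologicalType).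
Hypothesis X_borel : borel_space R X.

Lemma borel_space_hausdorff : hausdorff_space X.
Proof.
have [P [B [f [g [[hP _] _ [cf _] _ [gf _]]]]]] := X_borel.
move=> x y xy; rewrite -(gf x) -(gf y); congr g; apply: hP => U V Ux Vy.
have [z [Uz Vz]] := xy _ _ (cf x _ Ux) (cf y _ Vy).
by exists (f z).
Qed.

(** An open set of [X] is the trace of an open set of the ambient space, from
    which a function positive exactly on it can be pulled back. *)
Lemma borel_space_cozero (G : set X) : open G ->
  exists2 phi : X -> R, continuous phi &
    forall x, (0 <= phi x <= 1)%R /\ (G x <-> (0 < phi x)%R).
Proof.
have [P [B [f [g [_ _ [cf Bf] cg [gf _]]]]]] := X_borel.
move=> oG; have : open (g @^-1` G : set (subspace B)).
  by move/continuousP : cg; exact.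
move=> /open_subspaceP[V oV VB].
have GV x : G x <-> V (f x).
  have : (V `&` B) (f x) <-> ((g @^-1` G) `&` B) (f x) by rewrite VB.
  rewrite /setI/= gf; have := Bf x; tauto.
have [phi cphi hphi] := pseudometric_cozero oV.
exists (phi \o f) => [x|x]; first by apply: continuous_comp; [exact: cf|exact: cphi].
by have [? Vphi] := hphi (f x); split => //; rewrite -Vphi.
Qed.

End borel_space_topology.

(** * Expectations along the histories *)

Section mixture.
Context (R : realType) (d d' : measure_display)
  (Y : measurableType d) (Z : measurableType d').
Variables (k : Y -> {measure set Z -> \bar R}).
Hypothesis mk : forall U, measurable U -> measurable_fun [set: Y] (k ^~ U).
Hypothesis k1 : forall y, k y setT = 1.

Let k' (u : unit * Y) : {measure set Z -> \bar R} := k u.2.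

Let measurable_k' U : measurable U -> measurable_fun [set: unit * Y] (k' ^~ U).
Proof.
by move=> mU; exact: (measurableT_comp (mk mU) measurable_snd).
Qed.

HB.instance Definition _ := isKernel.Build _ _ _ _ R k' measurable_k'.

Let k'_setT u : k' u setT = 1.
Proof. exact: k1. Qed.

HB.instance Definition _ := Kernel_isProbability.Build _ _ _ _ R k' k'_setT.

(** [rho] is the composition of the constant kernel [P] with [k]. *)
Lemma ge0_integral_mixture (P : probability Y R) (rho : {measure set Z -> \bar R})
    (f : Z -> \bar R) :
  (forall B, measurable B -> rho B = \int[P]_y k y B) ->
  (forall z, 0 <= f z) -> measurable_fun [set: Z] f ->
  \int[rho]_z f z = \int[P]_y \int[k y]_z f z.
Proof.
move=> rhoE f0 mf.
pose l := kprobability (measurable_cst (P : pprobability Y R) : measurable_fun [set: unit] _).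
transitivity (\int[kcomp l k' tt]_z f z).
  by apply: eq_measure_integral => B mB _; rewrite rhoE.
exact: (@integral_kcomp _ _ _ _ _ _ _ l k').
Qed.

End mixture.

Section history_laws.
Context (R : realType) (dX dA : measure_display)
  (X : borelMeasurableType dX) (A : discreteBorelMeasurableType dA)
  (d : nat) (M : cmdp R X A d).

Lemma integral_init_law (zeta : probability X R) (f : history X A 0 -> \bar R) :
  (forall w, 0 <= f w) -> measurable_fun [set: history X A 0] f ->
  \int[init_law zeta]_w f w = \int[zeta]_x f (@init_history _ _ X A x).
Proof.
move=> f0 mf.
exact: (ge0_integral_pushforward (@measurable_init_history _ _ X A) zeta
  measurableT mf).
Qed.

Lemma integral_stage n (z : history X A n * A) (f : history X A n.+1 -> \bar R) :
  (forall w, 0 <= f w) -> measurable_fun [set: history X A n.+1] f ->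
  \int[stage_kernel M z]_w f w =
  \int[transition M (z.1.2, z.2)]_y f (extend_history z.1 z.2 y).
Proof.
move=> f0 mf.
have me : measurable_fun [set: X] (fun y : X => extend_history z.1 z.2 y).
  exact: (measurableT_comp (@measurable_extend_history _ _ X A n)
    (pair1_measurable z)).
exact: (ge0_integral_pushforward me (transition M (z.1.2, z.2)) measurableT mf).
Qed.

(** The law of the history one step later is the mixture, over the present
    history, of the kernel composed of the decision and the transition. *)
Lemma integral_history_lawS (pi : policy M) (zeta : probability X R) n
    (f : history X A n.+1 -> \bar R) :
  (forall w, 0 <= f w) -> measurable_fun [set: history X A n.+1] f ->
  \int[history_law pi zeta n.+1]_w f w =
  \int[history_law pi zeta n]_w \int[pi n w]_a
    \int[transition M (w.2, a)]_y f (extend_history w a y).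
Proof.
move=> f0 mf.
pose k := @stage_kernel _ _ _ X A _ M n : R.-sfker _ ~> _.
pose l := pi n : R.-sfker _ ~> _.
rewrite (@ge0_integral_mixture _ _ _ _ _ (mkcomp l k) _ _ (history_law pi zeta n))//.
- apply: eq_integral => w _; rewrite (integral_kcomp l k)//.
  by apply: eq_integral => a _; rewrite integral_stage.
- exact: (measurable_kernel (mkcomp l k)).
- move=> w; rewrite /mkcomp/= /kcomp (eq_integral (cst 1)) => [|a _]; last exact: prob_kernel.
  by rewrite integral_cst// mul1e prob_kernel.
Qed.

End history_laws.

Section action_expectation.
Context (R : realType) (dX dA : measure_display)
  (X : borelMeasurableType dX) (A : discreteBorelMeasurableType dA)
  (d : nat) (M : cmdp R X A d) (pi : policy M) (zeta : probability X R).

(** The expectation of [g (x_n, a_n)]; the action taken at time [n] is not yet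
    part of the history at time [n]. *)
Definition action_expectation n (g : X * A -> \bar R) : \bar R :=
  \int[history_law pi zeta n]_w \int[pi n w]_a g (w.2, a).

Lemma discrete_measurable (B : set A) : measurable B.
Proof.
rewrite measurable_borelE; apply: sub_sigma_algebra => /=.
exact: discrete_open.
Qed.

Lemma measurable_state_action n :
  measurable_fun [set: history X A n * A] (fun z => (z.1.2, z.2) : X * A).
Proof.
apply: measurable_fun_pair; last exact: measurable_snd.
apply: (@measurableT_comp _ _ _ _ _ _ (fun w : history X A n => w.2)).
  exact: measurable_snd.
exact: measurable_fst.
Qed.

Lemma measurable_state n : measurable_fun [set: history X A n] (fun w => w.2).
Proof. exact: measurable_snd. Qed.

Section fixed_time.
Variable n : nat.

Lemma measurable_action_integral (g : X * A -> \bar R) : (forall z, 0 <= g z) ->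
  measurable_fun [set: X * A] g ->
  measurable_fun [set: history X A n] (fun w => \int[pi n w]_a g (w.2, a)).
Proof.
move=> g0 mg.
exact: (@measurable_fun_integral_finite_kernel _ _ _ _ _
  (fun z => g (z.1.2, z.2)) (pi n) (fun=> g0 _)
  (measurableT_comp mg (@measurable_state_action n))).
Qed.

Lemma measurable_action_section (g : X * A -> \bar R) (x : X) :
  measurable_fun [set: A] (fun a => g (x, a)).
Proof. by move=> _ B mB; exact: discrete_measurable. Qed.

Lemma action_expectationD g1 g2 :
  (forall z, 0 <= g1 z) -> (forall z, 0 <= g2 z) ->
  measurable_fun [set: X * A] g1 -> measurable_fun [set: X * A] g2 ->
  action_expectation n (fun z => g1 z + g2 z) =
  action_expectation n g1 + action_expectation n g2.
Proof.
move=> g10 g20 mg1 mg2; rewrite /action_expectation -ge0_integralD//.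
- apply: eq_integral => w _; rewrite ge0_integralD//;
    exact: measurable_action_section.
- by move=> w _; exact: integral_ge0.
- exact: measurable_action_integral.
- by move=> w _; exact: integral_ge0.
- exact: measurable_action_integral.
Qed.

Lemma action_expectationZ (r : R) g :
  (0 <= r)%R -> (forall z, 0 <= g z) -> measurable_fun [set: X * A] g ->
  action_expectation n (fun z => r%:E * g z) = r%:E * action_expectation n g.
Proof.
move=> r0 g0 mg; rewrite /action_expectation -ge0_integralZl//.
- apply: eq_integral => w _; rewrite ge0_integralZl//.
  exact: measurable_action_section.
- exact: measurable_action_integral.
- by move=> w _; exact: integral_ge0.
Qed.

Lemma action_expectation_sum I (s : seq I) (g : I -> X * A -> \bar R) :
  (forall i z, 0 <= g i z) -> (forall i, measurable_fun [set: X * A] (g i)) ->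
  action_expectation n (fun z => \sum_(i <- s) g i z) =
  \sum_(i <- s) action_expectation n (g i).
Proof.
move=> g0 mg; rewrite /action_expectation -ge0_integral_sum//.
- apply: eq_integral => w _; rewrite ge0_integral_sum// => i.
  exact: measurable_action_section.
- by move=> i; exact: measurable_action_integral.
- by move=> i w _; exact: integral_ge0.
Qed.

Lemma action_expectation_cst r : action_expectation n (cst r) = r.
Proof.
rewrite /action_expectation (eq_integral (cst r)).
  rewrite integral_cst// -[RHS]mule1; congr (_ * _).
  exact: (probability_setT (history_law pi zeta n)).
by move=> w _; rewrite integral_cst// prob_kernel mule1.
Qed.

Lemma action_expectation_state (g : X -> \bar R) :
  action_expectation n (fun z => g z.1) =
  \int[history_law pi zeta n]_w g w.2.
Proof.
by apply: eq_integral => w _ /=; rewrite integral_cst// prob_kernel mule1.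
Qed.

Lemma action_expectation_next (g : X -> \bar R) :
  (forall x, 0 <= g x) -> measurable_fun [set: X] g ->
  action_expectation n (fun z => \int[transition M z]_y g y) =
  \int[history_law pi zeta n.+1]_w g w.2.
Proof.
move=> g0 mg; rewrite integral_history_lawS//.
exact: (measurableT_comp mg (@measurable_state n.+1)).
Qed.

(** A policy is carried by the admissible pairs, so inequalities are only
    needed on their graph. *)
Lemma le_action_expectation g1 g2 :
  (forall z, 0 <= g1 z) -> (forall z, 0 <= g2 z) ->
  measurable_fun [set: X * A] g1 -> measurable_fun [set: X * A] g2 ->
  (forall z, adm_graph M z -> g1 z <= g2 z) ->
  action_expectation n g1 <= action_expectation n g2.
Proof.
move=> g10 g20 mg1 mg2 g12; apply: ge0_le_integral => //.
- by move=> w _; exact: integral_ge0.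
- exact: measurable_action_integral.
- exact: measurable_action_integral.
move=> w _; apply: ae_ge0_le_integral => //.
- exact: measurable_action_section.
- exact: measurable_action_section.
exists (~` adm M w.2); split; first exact: discrete_measurable.
- transitivity (kernel_value (pi n) w (~` adm M w.2)); first by [].
  rewrite probability_setC; last exact: discrete_measurable.
  by rewrite [X in 1 - X](decision_adm pi w) subee.
- by apply: subsetC => a wa _; exact: g12.
Qed.

End fixed_time.

Lemma expected_cost0 i : expected_cost i pi zeta 0 = 0.
Proof. by apply: integral0_eq => w _; rewrite big_ord0. Qed.

(** Given the history at time [n], the past costs are constants. *)
Lemma expected_costS i n : expected_cost i pi zeta n.+1 =
  expected_cost i pi zeta n + action_expectation n (cost M i).
Proof.
have c0 := @cost_ge0 _ _ _ _ _ _ M i.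
have mc := @measurable_cost _ _ _ _ _ _ M i.
have mS m : measurable_fun [set: history X A m]
    (fun w => \sum_(k < m) cost M i (tnth w.1 k)).
  apply: emeasurable_sum => k; apply: (measurableT_comp mc).
  by apply: (measurableT_comp (measurable_tnth k)); exact: measurable_fst.
have S0 m (w : history X A m) : 0 <= \sum_(k < m) cost M i (tnth w.1 k).
  exact: sume_ge0.
rewrite {1}/expected_cost integral_history_lawS// /expected_cost.
rewrite /action_expectation -ge0_integralD//; last 2 first.
- by move=> w _; exact: integral_ge0.
- exact: measurable_action_integral.
apply: eq_integral => w _.
transitivity (\int[pi n w]_a (\sum_(k < n) cost M i (tnth w.1 k) + cost M i (w.2, a))).
  apply: eq_integral => a _; rewrite (eq_integral (cst
    (\sum_(k < n) cost M i (tnth w.1 k) + cost M i (w.2, a)))) => [|y _].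
    by rewrite integral_cst// prob_kernel mule1.
  rewrite big_ord_recr/=; congr (_ + cost M i _).
    apply: eq_bigr => k _; congr (cost M i _).
    by rewrite !(tnth_nth (w.2, a))/= nth_rcons size_tuple ltn_ord.
  by rewrite (tnth_nth (w.2, a))/= nth_rcons size_tuple ltnn eqxx.
rewrite ge0_integralD//; last exact: measurable_action_section.
by rewrite integral_cst// prob_kernel mule1.
exact: mS.
Qed.

Lemma expected_cost_ge0 i n : 0 <= expected_cost i pi zeta n.
Proof. by apply: integral_ge0 => w _; apply: sume_ge0 => k _; exact: cost_ge0. Qed.


(** Integrating the dual inequality along the first [n] stages; splitting the
    constant as [r1 - r2] keeps every term nonnegative, hence integrable in
    the extended sense. *)
Lemma telescoped_inequality (r1 r2 : R) (h : X -> \bar R) (l : 'I_d.+1 -> R) n :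
  (0 <= r1)%R -> (0 <= r2)%R -> (forall x, 0 <= h x) ->
  measurable_fun [set: X] h -> (forall i, 0 <= l i)%R ->
  (forall z, adm_graph M z -> r1%:E + h z.1 <=
    r2%:E + \int[transition M z]_y h y + \sum_(i < d.+1) (l i)%:E * cost M i z) ->
  (n%:R * r1)%:E + \int[history_law pi zeta 0]_w h w.2 <=
  (n%:R * r2)%:E + \int[history_law pi zeta n]_w h w.2 +
    \sum_(i < d.+1) (l i)%:E * expected_cost i pi zeta n.
Proof.
move=> r10 r20 h0 mh l0 hle.
have mq : measurable_fun [set: X * A] (fun z => \int[transition M z]_y h y).
  apply: (@measurable_fun_integral_kernel _ _ _ _ _ (transition M)) => //.
  by move=> U mU; exact: (measurable_kernel (transition M) U mU).
have mlc i : measurable_fun [set: X * A] (fun z => (l i)%:E * cost M i z).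
  by apply: measurable_funeM; exact: measurable_cost.
have lc0 i z : 0 <= (l i)%:E * cost M i z.
  by apply: mule_ge0; [rewrite lee_fin|exact: cost_ge0].
have step m : r1%:E + \int[history_law pi zeta m]_w h w.2 <=
    r2%:E + \int[history_law pi zeta m.+1]_w h w.2 +
    \sum_(i < d.+1) (l i)%:E * action_expectation m (cost M i).
  rewrite -action_expectation_state -action_expectation_next//.
  rewrite -{1}(action_expectation_cst m r1%:E) -{1}(action_expectation_cst m r2%:E).
  have -> : \sum_(i < d.+1) (l i)%:E * action_expectation m (cost M i) =
      action_expectation m (fun z => \sum_(i < d.+1) (l i)%:E * cost M i z).
    rewrite action_expectation_sum//; apply: eq_bigr => i _.
    rewrite action_expectationZ//; first by move=> z; exact: cost_ge0.
    exact: measurable_cost.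
  have q0 z : 0 <= \int[transition M z]_y h y by exact: integral_ge0.
  have s0 z : 0 <= \sum_(i < d.+1) (l i)%:E * cost M i z by exact: sume_ge0.
  have ms : measurable_fun [set: X * A]
    (fun z => \sum_(i < d.+1) (l i)%:E * cost M i z) by exact: emeasurable_sum.
  have mh1 : measurable_fun [set: X * A] (fun z => h z.1).
    exact: (measurableT_comp mh measurable_fst).
  have mrq : measurable_fun [set: X * A]
      (fun z => cst r2%:E z + \int[transition M z]_y h y).
    exact: emeasurable_funD.
  have rq0 z : 0 <= cst r2%:E z + \int[transition M z]_y h y.
    by apply: adde_ge0 => //=; rewrite lee_fin.
  rewrite -!action_expectationD//.
  apply: le_action_expectation => //.
  - by move=> z; apply: adde_ge0 => //=; rewrite lee_fin.
  - by move=> z; apply: adde_ge0.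
  - exact: emeasurable_funD.
  - exact: emeasurable_funD.
elim: n => [|n IHn].
  rewrite !mul0r !add0e leeDl// sume_ge0// => i _.
  by apply: mule_ge0; [rewrite lee_fin|exact: expected_cost_ge0].
have e0 := expected_cost_ge0.
have a0 m i : 0 <= action_expectation m (cost M i).
  by apply: integral_ge0 => w _; apply: integral_ge0 => a _; exact: cost_ge0.
have -> : \sum_(i < d.+1) (l i)%:E * expected_cost i pi zeta n.+1 =
    \sum_(i < d.+1) (l i)%:E * expected_cost i pi zeta n +
    \sum_(i < d.+1) (l i)%:E * action_expectation n (cost M i).
  rewrite -big_split/=; apply: eq_bigr => i _.
  by rewrite expected_costS ge0_muleDr.
rewrite -natr1 !mulrDl !mul1r 2!EFinD.
set a := (n%:R * r1)%:E; set b := (n%:R * r2)%:E.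
set S := \sum_(i < d.+1) (l i)%:E * expected_cost i pi zeta n.
set T := \sum_(i < d.+1) _.
move: IHn (step n); rewrite -/a -/b -/S -/T.
move: a b S T (\int[history_law pi zeta n.+1]_w h w.2) => a b S T En1.
move: (\int[history_law pi zeta n]_w h w.2) => En.
move: (\int[history_law pi zeta 0]_w h w.2) => E0 IHn stepn.
rewrite (addeC a) -addeA; apply: le_trans (leeD (lexx _) IHn) _.
rewrite (_ : r1%:E + (b + En + S) = (r1%:E + En) + (b + S)); last first.
  by rewrite (addeC b) -!addeA.
apply: le_trans (leeD stepn (lexx _)) _.
by rewrite -!addeA (addeC T) -addeA [En1 + _]addeCA [r2%:E + _]addeCA.
Qed.

End action_expectation.

(** * Weak duality *)

Lemma bounded_integrable (R : realType) d (T : measurableType d)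
    (mu : probability T R) (h : T -> R) :
  measurable_fun [set: T] h -> bounded_fun h ->
  mu.-integrable [set: T] (EFin \o h).
Proof.
move=> mh bh; apply: measurable_bounded_integrable => //.
  by rewrite (le_lt_trans (@probability_le1 _ _ _ mu _ measurableT))// ltry.
Qed.

Lemma integral_shift (R : realType) d (T : measurableType d)
    (mu : probability T R) (h : T -> R) (c : R) :
  measurable_fun [set: T] h -> bounded_fun h ->
  \int[mu]_x (h x + c)%:E = \int[mu]_x (h x)%:E + c%:E.
Proof.
move=> mh bh.
under eq_integral do rewrite EFinD.
rewrite integralD//=; last 2 first.
- exact: bounded_integrable.
- exact: finite_measure_integrable_cst.
rewrite integral_cst//; congr (_ + _); rewrite -[RHS]mule1; congr (_ * _).
exact: (probability_setT mu).
Qed.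

Lemma bounded_funP (T : Type) (R : realType) (h : T -> R) :
  bounded_fun h <-> exists2 H : R, (0 <= H)%R & forall x, (`|h x| <= H)%R.
Proof.
split=> [[H [_ /(_ (`|H| + 1)%R) hH]]|[H H0 hH]].
  exists (`|H| + 1)%R; first by rewrite addr_ge0.
  by move=> x; apply: hH => //; rewrite (le_lt_trans (ler_norm H))// ltrDl.
exists H; split => [|M HM x _]; first exact: num_real.
by apply: (le_trans (hH x)); exact: ltW.
Qed.

Lemma limn_esup_near (R : realType) (u : (\bar R)^nat) (l : R) :
  limn_esup u < l%:E -> exists N, forall n, (N <= n)%N -> u n <= l%:E.
Proof.
rewrite /limn_esup limf_esupE => /ereal_inf_lt[_ [V [N _ NV] <-] /ltW Vl].
exists N => n Nn; apply: le_trans Vl; apply: ereal_sup_ubound.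
by exists n => //; exact: NV.
Qed.

Section weak_duality.
Context (R : realType) (dX dA : measure_display)
  (X : borelMeasurableType dX) (A : discreteBorelMeasurableType dA)
  (d : nat) (M : cmdp R X A d) (pi : policy M) (zeta : probability X R).

Lemma average_cost_ge0 i : 0 <= average_cost i pi zeta.
Proof.
rewrite /average_cost /limn_esup limf_esup_ge0// => n.
by apply: mule_ge0; [rewrite lee_fin|exact: expected_cost_ge0].
Qed.

(** By [telescoped_inequality], [n * r] is at most a constant plus the weighted
    costs of the first [n] stages; dividing by [n], each average cost is eventually
    below any bound larger than its upper limit. *)
Lemma weak_duality (r : R) (h : X -> R) (l : 'I_d.+1 -> R) :
  measurable_fun [set: X] h -> bounded_fun h -> (forall i, 0 <= l i)%R ->
  (forall i, average_cost i pi zeta < +oo) ->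
  (forall z, adm_graph M z -> r%:E + (h z.1)%:E <=
    \int[transition M z]_y (h y)%:E + \sum_(i < d.+1) (l i)%:E * cost M i z) ->
  (r <= \sum_(i < d.+1) l i * fine (average_cost i pi zeta))%R.
Proof.
move=> mh /[dup] bh /bounded_funP[H H0 hH] l0 Jfin hle.
have Jfn i : average_cost i pi zeta \is a fin_num.
  by rewrite ge0_fin_numE// average_cost_ge0.
(* [r] is split into its positive and negative parts and [h] is shifted by its
   bound [H], so that all the integrands become nonnegative. *)
pose r1 := Num.max r 0%R; pose r2 := Num.max (- r)%R 0%R.
have r12 : r = (r1 - r2)%R by rewrite /r1 /r2 /Order.max/=; case: (ltP r 0%R); case: (ltP (- r)%R 0%R); lra.
have r10 : (0 <= r1)%R by rewrite /r1 le_max lexx orbT.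
have r20 : (0 <= r2)%R by rewrite /r2 le_max lexx orbT.
have hH' x : (0 <= h x + H <= 2 * H)%R.
  by have := hH x; rewrite ler_norml; lra.
have mhH : measurable_fun [set: X] (fun x => (h x + H)%:E).
  by apply/measurable_EFinP; exact: measurable_funD.
have bound n : (n%:R * r)%:E <=
    (2 * H)%:E + \sum_(i < d.+1) (l i)%:E * expected_cost i pi zeta n.
  have h'0 x : 0 <= (h x + H)%:E by rewrite lee_fin; case/andP: (hH' x).
  have hle' z : adm_graph M z -> r1%:E + (h z.1 + H)%:E <=
      r2%:E + \int[transition M z]_y (h y + H)%:E +
      \sum_(i < d.+1) (l i)%:E * cost M i z.
    move=> Gz.
    have -> : \int[transition M z]_y (h y + H)%:E =
        \int[transition M z]_y (h y)%:E + H%:E.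
      exact: (integral_shift (kernel_value (transition M) z) H mh bh).
    have e : (r2 + H)%:E + (r%:E + (h z.1)%:E) = r1%:E + (h z.1 + H)%:E.
      by rewrite -!EFinD r12; congr (_%:E); ring.
    move: (hle z Gz) => /(leeD2l (r2 + H)%:E); rewrite e => /le_trans; apply.
    move: (\int[_]_y _) (\sum_(i < _) _) => q S.
    by rewrite (EFinD r2 H) -!addeA leeD2l// addeCA.
  have := telescoped_inequality pi zeta n r10 r20 h'0 mhH l0 hle'.
  have En : \int[history_law pi zeta n]_w (h w.2 + H)%:E <= (2 * H)%:E.
    apply: (@le_trans _ _ (\int[history_law pi zeta n]_w (cst (2 * H)%:E w))).
      apply: ge0_le_integral => //.
      - exact: (measurableT_comp mhH (@measurable_state _ _ X A n)).
      - by move=> w _; rewrite lee_fin; case/andP: (hH' w.2).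
    rewrite integral_cst// -[leRHS]mule1 le_eqVlt; apply/orP; left; apply/eqP.
    by congr (_ * _); exact: (probability_setT (history_law pi zeta n)).
  have E0 : 0 <= \int[history_law pi zeta 0]_w (h w.2 + H)%:E.
    exact: integral_ge0.
  rewrite {1}r12 mulrBr EFinB leeBlDl// => T.
  apply: (@le_trans _ _ ((n%:R * r1)%:E + \int[history_law pi zeta 0]_w (h w.2 + H)%:E)).
    by rewrite leeDl.
  by apply: (le_trans T); rewrite -addeA; apply: leeD => //; exact: leeD.
apply/ler_addgt0Pr => e e0.
pose L := (\sum_(i < d.+1) l i + 1)%R.
have L0 : (0 < L)%R by rewrite /L ltr_wpDl// sumr_ge0.
pose e' := (e / 2 / L)%R.
have e'0 : (0 < e')%R by rewrite !divr_gt0.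
have hN i : exists N, forall n, (N <= n)%N ->
    (n%:R^-1)%:E * expected_cost i pi zeta n <=
    (fine (average_cost i pi zeta) + e')%:E.
  apply: (@limn_esup_near _
    (fun n => (n%:R^-1)%:E * expected_cost i pi zeta n)).
  by rewrite -[limn_esup _]/(average_cost i pi zeta) EFinD fineK// lteDl// lte_fin.
have [N hN'] := choice hN.
pose n := (maxn (\max_i N i) (Num.truncn (4 * H / e)).+1)%N.
have n0 : (0 < n)%N by rewrite /n leq_max orbT.
have nr0 : (0 < n%:R :> R)%R by rewrite ltr0n.
have nH : (2 * H <= n%:R * (e / 2))%R.
  have : (4 * H / e <= n%:R)%R.
    apply: le_trans (ltW (truncnS_gt _)) _.
    by rewrite ler_nat leq_max leqnn orbT.
  by rewrite ler_pdivrMr//; lra.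
have ec i : expected_cost i pi zeta n <=
    (n%:R * (fine (average_cost i pi zeta) + e'))%:E.
  have := hN' i n; rewrite leq_max (leq_bigmax i) => /(_ isT).
  by rewrite muleC lee_pdivrMr// muleC EFinM.
have := bound n.
have : \sum_(i < d.+1) (l i)%:E * expected_cost i pi zeta n <=
    (\sum_(i < d.+1) l i * (n%:R * (fine (average_cost i pi zeta) + e')))%:E.
  rewrite -sumEFin; apply: lee_sum => i _; rewrite EFinM.
  by apply: lee_wpmul2l => //; rewrite lee_fin.
move=> hs /le_trans /(_ (leeD (lexx _) hs)).
rewrite -EFinD lee_fin => hb.
rewrite -(ler_pM2l nr0); apply: (le_trans hb).
have -> : (\sum_(i < d.+1) l i * (n%:R * (fine (average_cost i pi zeta) + e')) =
    n%:R * (\sum_(i < d.+1) l i * fine (average_cost i pi zeta) +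
      (\sum_(i < d.+1) l i) * e'))%R.
  rewrite mulr_suml -big_split/= mulr_sumr; apply: eq_bigr => i _; ring.
have : ((\sum_(i < d.+1) l i) * e' <= e / 2)%R.
  rewrite (_ : e / 2 = L * e')%R; last by rewrite /e' mulrCA divff ?mulr1// gt_eqF.
  by rewrite ler_pM2r// /L lerDl.
move=> he; rewrite -(ler_pM2l nr0) in he.
by lra.
Qed.

End weak_duality.

Lemma feasible_finite (R : realType) (dX dA : measure_display)
  (X : borelMeasurableType dX) (A : discreteBorelMeasurableType dA)
  (d : nat) (M : cmdp R X A d) (pi : policy M) (zeta : probability X R) i :
  feasible M (pi, zeta) -> average_cost i pi zeta < +oo.
Proof.
case=> J0 Jk; have [j ->|->//] := unliftP ord0 i.
by apply: le_lt_trans (Jk j) _; rewrite ltry.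
Qed.

(** * A finitely additive solution of the primal program *)

Lemma bounded_funD (T : Type) (R : realType) (f g : T -> R) :
  bounded_fun f -> bounded_fun g -> bounded_fun (f \+ g)%R.
Proof.
move=> /bounded_funP[F F0 hF] /bounded_funP[G G0 hG]; apply/bounded_funP.
exists (F + G)%R; first exact: addr_ge0.
by move=> x; apply: le_trans (ler_normD _ _) _; exact: lerD.
Qed.

Lemma bounded_funZ (T : Type) (R : realType) (a : R) (f : T -> R) :
  bounded_fun f -> bounded_fun (fun x => a * f x)%R.
Proof.
move=> /bounded_funP[F F0 hF]; apply/bounded_funP.
exists (`|a| * F)%R; first exact: mulr_ge0.
by move=> x; rewrite normrM ler_wpM2l.
Qed.

Lemma bounded_fun_cst (T : Type) (R : realType) (a : R) :
  bounded_fun (fun _ : T => a).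
Proof. by apply/bounded_funP; exists `|a|%R. Qed.

Lemma bounded_fun_indic (T : Type) (R : realType) (E : set T) :
  bounded_fun (\1_E : T -> R).
Proof.
by apply/bounded_funP; exists 1%R => // z; rewrite indicE ger0_norm// lern1 leq_b1.
Qed.

#[local] Hint Resolve bounded_fun_indic : core.

Section transition_operator.
Context (R : realType) (dX dA : measure_display)
  (X : borelMeasurableType dX) (A : discreteBorelMeasurableType dA)
  (d : nat) (M : cmdp R X A d).

Definition transition_op (h : X -> R) (z : X * A) : R :=
  fine (\int[transition M z]_y (h y)%:E).

Lemma transition_opE (h : X -> R) z : measurable_fun [set: X] h -> bounded_fun h ->
  \int[transition M z]_y (h y)%:E = (transition_op h z)%:E.
Proof.
move=> mh bh; rewrite fineK//; apply: integrable_fin_num => //.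
exact: (@bounded_integrable _ _ _ (kernel_value (transition M) z)).
Qed.

Lemma transition_opD (h1 h2 : X -> R) z :
  measurable_fun [set: X] h1 -> bounded_fun h1 ->
  measurable_fun [set: X] h2 -> bounded_fun h2 ->
  transition_op (h1 \+ h2)%R z = (transition_op h1 z + transition_op h2 z)%R.
Proof.
move=> mh1 bh1 mh2 bh2; apply: EFin_inj.
rewrite -transition_opE; [|exact: measurable_funD|exact: bounded_funD].
rewrite EFinD -!transition_opE//.
exact: (@integralD_EFin _ _ _ (kernel_value (transition M) z) _ measurableT
  _ _ (bounded_integrable (kernel_value (transition M) z) mh1 bh1)
  (bounded_integrable (kernel_value (transition M) z) mh2 bh2)).
Qed.

Lemma transition_opZ (a : R) (h : X -> R) z : measurable_fun [set: X] h -> bounded_fun h ->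
  transition_op (fun x => a * h x)%R z = (a * transition_op h z)%R.
Proof.
move=> mh bh; apply: EFin_inj.
rewrite -transition_opE; [|exact: measurable_funM|exact: bounded_funZ].
rewrite EFinM -transition_opE//.
under eq_integral do rewrite EFinM.
exact: (integralZl measurableT
  (bounded_integrable (kernel_value (transition M) z) mh bh)).
Qed.

Lemma transition_op_cst (a : R) z : transition_op (fun=> a) z = a.
Proof.
by rewrite /transition_op (integral_cst (transition M z) measurableT a%:E)
  prob_kernel mule1.
Qed.

Lemma le_transition_op (h1 h2 : X -> R) z :
  measurable_fun [set: X] h1 -> bounded_fun h1 ->
  measurable_fun [set: X] h2 -> bounded_fun h2 ->
  (forall x, h1 x <= h2 x)%R -> (transition_op h1 z <= transition_op h2 z)%R.
Proof.
move=> mh1 bh1 mh2 bh2 h12; rewrite -lee_fin -!transition_opE//.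
apply: (@le_integral _ _ _ (kernel_value (transition M) z)) => //.
- exact: bounded_integrable.
- exact: bounded_integrable.
- by move=> x _; rewrite lee_fin.
Qed.

Lemma bounded_transition_op (h : X -> R) : measurable_fun [set: X] h ->
  bounded_fun h -> bounded_fun (transition_op h).
Proof.
move=> mh /[dup] bh /bounded_funP[H H0 hH]; apply/bounded_funP; exists H => // z.
have [H1 H2] : (forall x, - H <= h x)%R /\ (forall x, h x <= H)%R.
  by split=> x; have := hH x; rewrite ler_norml => /andP[].
rewrite ler_norml; apply/andP; split.
  by rewrite -[leLHS](transition_op_cst _ z); apply: le_transition_op => //;
    exact: bounded_fun_cst.
by rewrite -[leRHS](transition_op_cst _ z); apply: le_transition_op => //;
  exact: bounded_fun_cst.
Qed.

(** Adding the bound [H] of [h] reduces the claim to nonnegative integrands. *)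
Lemma measurable_transition_op (h : X -> R) : measurable_fun [set: X] h -> bounded_fun h ->
  measurable_fun [set: X * A] (transition_op h).
Proof.
move=> mh /[dup] bh /bounded_funP[H H0 hH].
have -> : transition_op h =
    fun z => (fine (\int[transition M z]_y (h y + H)%:E) - H)%R.
  apply/funext => z; have -> : \int[transition M z]_y (h y + H)%:E =
      \int[transition M z]_y (h y)%:E + H%:E.
    exact: (integral_shift (kernel_value (transition M) z) H mh bh).
  by rewrite transition_opE//= addrK.
apply: measurable_funB => //; apply: measurableT_comp => //.
apply: (@measurable_fun_integral_kernel _ _ _ _ _ (transition M)).
- by move=> U mU; exact: (measurable_kernel (transition M) U mU).
- by move=> y; rewrite lee_fin; have := hH y; rewrite ler_norml; lra.
- by apply/measurable_EFinP; exact: measurable_funD.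
Qed.

End transition_operator.

Section finitely_additive_solution.
Context (R : realType) (dX dA : measure_display)
  (X : borelMeasurableType dX) (A : discreteBorelMeasurableType dA)
  (d : nat) (M : cmdp R X A d) (V : R).
Hypothesis M_feasible : feasible M !=set0.
Hypothesis dual_le : forall rho h beta,
  dual_feasible M rho h beta -> (dual_objective M rho beta <= V)%R.
Local Open Scope ring_scope.

(** The upper limits of the primal program, in which a dual bound [V] takes the
    place of the limit of the cost to be minimized. *)
Definition cost_limit (i : 'I_d.+1) : R :=
  if unlift ord0 i is Some j then kappa M ord0 j else V.

Lemma cost_limit0 : cost_limit ord0 = V.
Proof. by rewrite /cost_limit unlift_none. Qed.

Lemma cost_limit_lift j : cost_limit (lift ord0 j) = kappa M ord0 j.
Proof. by rewrite /cost_limit liftK. Qed.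

Let c i z := fine (cost M i z).

Let cE i z : adm_graph M z -> cost M i z = (c i z)%:E.
Proof. by move=> Gz; rewrite fineK//; exact: cost_fin_num. Qed.

Let q := transition_op M.

(** Nonnegative combinations cannot certify that the limits are unattainable. If
    the cost [0] has a positive weight, dividing by it turns the certificate into
    a dual solution, whose value is at most [V]; if its weight is zero, weak
    duality applies to a feasible pair. *)
Lemma dual_certificate_ge0 (s : R) (h : X -> R) (l : 'I_d.+1 -> R) :
  measurable_fun [set: X] h -> bounded_fun h -> (forall i, 0 <= l i) ->
  (forall z, adm_graph M z ->
    0 <= s + (h z.1 - q h z) + \sum_(i < d.+1) l i * c i z) ->
  0 <= s + \sum_(i < d.+1) l i * cost_limit i.
Proof.
move=> mh bh l0 hle.
have mhN : measurable_fun [set: X] (fun x => (-1) * h x)%R.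
  exact: measurable_funM.
have bhN := bounded_funZ (-1) bh.
have [l00|] := eqVneq (l ord0) 0.
  have [[pi zeta] f] := M_feasible; have Jk := f.2.
  have Jfin i := feasible_finite i f.
  have := @weak_duality _ _ _ _ _ _ M pi zeta (- s) (fun x => (-1) * h x)%R l
    mhN bhN l0 Jfin.
  have hle' z : adm_graph M z -> ((- s)%:E + (-1 * h z.1)%:E <=
      \int[transition M z]_y (-1 * h y)%:E +
      \sum_(i < d.+1) (l i)%:E * cost M i z)%E.
    move=> Gz; rewrite transition_opE// transition_opZ//.
    under eq_bigr do rewrite cE// -EFinM.
    by rewrite sumEFin -!EFinD lee_fin; have := hle z Gz; rewrite -/q; lra.
  move=> /(_ hle') hs.
  suff : \sum_(i < d.+1) l i * fine (average_cost i pi zeta) <=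
    \sum_(i < d.+1) l i * cost_limit i by lra.
  rewrite !big_ord_recl l00 !mul0r !add0r; apply: ler_sum => j _.
  rewrite ler_wpM2l// cost_limit_lift -lee_fin fineK; first exact: Jk.
  by rewrite ge0_fin_numE// average_cost_ge0.
move=> l0_neq0; have l0_gt0 : 0 < l ord0 by rewrite lt_neqAle eq_sym l0_neq0 l0.
pose u := (l ord0)^-1; have u0 : 0 < u by rewrite invr_gt0.
pose beta : 'rV[R]_d := \row_j (- (u * l (lift ord0 j))).
have : dual_objective M (- (u * s)) beta <= V.
  apply: (@dual_le _ (fun x => (- u) * h x)%R); split.
  - exact: measurable_funM.
  - exact: bounded_funZ.
  - by move=> j; rewrite mxE oppr_le0 mulr_ge0// ltW.
  move=> z Gz; rewrite transition_opE//; last 2 first.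
  - exact: measurable_funM.
  - exact: bounded_funZ.
  rewrite transition_opZ// cE//.
  under eq_bigr do rewrite cE// -EFinM mxE.
  rewrite sumEFin -EFinN -!EFinD lee_fin.
  have /(ler_wpM2l (ltW u0)) := hle z Gz; rewrite mulr0 big_ord_recl.
  have e : u * (l ord0 * c ord0 z) = c ord0 z by rewrite mulrA mulVf// mul1r.
  have -> : \sum_(j < d) - (u * l (lift ord0 j)) * c (lift ord0 j) z =
      - (u * \sum_(j < d) l (lift ord0 j) * c (lift ord0 j) z).
    by rewrite mulr_sumr -sumrN; apply: eq_bigr => j _; rewrite mulNr mulrA.
  rewrite -/q; move: (\sum_(j < d) _) => S; lra.
rewrite /dual_objective => hV.
rewrite -(pmulr_rge0 _ u0) mulrDr mulr_sumr big_ord_recl cost_limit0.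
rewrite mulrA mulVf// mul1r.
have -> : \sum_(i < d) u * (l (lift ord0 i) * cost_limit (lift ord0 i)) =
    - \sum_(i < d) beta ord0 i * kappa M ord0 i.
  rewrite -sumrN; apply: eq_bigr => j _.
  by rewrite mxE cost_limit_lift mulNr opprK mulrA.
by lra.
Qed.

(** The values of the dual certificates for the integral of [f] under an invariant
    frequency with costs within [cost_limit]. Their infimum is the sublinear
    functional to which Hahn-Banach is applied. *)
Definition dual_bounds (f : X * A -> R) : set R :=
  [set v | exists (s : R) (h : X -> R) (l : 'I_d.+1 -> R),
    [/\ measurable_fun [set: X] h, bounded_fun h,
    (forall i, 0 <= l i),
    (forall z, adm_graph M z ->
      f z <= s + (h z.1 - q h z) + \sum_(i < d.+1) l i * c i z) &
    v = s + \sum_(i < d.+1) l i * cost_limit i]].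

Let p f := inf (dual_bounds f).

Let bounds_lb (f : X * A -> R) (H : R) : (forall z, `|f z| <= H) -> lbound (dual_bounds f) (- H).
Proof.
move=> hH v [s [h [l [mh bh l0 hle ->]]]].
have := @dual_certificate_ge0 (s + H) h l mh bh l0.
rewrite -addrA (addrC H) addrA => hs.
rewrite -subr_ge0 opprK; apply: hs => z Gz.
by have := hle z Gz; have := hH z; rewrite ler_norml; lra.
Qed.

Let q0 z : q (fun=> 0) z = 0. Proof. exact: transition_op_cst. Qed.

Let bounds_cst (f : X * A -> R) (s : R) : (forall z, adm_graph M z -> f z <= s) -> dual_bounds f s.
Proof.
move=> fs; exists s, (fun=> 0), (fun=> 0); split => //.
- exact: bounded_fun_cst.
- move=> z Gz; rewrite q0 big1 => [|i _]; last by rewrite mul0r.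
  by have := fs z Gz; lra.
- by rewrite big1 ?addr0// => i _; rewrite mul0r.
Qed.

Let has_inf_bounds (f : X * A -> R) : bounded_fun f -> has_inf (dual_bounds f).
Proof.
move=> /bounded_funP[H H0 hH]; split; last by exists (- H); exact: bounds_lb.
by exists H; apply: bounds_cst => z _; exact: le_trans (ler_norm _) (hH z).
Qed.

Let p_le (f : X * A -> R) v : bounded_fun f -> dual_bounds f v -> p f <= v.
Proof. by move=> bf fv; apply: ge_inf => //; case: (has_inf_bounds bf). Qed.

Let p_sublinear : sublinear_on [set f : X * A -> R | bounded_fun f] p.
Proof.
have D0 : bounded_fun (0 : X * A -> R) by exact: bounded_fun_cst.
have DD (f g : X * A -> R) : bounded_fun f -> bounded_fun g -> bounded_fun (f + g).
  exact: bounded_funD.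
have DZ a (f : X * A -> R) : bounded_fun f -> bounded_fun (a *: f).
  exact: bounded_funZ.
have p0 : p 0 = 0.
  apply/eqP; rewrite eq_le; apply/andP; split.
    by apply: p_le => //; apply: bounds_cst.
  apply: lb_le_inf; first by case: (has_inf_bounds D0).
  by move=> v /(@bounds_lb _ 0); rewrite oppr0; apply => z; rewrite normr0.
have hom a (f : X * A -> R) : 0 < a -> bounded_fun f -> p (a *: f) <= a * p f.
  move=> a0 bf; rewrite -ler_pdivrMl//.
  apply: lb_le_inf; first by case: (has_inf_bounds bf).
  move=> _ [s [h [l [mh bh l0 hle ->]]]].
  rewrite ler_pdivrMl//; apply: p_le; first exact: DZ.
  exists (a * s), (fun x => a * h x), (fun i => a * l i); split => //.
  - exact: measurable_funM.
  - exact: bounded_funZ.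
  - by move=> i; rewrite mulr_ge0// ltW.
  - move=> z Gz; rewrite /q transition_opZ// -mulrBr.
    under eq_bigr do rewrite -mulrA.
    by rewrite -mulr_sumr -!mulrDr; apply: ler_wpM2l; [exact: ltW|exact: hle].
  - by rewrite mulrDr mulr_sumr; congr (_ + _); apply: eq_bigr => i _; rewrite mulrA.
split=> [f g bf bg|a f].
  rewrite -lerBlDr; apply: lb_le_inf; first by case: (has_inf_bounds bf).
  move=> _ [s [h [l [mh bh l0 hle ->]]]].
  rewrite lerBlDr -lerBlDl; apply: lb_le_inf; first by case: (has_inf_bounds bg).
  move=> _ [s' [h' [l' [mh' bh' l'0 hle' ->]]]].
  rewrite lerBlDl; apply: p_le; first exact: DD.
  exists (s + s'), (h \+ h'), (fun i => l i + l' i); split => //.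
  - exact: measurable_funD.
  - exact: bounded_funD.
  - by move=> i; rewrite addr_ge0.
  - move=> z Gz; rewrite /q transition_opD//.
    under eq_bigr do rewrite mulrDl.
    rewrite big_split/=; have := hle z Gz; have := hle' z Gz.
    by rewrite -/q -[(f + g) z]/(f z + g z); lra.
  - under [in RHS]eq_bigr do rewrite mulrDl.
    by rewrite big_split/= addrACA.
rewrite le_eqVlt => /predU1P[<-|a0] bf; first by rewrite scale0r mul0r p0.
apply/eqP; rewrite eq_le hom//=.
have a'0 : 0 < a^-1 by rewrite invr_gt0.
have := hom _ _ a'0 (DZ a _ bf).
by rewrite scalerA mulVf ?gt_eqF// scale1r -ler_pdivrMl// invrK.
Qed.

(** Any linear functional below the infimum [p] of [dual_bounds] will do: each
    property of [L] is an inequality [p f <= v], witnessed by an explicit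
    certificate. The infimum is finite by [dual_certificate_ge0]. *)
Theorem finitely_additive_solution : exists L : (X * A -> R) -> R,
  [/\ linear_on [set f : X * A -> R | bounded_fun f] L,
      forall f g : X * A -> R, bounded_fun f -> bounded_fun g ->
        (forall z, adm_graph M z -> f z <= g z) -> L f <= L g,
      L (fun=> 1) = 1,
      forall h : X -> R, measurable_fun [set: X] h -> bounded_fun h ->
        L (fun z => h z.1) = L (transition_op M h) &
      forall i (f : X * A -> R), bounded_fun f ->
        (forall z, adm_graph M z -> ((f z)%:E <= cost M i z)%E) ->
        L f <= cost_limit i].
Proof.
have D0 : bounded_fun (0 : X * A -> R) by exact: bounded_fun_cst.
have DD (f g : X * A -> R) : bounded_fun f -> bounded_fun g -> bounded_fun (f + g).
  exact: bounded_funD.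
have DZ a (f : X * A -> R) : bounded_fun f -> bounded_fun (a *: f).
  exact: bounded_funZ.
have [L [LD LZ] Lp] := linear_below_sublinear D0 DD DZ p_sublinear.
have LN (f : X * A -> R) : bounded_fun f -> L (- f) = - L f.
  by move=> bf; rewrite -scaleN1r LZ// mulN1r.
have DN (f : X * A -> R) : bounded_fun f -> bounded_fun (- f).
  by move=> bf; rewrite -scaleN1r; exact: DZ.
have L_le (f : X * A -> R) s : bounded_fun f -> (forall z, adm_graph M z -> f z <= s) -> L f <= s.
  move=> bf fs; apply: le_trans (Lp _ bf) _; apply: p_le => //.
  exact: bounds_cst.
have mono (f g : X * A -> R) : bounded_fun f -> bounded_fun g ->
    (forall z, adm_graph M z -> f z <= g z) -> L f <= L g.
  move=> bf bg fg; rewrite -subr_le0 -LN// -LD//; last exact: DN.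
  apply: L_le; first by apply: DD => //; exact: DN.
  by move=> z Gz; rewrite -[(f + - g) z]/(f z - g z) subr_le0 fg.
have Linv (h : X -> R) : measurable_fun [set: X] h -> bounded_fun h ->
    L (fun z => h z.1) <= L (transition_op M h).
  move=> mh /[dup] bh /bounded_funP[H H0 hH].
  have bh1 : bounded_fun (fun z : X * A => h z.1).
    by apply/bounded_funP; exists H.
  have bq := bounded_transition_op M mh bh.
  rewrite -subr_le0 -LN// -LD//; last exact: DN.
  apply: le_trans (Lp _ _) _; first by apply: DD => //; exact: DN.
  apply: p_le; first by apply: DD => //; exact: DN.
  exists 0, h, (fun=> 0); split => //.
    move=> z Gz; rewrite big1 ?add0r ?addr0// => i _; by rewrite mul0r.
  by rewrite big1 ?addr0// => i _; rewrite mul0r.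
exists L; split => //.
- apply/eqP; rewrite eq_le L_le ?andTb//; last exact: bounded_fun_cst.
  have b1 : bounded_fun (1 : X * A -> R) by exact: bounded_fun_cst.
  have : L (- 1) <= -1 by apply: L_le => //; exact: DN.
  by rewrite LN// lerN2.
- move=> h mh bh; apply/eqP; rewrite eq_le Linv//=.
  have mhN : measurable_fun [set: X] (fun x => (-1) * h x) by exact: measurable_funM.
  have := Linv _ mhN (bounded_funZ (-1) bh).
  have -> : transition_op M (fun x => -1 * h x) = (-1) *: (transition_op M h).
    by apply/funext => z; rewrite transition_opZ.
  have bh1 : bounded_fun (fun z : X * A => h z.1).
    by have /bounded_funP[H H0 hH] := bh; apply/bounded_funP; exists H.
  have bq := bounded_transition_op M mh bh.
  have -> : (fun z : X * A => -1 * h z.1) = (-1) *: (fun z => h z.1) by [].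
  by rewrite !LZ//; lra.
- move=> i f bf fc; apply: le_trans (Lp _ bf) _; apply: p_le => //.
  exists 0, (fun=> 0), (fun j => (j == i)%:R); split => //.
  + exact: bounded_fun_cst.
  + move=> z Gz; rewrite q0 subrr !add0r (bigD1 i)//= eqxx mul1r big1 => [|j].
      by rewrite addr0 -lee_fin -cE//; exact: fc.
    by move/negPf => ->; rewrite mul0r.
  + rewrite (bigD1 i)//= eqxx mul1r big1 ?addr0 ?add0r// => j.
    by move/negPf => ->; rewrite mul0r.
Qed.

End finitely_additive_solution.

(** * From finite to countable additivity *)

Section layer_cake.
Context (R : realType).
Local Open Scope ring_scope.

(** The number of naturals below [x] is its ceiling. *)
Lemma count_levels (x : R) (K : nat) : 0 <= x ->
  Num.min x K%:R <= \sum_(k < K) ((k%:R < x)%R)%:R <= Num.min (x + 1) K%:R.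
Proof.
move=> x0; elim: K => [|K /andP[IH1 IH2]].
  by rewrite big_ord0 min_r// min_r ?lexx// addr_ge0.
rewrite big_ord_recr/= -natr1.
move: IH1 IH2; rewrite !minEle; case: (ltP K%:R x) => Kx /=; rewrite ?mulr1n ?mulr0n;
  repeat (case: ifPn; rewrite -?ltNge); lra.
Qed.

(** The staircase of step [1 / n] above a function with values in [[0, N]]. *)
Definition staircase (T : Type) (f : T -> R) (N n : nat) (z : T) : R :=
  n%:R^-1 * \sum_(k < N * n) \1_[set z | k%:R / n%:R < f z] z.

Lemma staircaseP (T : Type) (f : T -> R) (N n : nat) z : (0 < n)%N ->
  0 <= f z <= N%:R -> f z <= staircase f N n z <= f z + n%:R^-1.
Proof.
move=> n0 /andP[f0 fN]; have n0' : 0 < n%:R :> R by rewrite ltr0n.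
have := @count_levels (n%:R * f z) (N * n).
rewrite mulr_ge0// => /(_ isT).
rewrite natrM min_l; last by rewrite mulrC ler_pM2r.
move=> /andP[h1 h2].
have -> : staircase f N n z = n%:R^-1 * \sum_(k < N * n) ((k%:R < n%:R * f z)%R)%:R.
  congr (_ * _); apply: eq_bigr => k _; rewrite indicE; congr (_%:R).
  rewrite (_ : (z \in _) = (k%:R / n%:R < f z)); last first.
    by apply/idP/idP; rewrite inE.
  by rewrite ltr_pdivrMr// mulrC.
rewrite ler_pdivlMl// h1/= ler_pdivrMl//.
apply: le_trans h2 _; rewrite mulrDr divff ?gt_eqF//.
by rewrite ge_min lexx.
Qed.

End layer_cake.

Section frequency.
Context (R : realType) (dX dA : measure_display)
  (X : borelMeasurableType dX) (A : discreteBorelMeasurableType dA).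
Hypotheses (X_borel : borel_space R X) (A_countable : countable [set: A]).
Let T := (X * A)%type.

Lemma product_hausdorff : hausdorff_space T.
Proof.
have hX := borel_space_hausdorff X_borel.
move=> x y xy; apply: injective_projections.
  apply: hX => U V Ux Vy.
  have fst_nbhs (t : T) W : nbhs t.1 W -> nbhs t (fst @^-1` W) by exact: cvg_fst.
  have [z [Uz Vz]] := xy _ _ (fst_nbhs x U Ux) (fst_nbhs y V Vy).
  by exists z.1.
apply: (@discrete_hausdorff A) => U V Ux Vy.
have snd_nbhs (t : T) W : nbhs t.2 W -> nbhs t (snd @^-1` W) by exact: cvg_snd.
have [z [Uz Vz]] := xy _ _ (snd_nbhs x U Ux) (snd_nbhs y V Vy).
by exists z.2.
Qed.

(** Both projections are measurable for the Borel sets of the product. *)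
Lemma borel_product (B : set T) : measurable B -> <<s @open T >> B.
Proof.
have mfst : measurable_fun setT (fst : g_sigma_algebraType (@open T) -> X).
  apply: (measurability (@open X)); first exact: measurable_borelE.
  move=> _ [U oU <-]; rewrite setTI; apply: sub_sigma_algebra.
  by apply: open_comp => // z _; exact: cvg_fst.
have msnd : measurable_fun setT (snd : g_sigma_algebraType (@open T) -> A).
  apply: (measurability (@open A)); first exact: measurable_borelE.
  move=> _ [U oU <-]; rewrite setTI; apply: sub_sigma_algebra.
  by apply: open_comp => // z _; exact: cvg_snd.
move=> mB; have := measurable_fun_pair mfst msnd measurableT mB.
by rewrite setTI; congr (<<s _ >> _); apply/seteqP; split=> -[].
Qed.

Lemma open_cylinder (G : set X) (F : set A) : open G -> open (G `*` F : set T).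
Proof.
move=> oG; have -> : G `*` F = fst @^-1` G `&` snd @^-1` F :> set T by [].
apply: openI.
  by apply: open_comp => // z _; exact: cvg_fst.
by apply: open_comp => [z _|]; [exact: cvg_snd|exact: discrete_open].
Qed.

Context (d : nat) (M : cmdp R X A d) (L : (T -> R) -> R).
Hypotheses (L_linear : linear_on [set f : T -> R | bounded_fun f] L)
  (L_le : forall f g : T -> R, bounded_fun f -> bounded_fun g ->
    (forall z, adm_graph M z -> f z <= g z)%R -> (L f <= L g)%R)
  (L1 : L (fun=> 1%R) = 1%R).

Definition fa_measure (E : set T) : R := L \1_E.

Let L0 : L (fun=> 0%R) = 0%R.
Proof.
have := L_linear.2 0%R (fun=> 0%R) (bounded_fun_cst _ _).
by rewrite scale0r mul0r.
Qed.

Lemma fa_measure_le E F : E `<=` F -> (fa_measure E <= fa_measure F)%R.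
Proof.
move=> EF; apply: L_le; [exact: bounded_fun_indic|exact: bounded_fun_indic|].
move=> z _; rewrite !indicE ler_nat.
by case: (boolP (z \in E)) => //; rewrite inE => /EF zF; rewrite mem_set.
Qed.

Lemma fa_measure_ge0 E : (0 <= fa_measure E)%R.
Proof.
rewrite -L0; apply: L_le; [exact: bounded_fun_cst|exact: bounded_fun_indic|].
by move=> z _; rewrite indicE.
Qed.

Lemma fa_measureU E F : E `&` F = set0 ->
  (fa_measure (E `|` F) = fa_measure E + fa_measure F)%R.
Proof.
move=> EF; rewrite /fa_measure -L_linear.1; [|exact: bounded_fun_indic|exact: bounded_fun_indic].
congr L; apply/funext => z; rewrite -[RHS]/(\1_E z + \1_F z)%R !indicE.
rewrite in_setU; case: (boolP (z \in E)); case: (boolP (z \in F)) => //=.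
- by rewrite !inE => Fz Ez; have : (E `&` F) z by []; rewrite EF.
- by rewrite addr0.
- by rewrite add0r.
- by rewrite addr0.
Qed.

Lemma fa_measure_setT : fa_measure setT = 1%R.
Proof. by rewrite /fa_measure indicT. Qed.

Lemma fa_measure_leU E F : (fa_measure (E `|` F) <= fa_measure E + fa_measure F)%R.
Proof.
have -> : E `|` F = E `|` (F `\` E) by rewrite setUDr setDv setD0.
rewrite fa_measureU; last by rewrite setDE setICA setICr setI0.
by rewrite lerD2l; apply: fa_measure_le; exact: subDsetl.
Qed.

Definition frequency : set T -> \bar R := @outer_content R (X * A)%type fa_measure.

Let frequency0 : frequency set0 = 0.
Proof. by apply: outer_content0 => //; [exact: fa_measure_le|exact: fa_measureU]. Qed.

Let frequency_ge0 E : 0 <= frequency E.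
Proof. by apply: outer_content_ge0; exact: fa_measureU. Qed.

Let frequency_sigma_additive : semi_sigma_additive frequency.
Proof.
move=> F mF tF mUF; apply: outer_content_sigma_additive => //.
- exact: product_hausdorff.
- exact: fa_measure_le.
- exact: fa_measureU.
- exact: point.
- by move=> n; exact: borel_product.
Qed.

HB.instance Definition _ := isMeasure.Build _ _ _ frequency
  frequency0 frequency_ge0 frequency_sigma_additive.

(** The two bounds are those that characterize vague convergence of measures;
    they retain the finitely additive [fa_measure] up to its part at infinity. *)
Lemma exists_frequency : exists2 gamma : {measure set T -> \bar R},
  (forall G, open G -> gamma G <= (fa_measure G)%:E) &
  (forall K, compact K -> (fa_measure K)%:E <= gamma K).
Proof.
exists frequency => [G oG|K cK]; last exact: outer_content_compact.
by apply: outer_content_open => //; exact: fa_measure_le.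
Qed.

End frequency.

(** * Cutting along the actions *)

Section action_slices.
Context (R : realType) (dX dA : measure_display)
  (X : borelMeasurableType dX) (A : discreteBorelMeasurableType dA).
Hypothesis A_countable : countable [set: A].
Let T := (X * A)%type.

(** An injective numbering of the actions cuts the subsets of [X * A] into countably
    many cylinders. *)
Definition action_index : A -> nat := sval (cid (countable_injP _ A_countable)).

Lemma action_index_inj : injective action_index.
Proof.
rewrite /action_index; case: cid => f /= finj a b fab.
by apply: finj => //; rewrite inE.
Qed.

Definition index_fiber (k : nat) : set A := [set a | action_index a = k].

Definition slice (E : set T) (k : nat) : set X :=
  [set x | exists2 a, index_fiber k a & E (x, a)].

(** A fiber has at most one element. *)
Lemma sliceE E k : E `&` snd @^-1` index_fiber k = slice E k `*` index_fiber k.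
Proof.
apply/seteqP; split=> [[x a] [Exa ka]|[x a] /= [[b kb Exb] ka]].
  by split => //; exists a.
by split => //; rewrite (action_index_inj (etrans ka (esym kb))).
Qed.

Lemma slice_cases E k : slice E k = set0 \/ exists a, slice E k = pair^~ a @^-1` E.
Proof.
have [[a ka]|nk] := pselect (exists a, index_fiber k a); [right; exists a|left].
  apply/seteqP; split=> [x [b kb]|x Exa]; last by exists a.
  by rewrite (action_index_inj (etrans kb (esym ka))).
by apply/seteqP; split => // x [a ka _]; apply: nk; exists a.
Qed.

Lemma measurable_slice E k : measurable E -> measurable (slice E k).
Proof.
move=> mE; have [->|[a ->]] := slice_cases E k; first exact: measurable0.
have := pair2_measurable (T1 := X) a measurableT mE.
by rewrite setTI.
Qed.

Lemma open_slice E k : open E -> open (slice E k).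
Proof.
move=> oE; have [->|[a ->]] := slice_cases E k; first exact: open0.
apply: open_comp => // x _.
by apply: cvg_pair => /=; [exact: cvg_id|exact: cvg_cst].
Qed.

Lemma borel_measurable_open (G : set X) : open G -> measurable G.
Proof. by move=> oG; rewrite measurable_borelE; exact: sub_sigma_algebra. Qed.

Lemma borel_measurable_closed (C : set X) : closed C -> measurable C.
Proof.
by move=> cC; rewrite -[C]setCK; apply: measurableC; apply: borel_measurable_open;
  exact: closed_openC.
Qed.

Lemma measurable_cylinder (B : set X) (F : set A) :
  measurable B -> measurable (B `*` F).
Proof. by move=> mB; apply: measurableX => //; exact: discrete_measurable. Qed.

Lemma bigcup_slices E : E = \bigcup_k (slice E k `*` index_fiber k).
Proof.
apply/seteqP; split=> [[x a] Exa|[x a] [k _]].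
  by exists (action_index a) => //; split => //; exists a.
by rewrite -sliceE => -[].
Qed.

Lemma measurable_open_product (E : set T) : open E -> measurable E.
Proof.
move=> oE; rewrite (bigcup_slices E); apply: bigcup_measurable => k _.
by apply: measurable_cylinder; apply: borel_measurable_open; exact: open_slice.
Qed.

Lemma measurable_closed_product (E : set T) : closed E -> measurable E.
Proof.
by move=> cE; rewrite -[E]setCK; apply: measurableC; apply: measurable_open_product; exact: closed_openC.
Qed.

(** The projection of a compact set on the discrete space [A] is finite. *)
Lemma compact_bounded_index (K : set T) : compact K ->
  exists n, forall z, K z -> (action_index z.2 < n)%N.
Proof.
move=> /compact_near_coveringP cK.
have [|n _ /(_ n (leqnn n)) Kn] := cK nat \oo (fun n z => (action_index z.2 < n)%N) _.
  move=> z _; exists (snd @^-1` [set z.2], [set n | (action_index z.2 < n)%N]) => /=.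
    split; last by exists (action_index z.2).+1.
    have : nbhs z.2 [set z.2] by apply: open_nbhs_nbhs; split => //; exact: discrete_open.
    exact: cvg_snd.
  by move=> [y n] /= [-> ].
by exists n.
Qed.

End action_slices.

(** * Regularity of finite measures *)

Section closed_regularity.
Context (R : realType) (dX : measure_display) (X : borelMeasurableType dX).
Hypothesis X_borel : borel_space R X.
Context (nu : {finite_measure set X -> \bar R}).

(** The sets that can be enclosed, up to an arbitrarily small measure, between a
    closed set and an open set. *)
Let sandwiched : set (set X) := [set B | forall e : R, (0 < e)%R ->
  exists C G, [/\ closed C, open G, C `<=` B, B `<=` G & nu (G `\` C) <= e%:E]].

Let eventually_small (F : (set X)^nat) (E : set X) (e : R) :
  (forall n, measurable (F n)) -> nonincreasing_seq F -> \bigcap_n F n = E ->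
  nu E < e%:E -> exists n, nu (F n) <= e%:E.
Proof.
move=> mF ndF <- Ee.
have fin0 : nu (F 0%N) < +oo by rewrite -ge0_fin_numE// fin_num_measure.
have nuF := nonincreasing_cvg_mu fin0 mF (bigcapT_measurable mF) ndF.
have [n _ /(_ n (leqnn n)) nFe] := nuF _ (open_ereal_lt' Ee).
by exists n; exact: ltW.
Qed.

(** An open set is the increasing union of the closed superlevel sets of a
    function that is positive exactly on it. *)
Let sandwiched_open G : open G -> sandwiched G.
Proof.
move=> oG e e0; have [phi cphi phiP] := borel_space_cozero X_borel oG.
pose C (n : nat) := [set x | (n.+1%:R^-1 <= phi x)%R].
have cC n : closed (C n).
  apply: (@closed_comp _ _ phi [set y | n.+1%:R^-1 <= y]%R); last exact: closed_ge.
  by move=> x _; exact: cphi.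
have CG n : C n `<=` G.
  by move=> x Cx; apply/(phiP x).2; apply: lt_le_trans Cx; rewrite invr_gt0.
have [|||| n nGe] := @eventually_small (fun n => G `\` C n) set0 e.
- by move=> n; apply: measurableD; [exact: borel_measurable_open|exact: borel_measurable_closed].
- apply/nonincreasing_seqP => n; apply/subsetPset => x [Gx nCx]; split => // Cx.
  by apply: nCx; apply: le_trans Cx; rewrite lef_pV2 ?posrE// ler_nat.
- apply/seteqP; split => // x GC; have [Gx _] := GC 0%N I.
  have phix := (phiP x).2.1 Gx.
  have [_] := GC (Num.truncn (phi x)^-1) I; apply.
  by rewrite /C/= invf_ple ?posrE// ltW// truncnS_gt.
- by rewrite measure0.
by exists (C n), G; split.
Qed.

(** In a countable union, the open sets are united and finitely many of the
    closed ones suffice, by continuity from above. *)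
Let sandwiched_sigma_algebra : sigma_algebra setT sandwiched.
Proof.
split.
- move=> e e0; exists set0, set0; split => //; first exact: closed0; first exact: open0.
  by rewrite setD0 measure0 lee_fin ltW.
- move=> B sB e e0; have [C [G [cC oG CB BG GC]]] := sB e e0.
  exists (~` G), (~` C); split.
  + exact: open_closedC.
  + exact: closed_openC.
  + by rewrite setTD; exact: subsetC.
  + by rewrite setTD; exact: subsetC.
  + by rewrite setDE setCK setIC -setDE.
- move=> B sB e e0; have e20 : (0 < e / 2)%R by lra.
  have e2 n : (0 < e / 2 / (2 ^ n.+1)%:R)%R by rewrite divr_gt0// ltr0n expn_gt0.
  have [C /choice[G hCG]] := choice (fun n => sB n _ (e2 n)).
  have mG n : measurable (G n) by apply: borel_measurable_open; case: (hCG n).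
  have mC n : measurable (C n) by apply: borel_measurable_closed; case: (hCG n).
  have mGU : measurable (\bigcup_n G n) by exact: bigcupT_measurable.
  have mCU n : measurable (\big[setU/set0]_(k < n) C k) by exact: bigsetU_measurable.
  have [||||n nGe] := @eventually_small
    (fun n => \bigcup_n G n `\` \big[setU/set0]_(k < n) C k)
    (\bigcup_n G n `\` \bigcup_n C n) e.
  + by move=> n; exact: measurableD.
  + apply/nonincreasing_seqP => n; apply/subsetPset; apply: setDS.
    by rewrite big_ord_recr/=; exact: subsetUl.
  + apply/seteqP; split => [x xGC|x [Gx nCx] n _].
      split; first by case: (xGC 0%N I).
      move=> [k _ Ckx]; have [_] := xGC k.+1 I; apply.
      by rewrite -bigcup_mkord; exists k => /=.
    split => // ; rewrite -bigcup_mkord => -[k _ Ckx]; apply: nCx; by exists k.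
  + apply: (@le_lt_trans _ _ (e / 2)%:E); last by rewrite lte_fin; lra.
    apply: (@le_trans _ _ (\sum_(n <oo) nu (G n `\` C n))).
      apply: (@le_trans _ _ (nu (\bigcup_n (G n `\` C n)))).
        apply: le_measure; rewrite ?inE.
        * by apply: measurableD => //; exact: bigcupT_measurable.
        * by apply: bigcupT_measurable => n; exact: measurableD.
        * move=> x [[n _ Gnx] nCx]; exists n => //; split => // Cnx.
          by apply: nCx; exists n.
      apply: measure_sigma_subadditive => //.
      * by move=> n; exact: measurableD.
      * by apply: bigcupT_measurable => n; exact: measurableD.
    apply: le_trans (epsilon_trick0 xpredT (ltW e20)).
    by apply: lee_nneseries => // n _; case: (hCG n).
  exists (\big[setU/set0]_(k < n) C k), (\bigcup_n G n); split => //.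
  + by rewrite -bigcup_mkord; apply: closed_bigcup => // k _; case: (hCG k).
  + by apply: bigcup_open => k _; case: (hCG k).
  + rewrite -bigcup_mkord => x [k _ Ckx]; exists k => //.
    by case: (hCG k) => _ _ CB _ _; exact: CB.
  + move=> x [k _ Bkx]; exists k => //.
    by case: (hCG k) => _ _ _ BG _; exact: BG.
Qed.

Lemma closed_inner_regular (B : set X) (e : R) : measurable B -> (0 < e)%R ->
  exists C, [/\ closed C, C `<=` B & nu (B `\` C) <= e%:E].
Proof.
move=> mB e0; have : sandwiched B.
  move: mB; rewrite measurable_borelE => mB.
  by apply: (smallest_sub sandwiched_sigma_algebra _ mB); exact: sandwiched_open.
move=> /(_ _ e0)[C [G [cC oG CB BG GC]]]; exists C; split => //.
apply: le_trans GC; apply: le_measure; rewrite ?inE; last exact: setSD.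
- by apply: measurableD => //; exact: borel_measurable_closed.
- by apply: measurableD; [exact: borel_measurable_open|exact: borel_measurable_closed].
Qed.

End closed_regularity.

(** * Invariance and costs of the countably additive frequency *)

Lemma measurable_superlevel (R : realType) d (T : measurableType d)
  (g : T -> R) (t : R) :
  measurable_fun [set: T] g -> measurable [set z | (t < g z)%R].
Proof.
move=> mg; have := mg measurableT _ (measurable_itv `]t, +oo[).
by rewrite setTI preimage_itvoy.
Qed.

Section relaxation.
Context (R : realType) (dX dA : measure_display)
  (X : borelMeasurableType dX) (A : discreteBorelMeasurableType dA).
Hypotheses (X_borel : borel_space R X) (A_countable : countable [set: A]).
Let T := (X * A)%type.
Context (d : nat) (M : cmdp R X A d) (Gam : nat -> set T).
Hypotheses (SU : cond_SU M Gam) (hM : cond_M M Gam).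
Context (L : (T -> R) -> R) (K : 'I_d.+1 -> R).
Hypotheses (L_linear : linear_on [set f : T -> R | bounded_fun f] L)
  (L_le : forall f g : T -> R, bounded_fun f -> bounded_fun g ->
    (forall z, adm_graph M z -> f z <= g z)%R -> (L f <= L g)%R)
  (L1 : L (fun=> 1%R) = 1%R)
  (L_invariant : forall h : X -> R, measurable_fun [set: X] h ->
    bounded_fun h -> L (fun z => h z.1) = L (transition_op M h))
  (L_cost : forall i (f : T -> R), bounded_fun f ->
    (forall z, adm_graph M z -> (f z)%:E <= cost M i z) -> (L f <= K i)%R).
Context (gamma : {measure set T -> \bar R}).
Hypotheses
  (gamma_open : forall G, open G -> gamma G <= (fa_measure L G)%:E)
  (gamma_compact : forall C, compact C -> (fa_measure L C)%:E <= gamma C).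

Local Notation m := (fa_measure L).

Let m_le E F : E `<=` F -> (m E <= m F)%R.
Proof. exact: (fa_measure_le L_le). Qed.

Let m_ge0 E : (0 <= m E)%R.
Proof. exact: (fa_measure_ge0 L_linear L_le). Qed.

Let m_leU E F : (m (E `|` F) <= m E + m F)%R.
Proof. exact: (fa_measure_leU L_linear L_le). Qed.

Let L0 : L (fun=> 0%R) = 0%R.
Proof.
have := L_linear.2 0%R (fun=> 0%R) (bounded_fun_cst _ _).
by rewrite scale0r mul0r.
Qed.

Let LD (f g : T -> R) : bounded_fun f -> bounded_fun g ->
  L (fun z => f z + g z)%R = (L f + L g)%R.
Proof. exact: L_linear.1. Qed.

Let LZ a (f : T -> R) : bounded_fun f -> L (fun z => a * f z)%R = (a * L f)%R.
Proof. exact: L_linear.2. Qed.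

Let sum_nil I (f : I -> T -> R) :
  (fun z => \sum_(i <- [::]) f i z)%R = (fun=> 0%R).
Proof. by apply/funext => z; rewrite big_nil. Qed.

Let sum_cons I i (s : seq I) (f : I -> T -> R) :
  (fun z => \sum_(i <- i :: s) f i z)%R =
  (fun z => f i z + \sum_(i <- s) f i z)%R.
Proof. by apply/funext => z; rewrite big_cons. Qed.

Let bounded_sum I (s : seq I) (f : I -> T -> R) : (forall i, bounded_fun (f i)) ->
  bounded_fun (fun z => \sum_(i <- s) f i z)%R.
Proof.
move=> bf; elim: s => [|i s IHs]; first by rewrite sum_nil; exact: bounded_fun_cst.
by rewrite sum_cons; exact: bounded_funD.
Qed.

Let L_sum I (s : seq I) (f : I -> T -> R) : (forall i, bounded_fun (f i)) ->
  L (fun z => \sum_(i <- s) f i z)%R = (\sum_(i <- s) L (f i))%R.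
Proof.
move=> bf; elim: s => [|i s IHs]; first by rewrite sum_nil L0 big_nil.
by rewrite sum_cons LD//; [rewrite IHs big_cons|exact: bounded_sum].
Qed.

Let compact_Gam j : compact (Gam j). Proof. by case: SU. Qed.

Let measurable_compact (C : set T) : compact C -> measurable C.
Proof.
move=> cC; apply: measurable_closed_product => //.
exact: (compact_closed (product_hausdorff X_borel)).
Qed.

(** The cost [i] exceeds any prescribed [B] off some [Gam j], while [L] keeps it
    below [K i]; by Markov's inequality the complement of [Gam j] has a frequency
    of at most [K i / B]. *)
Lemma fa_measure_tight (e : R) : (0 < e)%R -> exists j, (m (~` Gam j) <= e)%R.
Proof.
move=> e0; have [_ _ _ [i /cvgeyPge ci]] := SU.
have K0 : (0 <= K i)%R.
  rewrite -L0; apply: L_cost; first exact: bounded_fun_cst.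
  by move=> z _; exact: cost_ge0.
pose B := ((K i + 1) / e)%R.
have B0 : (0 < B)%R by rewrite divr_gt0// ltr_wpDl.
have [j _ /(_ j (leqnn j)) Bj] := ci B.
exists j; have : (L (fun z => B * \1_(~` Gam j) z) <= K i)%R.
  apply: L_cost => [|z Gz]; first exact: bounded_funZ.
  rewrite indicE; case: (boolP (z \in _)) => [|_]; last by rewrite mulr0 cost_ge0.
  rewrite inE mulr1 => Gjz; apply: le_trans Bj _.
  by apply: ereal_inf_lbound; exists z.
rewrite LZ// -/(m _) /B => h.
have : ((K i + 1) * m (~` Gam j) <= K i * e)%R.
  by move: h; rewrite mulrAC ler_pdivrMr.
have := m_ge0 (~` Gam j); nra.
Qed.

Let gamma_le E F : measurable E -> measurable F -> E `<=` F -> gamma E <= gamma F.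
Proof. by move=> mE' mF EF; apply: le_measure; rewrite ?inE. Qed.

(** By tightness a closed set is compact up to a small frequency. *)
Lemma gamma_closed (C : set T) : closed C -> (m C)%:E <= gamma C.
Proof.
move=> cC; apply/lee_addgt0Pr => e e0; have [j mj] := fa_measure_tight e0.
have mC := measurable_closed_product A_countable cC.
have cCj : compact (C `&` Gam j) by rewrite setIC; exact: compact_closedI.
apply: (@le_trans _ _ ((m (C `&` Gam j))%:E + (m (~` Gam j))%:E)).
  rewrite -EFinD lee_fin; apply: le_trans (m_leU _ _).
  by apply: m_le => z Cz; have [Gz|Gz] := pselect (Gam j z); [left|right].
apply: leeD; last by rewrite lee_fin.
apply: le_trans (gamma_compact cCj) _; apply: gamma_le => //.
exact: measurable_compact.
Qed.

Lemma gamma_setT : gamma setT = 1.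
Proof.
apply/eqP; rewrite eq_le; apply/andP; split.
  by apply: le_trans (gamma_open openT) _; rewrite fa_measure_setT.
by have := gamma_closed closedT; rewrite fa_measure_setT.
Qed.

Section layer_cake.
Variables (g : T -> R) (N : nat).
Hypotheses (mg : measurable_fun [set: T] g) (gN : forall z, (0 <= g z <= N%:R)%R).

Let superlevel t := [set z | (t < g z)%R].

Let measurable_level t : measurable_fun [set: T] (\1_(superlevel t) : T -> R).
Proof. by apply: measurable_indic; exact: (measurable_superlevel t mg). Qed.

Let bg : bounded_fun g.
Proof.
apply/bounded_funP; exists N%:R => // z.
by have /andP[g0 ?] := gN z; rewrite ger0_norm.
Qed.

Let bounded_staircase n : bounded_fun (staircase g N n).
Proof. by apply: bounded_funZ; exact: bounded_sum. Qed.

Let L_staircase n :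
  L (staircase g N n) = (n%:R^-1 * \sum_(k < N * n) m (superlevel (k%:R / n%:R)))%R.
Proof. by rewrite LZ ?L_sum//; exact: bounded_sum. Qed.

Let integral_staircase n : \int[gamma]_z (staircase g N n z)%:E =
  (n%:R^-1)%:E * \sum_(k < N * n) gamma (superlevel (k%:R / n%:R)%R).
Proof.
under eq_integral do rewrite EFinM -sumEFin.
rewrite ge0_integralZl//=.
- congr (_ * _); rewrite ge0_integral_sum//.
  apply: eq_bigr => k _; rewrite integral_indic ?setIT//.
  exact: (measurable_superlevel _ mg).
- by move=> k; apply/measurable_EFinP; exact: measurable_level.
- apply: emeasurable_sum => k; apply/measurable_EFinP.
  exact: measurable_level.
- by move=> z _; apply: sume_ge0 => k _; rewrite lee_fin.
Qed.

Let measurable_staircase n : measurable_fun [set: T] (EFin \o staircase g N n).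
Proof.
apply/measurable_EFinP; apply: measurable_funM => //.
by apply: measurable_sum => k; exact: measurable_level.
Qed.

Let inv_small (e : R) : (0 < e)%R -> exists2 n, (0 < n)%N & (n%:R^-1 <= e)%R.
Proof.
move=> e0; exists (Num.truncn e^-1).+1 => //.
by rewrite invf_ple ?posrE// ltW// truncnS_gt.
Qed.

(** The staircases of step [1 / n] reduce the comparison of [L] with the integral to
    the comparison of [fa_measure L] with [gamma] on superlevel sets. *)
Lemma layer_cake_le :
  (forall t, (0 <= t)%R -> gamma (superlevel t) <= (m (superlevel t))%:E) ->
  \int[gamma]_z (g z)%:E <= (L g)%:E.
Proof.
move=> gm; apply/lee_addgt0Pr => e e0; have [n n0 ne] := inv_small e0.
have gs z : (g z <= staircase g N n z <= g z + n%:R^-1)%R by exact: staircaseP.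
apply: (@le_trans _ _ (\int[gamma]_z (staircase g N n z)%:E)).
  apply: ge0_le_integral => //.
  - by move=> z _; rewrite lee_fin; case/andP: (gN z).
  - exact/measurable_EFinP.
  - exact: measurable_staircase.
  - by move=> z _; rewrite lee_fin; case/andP: (gs z).
rewrite integral_staircase; apply: (@le_trans _ _ (L (staircase g N n))%:E).
  rewrite L_staircase EFinM lee_wpmul2l ?lee_fin// -sumEFin.
  by apply: lee_sum => k _; exact: gm.
rewrite -EFinD lee_fin; apply: le_trans (L_le (bounded_staircase n)
  (bounded_funD bg (bounded_fun_cst _ n%:R^-1)) _) _.
  by move=> z _; case/andP: (gs z).
rewrite (LD bg (bounded_fun_cst _ _)) lerD2l.
have := @LZ n%:R^-1%R (fun=> 1%R) (bounded_fun_cst _ _).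
by rewrite L1; under eq_fun do rewrite mulr1; move=> ->; rewrite mulr1.
Qed.

Lemma layer_cake_ge (e : R) : (0 <= e)%R ->
  (forall t, (0 <= t)%R -> (m (superlevel t))%:E <= gamma (superlevel t) + e%:E) ->
  (L g)%:E <= \int[gamma]_z (g z)%:E + (N%:R * e)%:E.
Proof.
move=> e0 mgam; apply/lee_addgt0Pr => e' e'0; have [n n0 ne] := inv_small e'0.
have gs z : (g z <= staircase g N n z <= g z + n%:R^-1)%R by exact: staircaseP.
apply: (@le_trans _ _ (L (staircase g N n))%:E).
  by rewrite lee_fin; apply: L_le => // z _; case/andP: (gs z).
apply: (@le_trans _ _ (\int[gamma]_z (staircase g N n z)%:E + (N%:R * e)%:E)).
  rewrite integral_staircase L_staircase.
  have -> : (N%:R * e = n%:R^-1 * \sum_(k < N * n) e)%R.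
    rewrite sumr_const card_ord -[(e *+ _)%R]mulr_natl natrM.
    by rewrite [(N%:R * n%:R)%R]mulrC -mulrA mulKf// pnatr_eq0 -lt0n.
  rewrite !EFinM -ge0_muleDr.
  - rewrite lee_wpmul2l ?lee_fin// -!sumEFin -big_split/=.
    by apply: lee_sum => k _; apply: mgam.
  - exact: sume_ge0.
  - by rewrite lee_fin sumr_ge0.
rewrite [leRHS]addeAC; apply: leeD; last exact: lexx.
apply: (@le_trans _ _ (\int[gamma]_z ((g z)%:E + (n%:R^-1)%:E))).
  apply: ge0_le_integral => //.
  - by move=> z _; have := gs z; have := gN z; rewrite lee_fin; lra.
  - exact: measurable_staircase.
  - by apply: emeasurable_funD => //; exact/measurable_EFinP.
  - by move=> z _; rewrite -EFinD lee_fin; case/andP: (gs z).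
rewrite ge0_integralD//; last first.
- exact/measurable_EFinP.
- by move=> z _; rewrite lee_fin; case/andP: (gN z).
by rewrite integral_cst// gamma_setT mule1 leeD2l// lee_fin.
Qed.

End layer_cake.

Let L_cst a : L (fun=> a) = a.
Proof.
have := @LZ a (fun=> 1%R) (bounded_fun_cst _ _).
by under eq_fun do rewrite mulr1; move=> ->; rewrite L1 mulr1.
Qed.

Section majorized.
Variables (j : nat) (O D : set X) (nu : {finite_measure set X -> \bar R}).
Hypotheses (oO : open O) (GamO : fst @` Gam j `<=` O) (cD : closed D).
Hypothesis majorized : forall B z, measurable B -> adm_graph M z ->
  transition M z ((O `\` D) `&` B) <= nu B.
Let W := O `\` D.

(** By invariance the frequency of [B] in the state marginal is the frequency of
    moving into [B], which the majorization bounds by [nu B]. *)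
Lemma fa_measure_majorized (B : set X) (F : set A) : measurable B -> B `<=` W ->
  (m (B `*` F))%:E <= nu B.
Proof.
move=> mB BW; rewrite -(fineK (fin_num_measure nu B mB)) lee_fin.
have bB : bounded_fun (\1_B : X -> R) by exact: bounded_fun_indic.
have mindB : measurable_fun [set: X] (\1_B : X -> R) by exact: measurable_indic.
apply: (@le_trans _ _ (m (B `*` setT))); first by apply: m_le => z [].
have -> : m (B `*` setT) = L (fun z => \1_B z.1).
  congr L; apply/funext => -[x a]; rewrite !indicE/=; congr (nat_of_bool _)%:R.
  by apply/idP/idP; rewrite !inE => // -[].
rewrite L_invariant// -[leRHS]L_cst; apply: L_le.
- exact: bounded_transition_op.
- exact: bounded_fun_cst.
move=> z Gz; rewrite /transition_op integral_indic// setIT.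
apply: fine_le.
- exact: (fin_num_measure (kernel_value (transition M) z)).
- exact: fin_num_measure.
by have := majorized mB Gz; rewrite setIidr.
Qed.

(** [nu] dominates the frequency and is a measure, so [B] can be replaced by a
    closed subset of it; there [gamma_closed] applies. *)
Lemma fa_measure_cylinder_le (B : set X) (F : set A) : measurable B -> B `<=` W ->
  (m (B `*` F))%:E <= gamma (B `*` F).
Proof.
move=> mB BW; apply/lee_addgt0Pr => e e0.
have [C [cC CB BCe]] := closed_inner_regular X_borel nu mB e0.
have mC : measurable C by exact: borel_measurable_closed.
have BE : B `*` F = (C `*` F) `|` ((B `\` C) `*` F).
  apply/seteqP; split=> [[x a] [/= Bx Fa]|[x a]].
    by have [Cx|Cx] := pselect (C x); [left|right].
  by move=> [[/= /CB]|[/= []]].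
apply: (@le_trans _ _ ((m (C `*` F))%:E + (m ((B `\` C) `*` F))%:E)).
  by rewrite -EFinD lee_fin {1}BE.
apply: leeD.
  apply: le_trans (gamma_closed _) _.
    have -> : C `*` F = ~` ((~` C `*` setT) `|` (setT `*` ~` F)) :> set T.
      apply/seteqP; split=> [[x a] [/= Cx Fa] [[]|[]]//|[x a] /= h].
      by split; apply: contrapT => h'; apply: h; [left|right].
    apply: open_closedC; apply: openU; apply: open_cylinder; last exact: openT.
    exact: closed_openC.
  apply: gamma_le; [exact: measurable_cylinder|exact: measurable_cylinder|].
  by move=> [x a] [/= /CB].
apply: le_trans BCe; apply: fa_measure_majorized; first exact: measurableD.
by move=> x [/BW].
Qed.

(** Only finitely many actions occur in [Gam j], so [E] can be exhausted by finitely
    many cylinders, to each of which [fa_measure_cylinder_le] applies. *)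
Lemma fa_measure_le_gamma (E : set T) : measurable E -> E `<=` W `*` setT ->
  (m E)%:E <= gamma E + (m (~` Gam j))%:E.
Proof.
move=> mE EW; have [n jn] := compact_bounded_index A_countable (@compact_Gam j).
pose En n := E `&` [set z | (action_index A_countable z.2 < n)%N].
have mEn k : measurable (En k).
  apply: measurableI => //.
  have -> : [set z : T | (action_index A_countable z.2 < k)%N] =
      setT `*` [set a | (action_index A_countable a < k)%N].
    by apply/seteqP; split=> [[x a]//|[x a] []].
  exact: measurable_cylinder.
have step k : En k.+1 = En k `|` (slice A_countable E k `*` index_fiber A_countable k).
  rewrite -sliceE; apply/seteqP; split=> [z [Ez /=]|z].
    by rewrite ltnS leq_eqVlt => /orP[/eqP zk|zk]; [right|left].
  by move=> [[Ez /= zk]|[Ez /= zk]]; split => //=;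
    [rewrite ltnS ltnW|rewrite zk].
have dis k : En k `&` (slice A_countable E k `*` index_fiber A_countable k) = set0.
  rewrite -sliceE; apply/seteqP; split => // z [[Ez /= zk] [_ /= zk']].
  by move: zk; rewrite zk' ltnn.
have Enle k : (m (En k))%:E <= gamma (En k).
  elim: k => [|k IHk].
    have -> : En 0%N = set0 by apply/seteqP; split => // z [].
    by rewrite measure0 lee_fin; have := m_leU set0 set0; have := L0;
      rewrite /fa_measure indic0 => ->.
  rewrite step measureU//; last first.
    apply: measurable_cylinder; exact: measurable_slice.
  apply: (@le_trans _ _ ((m (En k))%:E +
    (m (slice A_countable E k `*` index_fiber A_countable k))%:E)).
    by rewrite -EFinD lee_fin.
  apply: leeD => //; apply: fa_measure_cylinder_le; first exact: measurable_slice.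
  by move=> x [a _ /EW[]].
apply: (@le_trans _ _ ((m (En n))%:E + (m (~` Gam j))%:E)).
  rewrite -EFinD lee_fin; apply: le_trans (m_leU _ _); apply: m_le => z Ez.
  have [Gz|Gz] := pselect (Gam j z); last by right.
  by left; split => //; exact: jn.
apply: leeD => //; apply: le_trans (Enle n) _; apply: gamma_le => //.
exact: subIsetl.
Qed.

(** Raised to its upper bound off the closed cylinder over [D], the function [u]
    becomes lower semicontinuous, so its integral under [gamma] is at most its
    value under [L]. The amount [g] by which [u] is raised has to be taken back on
    both sides: inside of [O] the frequency is below [gamma] up to tightness, and
    outside of [O] it is itself small. *)
Lemma relax_near (u : T -> R) (N : nat) : measurable_fun [set: T] u ->
  (forall z, 0 <= u z <= N%:R)%R ->
  (forall t, (0 <= t)%R -> exists2 V : set T, open V &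
    V `&` (D `*` setT) = [set z | (t < u z)%R] `&` (D `*` setT)) ->
  \int[gamma]_z (u z)%:E <= (L u)%:E + (N%:R * m (~` Gam j) *+ 2)%:E.
Proof.
move=> mu uN uV.
have mD : measurable D by exact: borel_measurable_closed.
pose off : set T := ~` D `*` setT; pose g z := ((N%:R - u z) * \1_off z)%R.
have moff : measurable off by apply: measurable_cylinder; exact: measurableC.
have mg : measurable_fun [set: T] g.
  by apply: measurable_funM; [exact: measurable_funB|exact: measurable_indic].
have gN z : (0 <= g z <= N%:R)%R.
  rewrite /g indicE; case: (z \in off); rewrite ?mulr1 ?mulr0; have := uN z; last by lra.
  by lra.
have bu : bounded_fun u.
  apply/bounded_funP; exists N%:R => // z.
  by have /andP[u0 ?] := uN z; rewrite ger0_norm.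
have bg : bounded_fun g.
  apply/bounded_funP; exists N%:R => // z.
  by have /andP[g0 ?] := gN z; rewrite ger0_norm.
have fD z : D z.1 -> (u z + g z = u z)%R.
  move=> Dz; rewrite /g indicE memNset ?mulr0 ?addr0//.
  by move=> -[/=].
have fDC z : ~ D z.1 -> (u z + g z = N%:R)%R.
  by move=> Dz; rewrite /g indicE mem_set// mulr1; lra.
have fN z : (0 <= u z + g z <= N%:R)%R.
  by have [Dz|Dz] := pselect (D z.1); [rewrite fD|rewrite fDC// lexx ler0n].
have ufg : \int[gamma]_z (u z + g z)%:E <= (L (fun z => u z + g z)%R)%:E.
  apply: (@layer_cake_le _ N) => //; first exact: measurable_funD.
  move=> t t0; apply: gamma_open.
  have [tN|Nt] := ltP t N%:R; last first.
    have -> : [set z | (t < u z + g z)%R] = set0.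
      by apply/seteqP; split => // z /=; have := fN z; lra.
    exact: open0.
  have [V oV VD] := uV t t0.
  have -> : [set z | (t < u z + g z)%R] = V `|` off.
    apply/seteqP; split=> z.
      have [Dz|Dz] := pselect (D z.1); last by right.
      rewrite /= fD// => tu; left.
      by have : ([set z | (t < u z)%R] `&` (D `*` setT)) z; [|rewrite -VD => -[]].
    have [Dz|Dz] := pselect (D z.1); last by rewrite /= fDC.
    move=> [Vz|[/=]//]; rewrite /= fD//.
    by have : (V `&` (D `*` setT)) z; [|rewrite VD => -[]].
  by apply: openU => //; apply: open_cylinder; exact: closed_openC.
pose inO : set T := O `*` setT.
have minO : measurable inO by apply: measurable_cylinder; exact: borel_measurable_open.
pose g1 z := (g z * \1_inO z)%R.
have mg1 : measurable_fun [set: T] g1.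
  by apply: measurable_funM => //; exact: measurable_indic.
have g1g z : (0 <= g1 z <= g z)%R.
  by rewrite /g1 indicE; case: (z \in inO); rewrite ?mulr1 ?mulr0; have := gN z; lra.
have g1N z : (0 <= g1 z <= N%:R)%R by have := g1g z; have := gN z; lra.
have bg1 : bounded_fun g1.
  apply/bounded_funP; exists N%:R => // z.
  by have /andP[? ?] := g1N z; rewrite ger0_norm.
have Lg1 : (L g1)%:E <= \int[gamma]_z (g1 z)%:E + (N%:R * m (~` Gam j))%:E.
  apply: layer_cake_ge => // t t0; apply: fa_measure_le_gamma.
    exact: (measurable_superlevel t mg1).
  move=> [x a] /=; rewrite /g1 /g !indicE.
  case: (boolP (_ \in inO)) => [|_]; last by rewrite mulr0 => /lt_le_trans/(_ t0); rewrite ltxx.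
  case: (boolP (_ \in off)) => [|_ _]; last by rewrite mulr0 mul0r => /lt_le_trans/(_ t0); rewrite ltxx.
  by rewrite !inE => -[/= Dx _] [/= Ox _].
have Lg : (L g <= L g1 + N%:R * m (~` Gam j))%R.
  rewrite -LZ// -LD//; last exact: bounded_funZ.
  apply: L_le => //; first by apply: bounded_funD => //; exact: bounded_funZ.
  move=> z _; rewrite /g1 [X in (X * \1_inO _)%R]/(g z) !indicE.
  case: (boolP (z \in inO)) => zO; first by rewrite mulr1 lerDl mulr_ge0.
  have -> : z \in ~` Gam j.
    rewrite inE => Gz; move/negP : zO; apply; rewrite inE; split => //.
    by apply: GamO; exists z.
  by rewrite mulr0 add0r mulr1; case/andP: (gN z).
have intD : \int[gamma]_z (u z + g z)%:E =
    \int[gamma]_z (u z)%:E + \int[gamma]_z (g z)%:E.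
  under eq_integral do rewrite EFinD.
  rewrite ge0_integralD//.
  - by move=> z _; rewrite lee_fin; case/andP: (uN z).
  - exact/measurable_EFinP.
  - by move=> z _; rewrite lee_fin; case/andP: (gN z).
  - exact/measurable_EFinP.
have int_fin : \int[gamma]_z (g z)%:E \is a fin_num.
  rewrite ge0_fin_numE; last first.
    by apply: integral_ge0 => z _; rewrite lee_fin; case/andP: (gN z).
  apply: (@le_lt_trans _ _ (\int[gamma]_z (cst N%:R%:E z))).
    apply: ge0_le_integral => //.
    - by move=> z _; rewrite lee_fin; case/andP: (gN z).
    - exact/measurable_EFinP.
    - by move=> z _; rewrite lee_fin; case/andP: (gN z).
  by rewrite integral_cst// gamma_setT mule1 ltry.
have int_g1 : \int[gamma]_z (g1 z)%:E <= \int[gamma]_z (g z)%:E.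
  apply: ge0_le_integral => //.
  - by move=> z _; rewrite lee_fin; case/andP: (g1N z).
  - exact/measurable_EFinP.
  - exact/measurable_EFinP.
  - by move=> z _; rewrite lee_fin; case/andP: (g1g z).
rewrite -(leeD2rE _ _ int_fin) -intD; apply: le_trans ufg _.
rewrite LD// EFinD -addeA; apply: leeD => //.
move: Lg int_g1 Lg1; set c := (N%:R * m (~` Gam j))%R => Lg int_g1 Lg1.
apply: (@le_trans _ _ ((L g1)%:E + c%:E)); first by rewrite -EFinD lee_fin.
apply: (@le_trans _ _ (\int[gamma]_z (g z)%:E + c%:E + c%:E)).
  by apply: leeD => //; apply: le_trans Lg1 _; exact: leeD.
by rewrite mulr2n EFinD -addeA [leRHS]addeC.
Qed.

End majorized.

(** The open set, the closed set and the majorant are chosen for a [Gam j] that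
    carries all but a small frequency; [N] being fixed, the error vanishes. *)
Lemma relax (u : T -> R) (N : nat) : measurable_fun [set: T] u ->
  (forall z, 0 <= u z <= N%:R)%R ->
  (forall D : set X, closed D ->
    {within D `*` [set: A],
      continuous (kernel_value (transition M) : T -> weak_probability R X)} ->
    (forall i, lower_semicontinuous
      (cost M i : subspace (D `*` [set: A]) -> \bar R)) ->
    forall t, (0 <= t)%R -> exists2 V : set T, open V &
      V `&` (D `*` setT) = [set z | (t < u z)%R] `&` (D `*` setT)) ->
  \int[gamma]_z (u z)%:E <= (L u)%:E.
Proof.
move=> mu uN uV; apply/lee_addgt0Pr => e e0.
have N0 : (0 < N%:R + 1 :> R)%R by rewrite ltr_wpDl.
have [|j mj] := @fa_measure_tight (e / 2 / (N%:R + 1))%R; first by rewrite !divr_gt0.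
have [|O [D [nu [[oO GO] cD maj cq lc]]]] := hM (K := fst @` Gam j); first by exists j.
apply: le_trans (relax_near oO GO cD maj mu uN (uV D cD cq lc)) _.
apply: leeD => //; rewrite lee_fin mulr2n.
move: mj; rewrite ler_pdivlMr// => mj; have := m_ge0 (~` Gam j); lra.
Qed.

(** The truncated costs inherit lower semicontinuity on [D], and [L] bounds them by
    [K i]; the truncation is removed by monotone convergence. *)
Lemma gamma_cost i : \int[gamma]_z cost M i z <= (K i)%:E.
Proof.
pose u (k : nat) z := fine (mine (cost M i z) k%:R%:E).
have c0 z : 0 <= cost M i z by exact: cost_ge0.
have uE N z : (u N z)%:E = mine (cost M i z) N%:R%:E.
  have m0 : 0 <= mine (cost M i z) N%:R%:E by rewrite le_min c0 lee_fin ler0n.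
  rewrite fineK// ge0_fin_numE//.
  by rewrite (@le_lt_trans _ _ N%:R%:E) ?ge_min ?lexx ?orbT// ltry.
have mu k : measurable_fun [set: T] (u k).
  apply/measurable_EFinP.
  have -> : EFin \o u k = (fun z => mine (cost M i z) k%:R%:E).
    by apply/funext => z; exact: uE.
  by apply: measurable_mine => //; exact: measurable_cost.
have uN N z : (0 <= u N z <= N%:R)%R.
  by rewrite -!lee_fin uE le_min c0 lee_fin ler0n ge_min lexx orbT.
have bu N : bounded_fun (u N).
  apply/bounded_funP; exists N%:R => // z.
  by have /andP[u0 ?] := uN N z; rewrite ger0_norm.
have intu N : \int[gamma]_z (u N z)%:E <= (K i)%:E.
  apply: le_trans (@relax (u N) N _ _ _) _ => //; last first.
    rewrite lee_fin; apply: L_cost => // z _.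
    by rewrite uE ge_min lexx.
  move=> D cD _ /(_ i) /lower_semicontinuousP lc t t0.
  have [tN|Nt] := ltP t N%:R; last first.
    exists set0; first exact: open0.
    rewrite set0I; apply/seteqP; split => // z [/= tu _].
    by have := uN N z; lra.
  have /open_subspaceP[V oV VD] := lc t.
  exists V => //; rewrite VD; congr (_ `&` _); apply/seteqP; split=> z /=.
    by move=> tc; rewrite -lte_fin uE lt_min tc lte_fin.
  by rewrite -lte_fin uE lt_min => /andP[].
have limu z : (u N z)%:E @[N --> \oo] --> cost M i z.
  have := c0 z; under eq_fun do rewrite uE.
  case: (cost M i z) => [r| |] // r0.
    apply: cvg_near_cst; exists (Num.truncn r).+1 => // n /= rn.
    rewrite min_l// lee_fin; apply: ltW; apply: lt_le_trans (truncnS_gt _) _.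
    by rewrite ler_nat.
  by under eq_fun do rewrite minye; apply/cvgeryP; exact: cvgr_idn.
rewrite (eq_integral (fun z => limn (fun N => (u N z)%:E))); last first.
  by move=> z _; apply/esym/cvg_lim => //; exact: limu.
rewrite monotone_convergence//.
- apply: lime_le.
    apply: ereal_nondecreasing_is_cvgn => N N' NN'.
    apply: ge0_le_integral => //.
    + by move=> z _; rewrite lee_fin; case/andP: (uN N z).
    + exact/measurable_EFinP.
    + exact/measurable_EFinP.
    + by move=> z _; rewrite !uE le_min !ge_min lexx/= lee_fin ler_nat NN' orbT.
  by apply: nearW.
- by move=> N; exact/measurable_EFinP.
- by move=> N z _; rewrite lee_fin; case/andP: (uN N z).
- by move=> z _ N N' NN'; rewrite !uE le_min !ge_min lexx/= lee_fin ler_nat NN' orbT.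
Qed.

(** [relax] for [u] and for [1 - u]. *)
Lemma relax_continuous (u : T -> R) : measurable_fun [set: T] u ->
  (forall z, 0 <= u z <= 1)%R ->
  (forall D : set X, closed D ->
    {within D `*` [set: A],
      continuous (kernel_value (transition M) : T -> weak_probability R X)} ->
    {within D `*` [set: A], continuous u}) ->
  \int[gamma]_z (u z)%:E = (L u)%:E.
Proof.
move=> mu u1 cu.
have bu : bounded_fun u.
  by apply/bounded_funP; exists 1%R => // z; have /andP[u0 ?] := u1 z; rewrite ger0_norm.
have bNu := bounded_funZ (-1) bu.
pose v z := (1 + (-1) * u z)%R.
have mv : measurable_fun [set: T] v.
  by apply: measurable_funD => //; exact: measurable_funM.
have v1 z : (0 <= v z <= 1)%R by have := u1 z; rewrite /v; lra.
have intu : \int[gamma]_z (u z)%:E <= (L u)%:E.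
  apply: (@relax u 1) => // D cD cq _ t t0.
  have /continuousP/(_ [set y | (t < y)%R] (@open_gt _ _)) := cu D cD cq.
  by move=> /open_subspaceP[V oV VD]; exists V.
have intv : \int[gamma]_z (v z)%:E <= (L v)%:E.
  apply: (@relax v 1) => // D cD cq _ t t0.
  have /continuousP/(_ [set y | (y < 1 - t)%R] (@open_lt _ _)) := cu D cD cq.
  move=> /open_subspaceP[V oV VD]; exists V => //; rewrite VD; congr (_ `&` _).
  by apply/seteqP; split=> z /=; rewrite /from_subspace /v => ?; lra.
have intuv : \int[gamma]_z (u z)%:E + \int[gamma]_z (v z)%:E = 1.
  rewrite -ge0_integralD//.
  - rewrite (eq_integral (cst 1)); first by rewrite integral_cst// gamma_setT mule1.
    by move=> z _; rewrite -EFinD /v; congr EFin; lra.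
  - by move=> z _; rewrite lee_fin; case/andP: (u1 z).
  - exact/measurable_EFinP.
  - by move=> z _; rewrite lee_fin; case/andP: (v1 z).
  - exact/measurable_EFinP.
have Lv : L v = (1 - L u)%R.
  by rewrite (LD (bounded_fun_cst _ _) bNu) L1 LZ// mulN1r.
apply/eqP; rewrite eq_le intu/=.
have fu : \int[gamma]_z (u z)%:E \is a fin_num.
  rewrite ge0_fin_numE; first by rewrite (le_lt_trans intu)// ltry.
  by apply: integral_ge0 => z _; rewrite lee_fin; case/andP: (u1 z).
move: intuv intv; rewrite -(fineK fu) Lv; move: (fine _) => a.
case: (\int[gamma]_z (v z)%:E) => [b| |] //; rewrite -EFinD => -[]; rewrite !lee_fin; lra.
Qed.

Section open_set.
Variables (G : set X) (phi : X -> R).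
Hypotheses (cphi : continuous phi)
  (phiP : forall x, (0 <= phi x <= 1)%R /\ (G x <-> (0 < phi x)%R)).

(* Continuous functions increasing to the indicator of [G]. *)
Let h (n : nat) x := Num.min 1%R (n%:R * phi x)%R.

Let h1 n x : (0 <= h n x <= 1)%R.
Proof.
have [/andP[p0 p1] _] := phiP x.
by rewrite /h le_min ler01 ge_min lexx !andbT/= mulr_ge0.
Qed.

Let ch n : continuous (h n).
Proof.
move=> x; apply: (@continuous_min _ _ (cst 1%R) (fun x => n%:R * phi x)%R x).
  exact: cvg_cst.
by apply: cvgM; [exact: cvg_cst|exact: cphi].
Qed.

Let mh n : measurable_fun [set: X] (h n).
Proof.
have /continuousP ch' := @ch n.
apply: (measurability _ (RGenOpens.measurableE R)) => _ [_ [a [b ->] <-]].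
by rewrite setTI; apply: borel_measurable_open; apply: ch'; exact: interval_open.
Qed.

Let bh n : bounded_fun (h n).
Proof.
by apply/bounded_funP; exists 1%R => // x; have /andP[h0 ?] := h1 n x; rewrite ger0_norm.
Qed.

Let h_nd x : nondecreasing_seq (h ^~ x).
Proof.
move=> k l kl; have [/andP[p0 _] _] := phiP x.
by rewrite /h le_min ge_min lexx/= ge_min ler_wpM2r ?ler_nat ?orbT.
Qed.

Let h_cvg x : (h n x)%:E @[n --> \oo] --> (\1_G x)%:E.
Proof.
have [/andP[p0 p1] Gx] := phiP x; rewrite indicE.
have [xG|xG] := pselect (G x).
  rewrite mem_set//; have phi0 := Gx.1 xG.
  apply: cvg_near_cst; exists (Num.truncn (phi x)^-1).+1 => // n /= rn.
  congr EFin; apply/eqP; rewrite eq_le ge_min lexx/= le_min lexx/=.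
  rewrite -ler_pdivrMr// div1r; apply: ltW; apply: lt_le_trans (truncnS_gt _) _.
  by rewrite ler_nat.
rewrite memNset//; have -> : (fun n => (h n x)%:E) = cst 0; last exact: cvg_cst.
have phi0 : phi x = 0%R.
  by apply/eqP; rewrite eq_le p0 andbT leNgt; apply/negP => /Gx.2.
by apply/funext => n; congr EFin; rewrite /h phi0 mulr0 min_r.
Qed.

Let integral_h n : \int[gamma]_z (h n z.1)%:E = \int[gamma]_z (transition_op M (h n) z)%:E.
Proof.
transitivity (L (fun z => h n z.1))%:E.
  apply: relax_continuous.
  - exact: (measurableT_comp (mh n) measurable_fst).
  - by move=> z; exact: h1.
  - move=> D _ _; apply: continuous_subspaceT => z.
    by apply: continuous_comp; [exact: cvg_fst|exact: ch].
rewrite L_invariant//; apply/esym; apply: relax_continuous.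
- exact: measurable_transition_op.
- move=> z; apply/andP; split.
    by rewrite -[leLHS](transition_op_cst M _ z); apply: le_transition_op => //;
      [exact: bounded_fun_cst|move=> x; case/andP: (h1 n x)].
  by rewrite -[leRHS](transition_op_cst M _ z); apply: le_transition_op => //;
    [exact: bounded_fun_cst|move=> x; case/andP: (h1 n x)].
- move=> D _ cq.
  pose f : bounded_continuous R X := exist _ (h n) (conj (@ch n) (@bh n)).
  have ev : continuous (fun mu : weak_probability R X => integrals mu f).
    move=> mu; apply: (@continuous_comp _ _ _
      (@integrals R _ X : weak_probability R X -> _) (fun g => g f)).
      exact: initial_continuous.
    exact: (@proj_continuous {classic (bounded_continuous R X)} (fun=> R : topologicalType) f).
  move=> z; exact: (continuous_comp (cq z) (ev _)).
Qed.

(** Invariance under [L] is transferred to [gamma] for the continuous functions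
    [h n], whose images under the kernel are continuous on [D], and then to their
    limit. *)
Lemma gamma_invariant_open : measurable G ->
  gamma (G `*` setT) = \int[gamma]_z transition M z G.
Proof.
move=> mG; transitivity (limn (fun n => \int[gamma]_z (h n z.1)%:E)).
  rewrite -monotone_convergence//.
  - transitivity (\int[gamma]_z (\1_(G `*` setT) z)%:E).
      by rewrite integral_indic ?setIT//; exact: measurable_cylinder.
    apply: eq_integral => z _; apply/esym/cvg_lim => //.
    have -> : (\1_(G `*` setT) z)%:E = (\1_G z.1)%:E :> \bar R; last exact: h_cvg.
    congr (nat_of_bool _)%:R%:E; apply/idP/idP; rewrite !inE; first by case.
    by move=> Gz; split.
  - by move=> n; apply/measurable_EFinP; exact: (measurableT_comp (mh n) measurable_fst).
  - by move=> n z _; rewrite lee_fin; case/andP: (h1 n z.1).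
  - by move=> z _ k l kl; rewrite lee_fin; exact: h_nd.
under eq_fun do rewrite integral_h.
have op_nd z : nondecreasing_seq (fun n => (transition_op M (h n) z)%:E).
  move=> k l kl; rewrite lee_fin; apply: le_transition_op => // x.
  exact: h_nd.
rewrite -monotone_convergence//.
- apply: eq_integral => z _.
  transitivity (limn (fun n => \int[transition M z]_y (h n y)%:E)).
    by congr (limn _); apply/funext => n; rewrite transition_opE.
  rewrite -monotone_convergence//.
  + transitivity (\int[transition M z]_y (\1_G y)%:E); last first.
      by rewrite integral_indic ?setIT.
    apply: eq_integral => x _.
    by apply/cvg_lim => //; exact: h_cvg.
  + by move=> n; exact/measurable_EFinP.
  + by move=> n x _; rewrite lee_fin; case/andP: (h1 n x).
  + by move=> x _ k l kl; rewrite lee_fin; exact: h_nd.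
- by move=> n; apply/measurable_EFinP; exact: measurable_transition_op.
- move=> n z _; rewrite lee_fin -[leLHS](transition_op_cst M _ z).
  apply: le_transition_op => //; first exact: bounded_fun_cst.
  by move=> x; case/andP: (h1 n x).
Qed.

End open_set.

Definition normalized_frequency : set T -> \bar R := gamma.

HB.instance Definition _ := Measure.on normalized_frequency.

Let normalized_frequency_setT : normalized_frequency setT = 1.
Proof. exact: gamma_setT. Qed.

HB.instance Definition _ := Measure_isProbability.Build _ _ _
  normalized_frequency normalized_frequency_setT.

(** Equality on open sets gives equality on closed sets, hence by closed regularity
    an inequality on all Borel sets. Applied to a set and to its complement, whose
    measures have the sum [1] on both sides, the inequality is an equality. *)
Lemma gamma_invariant (B : set X) : measurable B ->
  gamma (B `*` setT) = \int[gamma]_z transition M z B.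
Proof.
pose fst_mfun : {mfun T >-> X} := HB.pack (fst : T -> X)
  (isMeasurableFun.Build _ _ _ _ (fst : T -> X) measurable_fst).
have [p pE] : exists p : probability X R, forall E, p E = gamma (E `*` setT).
  exists (distribution (normalized_frequency : probability T R) fst_mfun) => E.
  transitivity (gamma (fst @^-1` E)); first by [].
  by congr (gamma _); apply/seteqP; split=> [z|z []].
pose q E := \int[gamma]_z transition M z E.
have mq E : measurable E -> measurable_fun [set: T] (transition M ^~ E).
  by move=> mE; exact: (measurable_kernel (transition M) E mE).
have q_le E F : measurable E -> measurable F -> E `<=` F -> q E <= q F.
  move=> mE mF EF; apply: ge0_le_integral => //; try exact: mq.
  by move=> z _; apply: le_measure; rewrite ?inE.
have qC E : measurable E -> q E + q (~` E) = 1.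
  move=> mE; have mEC := measurableC mE.
  rewrite /q -ge0_integralD//; try exact: mq.
  rewrite (eq_integral (cst 1)); first by rewrite integral_cst// gamma_setT mule1.
  move=> z _; rewrite -measureU//; last by rewrite setICr.
  by rewrite setUCr; exact: (prob_kernel z).
have pC E : measurable E -> p E + p (~` E) = 1.
  move=> mE; rewrite -measureU//; [|exact: measurableC|by rewrite setICr].
  by rewrite setUCr; exact: probability_setT.
have closedE C : closed C -> q C = p C.
  move=> cC; have oC := closed_openC cC; have mC := borel_measurable_open oC.
  have mC' : measurable C by rewrite -[C]setCK; exact: measurableC.
  have [phi cphi phiP] := borel_space_cozero X_borel oC.
  have e : p (~` C) = q (~` C) by rewrite pE; exact: gamma_invariant_open cphi phiP mC.
  have := qC _ mC'; rewrite -(pC _ mC') -e.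
  have fp : p (~` C) \is a fin_num by exact: fin_num_measure.
  by move=> /(congr1 (fun x => x - p (~` C))); rewrite !addeK.
have le_pq E : measurable E -> p E <= q E.
  move=> mE; apply/lee_addgt0Pr => e e0.
  have [C [cC CE Ce]] := closed_inner_regular X_borel p mE e0.
  have mC : measurable C by exact: borel_measurable_closed.
  have -> : p E = p C + p (E `\` C).
    rewrite -measureU//; [|exact: measurableD|by rewrite setDE setICA setICr setI0].
    by rewrite setUDr setDv setD0; congr (p _); apply/esym/setUidPr.
  by apply: leeD => //; rewrite -closedE//; exact: q_le.
move=> mB; rewrite -pE -/(q B); apply/eqP; rewrite eq_le le_pq//=.
have := le_pq _ (measurableC mB); have := qC _ mB; rewrite -(pC _ mB).
rewrite -(fineK (fin_num_measure p B mB)).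
rewrite -(fineK (fin_num_measure p (~` B) (measurableC mB))).
move: (fine (p B)) (fine (p (~` B))) (q B) (q (~` B)) => a b [a'| |] [b'| |] //.
by move=> [ab]; rewrite lee_fin => h; rewrite lee_fin; lra.
Qed.

Theorem invariant_frequency : exists P : probability T R,
  (forall B, measurable B -> P (B `*` setT) = \int[P]_z transition M z B) /\
  (forall i, \int[P]_z cost M i z <= (K i)%:E).
Proof.
exists normalized_frequency; split; first exact: gamma_invariant.
exact: gamma_cost.
Qed.

End relaxation.

(** * Disintegration *)

(** A randomized choice among the points of a sequence; policies arise in this way
    because the actions are countable. *)
Section weighted_kernel.
Context (R : realType) (d d' : measure_display)
  (X : measurableType d) (Y : measurableType d').
Variables (a : nat -> Y) (v : nat -> X -> R).
Hypotheses (v0 : forall n x, (0 <= v n x)%R)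
  (mv : forall n, measurable_fun [set: X] (v n))
  (v1 : forall x, \sum_(n <oo) (v n x)%:E = 1).

Definition weighted_measure (x : X) : {measure set Y -> \bar R} :=
  mseries (fun n => mscale (NngNum (v0 n x)) (dirac (a n))) 0.

Lemma weighted_measureE x B :
  weighted_measure x B = \sum_(n <oo) (v n x)%:E * \d_(a n) B.
Proof. by []. Qed.

Let measurable_weighted B : measurable B ->
  measurable_fun [set: X] (weighted_measure ^~ B).
Proof.
move=> mB; apply: (@ge0_emeasurable_sum _ _ _ setT
  (fun n x => (v n x)%:E * \d_(a n) B) predT) => n.
  by move=> x _ _; apply: mule_ge0; [rewrite lee_fin|].
move=> _; apply: emeasurable_funM; last exact: measurable_cst.
exact/measurable_EFinP.
Qed.

HB.instance Definition _ :=
  isKernel.Build _ _ _ _ R weighted_measure measurable_weighted.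

Let weighted_setT x : weighted_measure x setT = 1.
Proof.
rewrite weighted_measureE -(v1 x); apply: eq_eseriesr => n _.
by rewrite diracT mule1.
Qed.

HB.instance Definition _ :=
  Kernel_isProbability.Build _ _ _ _ R weighted_measure weighted_setT.

Lemma exists_weighted_kernel : exists mu : R.-pker X ~> Y,
  forall x B, mu x B = \sum_(n <oo) (v n x)%:E * \d_(a n) B.
Proof. by exists weighted_measure. Qed.

End weighted_kernel.

(** The law of [(x, y)] when [y] is drawn from [mu x]. *)
Section graph_kernel.
Context (R : realType) (d d' : measure_display)
  (X : measurableType d) (Y : measurableType d') (mu : R.-pker X ~> Y).

Definition graph_measure (x : X) : set (X * Y) -> \bar R :=
  fun B => mu x [set y | B (x, y)].

Let measurable_graph x (B : set (X * Y)) :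
  measurable B -> measurable [set y | B (x, y)].
Proof.
by move=> mB; have := pair1_measurable x measurableT mB; rewrite setTI.
Qed.

Let graph0 x : graph_measure x set0 = 0.
Proof. exact: measure0. Qed.

Let graph_ge0 x B : 0 <= graph_measure x B.
Proof. exact: measure_ge0. Qed.

Let graph_sigma_additive x : semi_sigma_additive (graph_measure x).
Proof.
move=> F mF tF mUF; rewrite /graph_measure.
rewrite (_ : [set y | _] = \bigcup_k [set y | F k (x, y)]); last by [].
apply: measure_semi_sigma_additive.
- by move=> k; exact: measurable_graph.
- apply/trivIsetP => i j _ _ ij; apply/seteqP; split => // y [Fi Fj].
  by move/trivIsetP : tF => /(_ i j Logic.I Logic.I ij) /seteqP[h _];
    exact: (h _ (conj Fi Fj)).
- by apply: bigcup_measurable => k _; exact: measurable_graph.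
Qed.

HB.instance Definition _ x := isMeasure.Build _ _ _ (graph_measure x)
  (graph0 x) (graph_ge0 x) (@graph_sigma_additive x).

Lemma ge0_integral_graph (p : probability X R) (P : {measure set (X * Y) -> \bar R})
    (g : X * Y -> \bar R) :
  (forall B, measurable B -> P B = \int[p]_x mu x [set y | B (x, y)]) ->
  (forall z, 0 <= g z) -> measurable_fun [set: X * Y] g ->
  \int[P]_z g z = \int[p]_x \int[mu x]_y g (x, y).
Proof.
move=> PE g0 mg.
rewrite (@ge0_integral_mixture _ _ _ _ _ graph_measure _ _ p P g)//.
- apply: eq_integral => x _.
  exact: (ge0_integral_pushforward (pair1_measurable x) (mu x) measurableT mg).
- move=> B; rewrite -inE => /(measurable_fun_xsection_finite_kernel mu).
  congr measurable_fun; apply/funext => x; congr (mu x _).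
  by apply/seteqP; split => y; rewrite /xsection /= inE.
- by move=> x; exact: prob_kernel.
Qed.

End graph_kernel.

Section slice_measure.
Context (R : realType) (dX dA : measure_display)
  (X : borelMeasurableType dX) (A : discreteBorelMeasurableType dA)
  (P : probability (X * A)%type R) (F : set A).

Definition slice_measure : set X -> \bar R := fun B => P (B `*` F).

Let slice_measure0 : slice_measure set0 = 0.
Proof. by rewrite /slice_measure set0X measure0. Qed.

Let slice_measure_ge0 B : 0 <= slice_measure B.
Proof. exact: measure_ge0. Qed.

Let slice_measure_sigma_additive : semi_sigma_additive slice_measure.
Proof.
move=> G mG tG mUG; rewrite /slice_measure.
have -> : \bigcup_n G n `*` F = \bigcup_n (G n `*` F).
  by apply/seteqP; split=> [[x a] [/= [n _ Gnx] Fa]|[x a] [n _ [/= Gnx Fa]]];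
    [exists n|split => //; exists n].
apply: measure_semi_sigma_additive.
- by move=> n; exact: measurable_cylinder.
- apply/trivIsetP => i j _ _ ij; apply/seteqP; split => // -[x a] [[/= Gi _] [/= Gj _]].
  by move/trivIsetP : tG => /(_ i j Logic.I Logic.I ij) /seteqP[h _];
    exact: (h _ (conj Gi Gj)).
- by apply: bigcup_measurable => n _; exact: measurable_cylinder.
Qed.

HB.instance Definition _ := isMeasure.Build _ _ _ slice_measure
  slice_measure0 slice_measure_ge0 slice_measure_sigma_additive.

Let slice_measure_fin : fin_num_fun slice_measure.
Proof. by move=> B mB; apply: fin_num_measure; exact: measurable_cylinder. Qed.

HB.instance Definition _ := Measure_isFinite.Build _ _ _ slice_measure
  slice_measure_fin.

End slice_measure.

Section disintegration.
Context (R : realType) (dX dA : measure_display)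
  (X : borelMeasurableType dX) (A : discreteBorelMeasurableType dA).
Hypothesis A_countable : countable [set: A].
Let T := (X * A)%type.
Context (d : nat) (M : cmdp R X A d) (P : probability T R) (p : probability X R).
Hypotheses (P_adm : P (~` adm_graph M) = 0)
  (pE : forall B, measurable B -> p B = P (B `*` setT)).

Local Notation fiber := (index_fiber A_countable).

(** For each action, the part of [P] on it has a density [r n] with respect to the
    marginal [p]. Almost everywhere these densities have the sum [1] and vanish on
    the inadmissible actions; on the exceptional set they are replaced by the
    indicator of the first admissible action, as a policy has to be admissible
    everywhere. *)
Lemma exists_disintegration : exists mu : R.-pker X ~> A,
  (forall x, mu x (adm M x) = 1) /\
  (forall B, measurable B -> P B = \int[p]_x mu x [set a | B (x, a)]).
Proof.
have mcyl := @measurable_cylinder _ _ X A.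
(* [a_ n] is the action numbered [n]; its value is arbitrary when there is none. *)
have [a_ a_P] : exists a_ : nat -> A, forall n b, fiber n b -> b = a_ n.
  have ex n : exists a, forall b, fiber n b -> b = a.
    have [[b nb]|nb] := pselect (exists b, fiber n b).
      by exists b => c nc; apply: (@action_index_inj _ _ A_countable); rewrite nb nc.
    by exists point => b nb'; case: nb; exists b.
  by have [a_ h] := choice ex; exists a_.
have mG : measurable (adm_graph M) by exact: measurable_adm.
have exRN n : exists r : X -> R, [/\ forall x, (0 <= r x)%R,
    measurable_fun [set: X] r,
    forall B, measurable B -> P (B `*` fiber n) = \int[p]_(x in B) (r x)%:E &
    ~ fiber n (a_ n) -> forall x, r x = 0%R].
  have [na|na] := pselect (fiber n (a_ n)); last first.
    have F0 : fiber n = set0.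
      by apply/seteqP; split => // b nb; apply: na; rewrite -(a_P _ _ nb).
    exists (fun=> 0%R); split => // B mB.
    by rewrite F0 setX0 measure0 integral0_eq.
  have dom : slice_measure P (fiber n) `<< p.
    apply/null_content_dominatesP => B mB pB0; apply/eqP.
    rewrite -measure_le0; apply: (@le_trans _ _ (p B)); last by rewrite [leLHS]pB0.
    rewrite pE//; apply: le_measure; rewrite ?inE.
    - exact: mcyl.
    - exact: mcyl.
    - by move=> z [].
  have [f [f0 ffin fint fE]] := radon_nikodym_sigma_finite dom.
  exists (fine \o f); split.
  - by move=> x; exact: fine_ge0.
  - by apply: measurableT_comp => //; exact: measurable_int fint.
  - move=> B mB; rewrite -[LHS]/(slice_measure P (fiber n) B) fE//.
    by apply: eq_integral => x _; rewrite /= fineK.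
  - by [].
have [r rP] := choice exRN.
have r0 n x : (0 <= r n x)%R by case: (rP n).
have mr n : measurable_fun [set: X] (r n) by case: (rP n).
pose S (B : set T) x := \sum_(n <oo) (r n x)%:E * \d_(a_ n) [set a | B (x, a)].
have term0 B n x : 0 <= (r n x)%:E * \d_(a_ n) [set a | B (x, a)].
  by apply: mule_ge0; [rewrite lee_fin|].
have termE B n x : (r n x)%:E * \d_(a_ n) [set a | B (x, a)] =
    ((fun x => (r n x)%:E) \_ (slice A_countable B n)) x.
  rewrite patchE diracE; have [na|na] := pselect (fiber n (a_ n)); last first.
    by have [_ _ _ ->//] := rP n; rewrite mul0e; case: ifP.
  have -> : (a_ n \in [set a | B (x, a)]) = (x \in slice A_countable B n).
    apply/idP/idP; rewrite !inE; first by exists (a_ n).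
    by move=> [b nb Bxb]; rewrite /= -(a_P _ _ nb).
  by case: ifP => _; [rewrite mule1|rewrite mule0].
have mterm B n : measurable B ->
    measurable_fun [set: X] (fun x => (r n x)%:E * \d_(a_ n) [set a | B (x, a)]).
  move=> mB; under eq_fun do rewrite termE.
  apply/(measurable_restrictT (fun x => (r n x)%:E) (measurable_slice _ _ mB)).
  by apply: measurable_funTS; exact/measurable_EFinP.
have mS B : measurable B -> measurable_fun [set: X] (S B).
  move=> mB; apply: (@ge0_emeasurable_sum _ _ _ setT
    (fun n x => (r n x)%:E * \d_(a_ n) [set a | B (x, a)]) predT) => n.
    by move=> x _ _.
  by move=> _; exact: mterm.
have S0 B x : 0 <= S B x by apply: nneseries_ge0 => n _ _.
have PS B : measurable B -> P B = \int[p]_x S B x.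
  move=> mB; rewrite integral_nneseries//; last by move=> n; exact: mterm.
  rewrite {1}(bigcup_slices A_countable B) measure_semi_bigcup.
  - apply: eq_eseriesr => n _; have [_ _ rE _] := rP n.
    rewrite /= rE; last exact: measurable_slice.
    by rewrite integral_mkcond; apply: eq_integral => x _; rewrite termE.
  - by move=> n; apply: mcyl; exact: measurable_slice.
  - apply/trivIsetP => i j _ _ ij; apply/seteqP; split => // -[x a] [[_ /= ia] [_ /= ja]].
    by move/eqP : ij; apply; rewrite -ia -ja.
  - by rewrite -bigcup_slices.
have ST_ae : ae_eq p setT (S setT) (cst 1).
  apply: integral_ae_eq => //.
  - apply/integrableP; split; first exact: mS.
    under eq_integral do rewrite gee0_abs//.
    by rewrite -PS// ltey_eq fin_num_measure.
  - move=> E _ mE; rewrite integral_cst// mul1e -[RHS]/(p E) pE// PS; last exact: mcyl.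
    rewrite integral_mkcond; apply: eq_integral => x _; rewrite patchE.
    case: ifPn => xE.
      apply: eq_eseriesr => n _; congr (_ * \d_(_) _).
      by apply/seteqP; split => // a _; split => //=; rewrite inE in xE.
    apply/esym; apply: eseries0 => n _ _.
    rewrite (_ : [set a | _] = set0) ?dirac0 ?mule0//.
    by apply/seteqP; split => // a [/= Ex _]; move: xE; rewrite notin_setE.
have SG_ae : ae_eq p setT (S (~` adm_graph M)) (cst 0).
  apply/ae_eq_integral_abs => //; first by apply: mS; exact: measurableC.
  under eq_integral do rewrite gee0_abs//.
  by rewrite -PS//; exact: measurableC.
pose good := [set x | S setT x = 1 /\ S (~` adm_graph M) x = 0].
have mgood : measurable good.
  have -> : good = S setT @^-1` [set 1] `&` S (~` adm_graph M) @^-1` [set 0] by [].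
  apply: measurableI; rewrite -[X in measurable X]setTI.
    exact: mS.
  by apply: mS => //; exact: measurableC.
have good_ae : {ae p, forall x, good x}.
  by move: ST_ae SG_ae; apply: filterS2 => x h1 h2; split; [exact: h1|exact: h2].
pose e n := [set x | fiber n (a_ n) /\ adm M x (a_ n)].
have me n : measurable (e n).
  have [na|na] := pselect (fiber n (a_ n)); last first.
    by rewrite (_ : e n = set0)//; apply/seteqP; split => // x [].
  rewrite (_ : e n = pair^~ (a_ n) @^-1` adm_graph M).
    by have := pair2_measurable (T1 := X) (a_ n) measurableT mG; rewrite setTI.
  by apply/seteqP; split => [x []|x].
have msd n : measurable (seqDU e n).
  by apply: measurableD => //; exact: bigsetU_measurable.
have sdT : \bigcup_n seqDU e n = setT.
  rewrite -seqDU_bigcup_eq; apply/seteqP; split => // x _.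
  have [a xa] := adm_neq0 M x; exists (action_index A_countable a) => //.
  have ia : fiber (action_index A_countable a) a by [].
  by split; rewrite -(a_P _ _ ia).
have sd1 x : \sum_(n <oo) (\1_(seqDU e n) x)%:E = 1 :> \bar R.
  transitivity (\d_x (\bigcup_n seqDU e n) : \bar R).
    by rewrite measure_semi_bigcup//; rewrite sdT.
  by rewrite sdT diracT.
pose v n x := (r n x * \1_good x + \1_(seqDU e n) x * \1_(~` good) x)%R.
have v_good n x : good x -> v n x = r n x.
  move=> gx; rewrite /v (indicE _ good) (indicE _ (~` good)) mem_set// memNset.
    by rewrite mulr1 mulr0 addr0.
  by move=> /(_ gx).
have v_bad n x : ~ good x -> v n x = \1_(seqDU e n) x.
  move=> gx; rewrite /v (indicE _ good) (indicE _ (~` good)) memNset// mem_set//.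
  by rewrite mulr0 add0r mulr1.
have v0 n x : (0 <= v n x)%R.
  by rewrite /v addr_ge0 ?mulr_ge0.
have mv n : measurable_fun [set: X] (v n).
  apply: measurable_funD; apply: measurable_funM => //; apply: measurable_indic => //.
  exact: measurableC.
have v1 x : \sum_(n <oo) (v n x)%:E = 1.
  have [gx|gx] := pselect (good x).
    rewrite -gx.1; apply: eq_eseriesr => n _.
    by rewrite v_good// (_ : [set a | _] = setT) ?diracT ?mule1.
  by rewrite -(sd1 x); apply: eq_eseriesr => n _; rewrite v_bad.
have [mu muE] := exists_weighted_kernel a_ v0 mv v1.
exists mu; split.
  move=> x; have mC : mu x (~` adm M x) = 0.
    rewrite muE; have [gx|gx] := pselect (good x).
      transitivity (S (~` adm_graph M) x); last exact: gx.2.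
      by apply: eq_eseriesr => n _; rewrite v_good.
    apply: eseries0 => n _ _; rewrite v_bad//.
    rewrite indicE; case: (boolP (x \in _)) => [|_]; last by rewrite mul0e.
    by rewrite inE diracE => -[[_ xa] _]; rewrite memNset ?mule0// => /(_ xa).
  have <- : mu x setT = 1 by exact: prob_kernel.
  rewrite -(setUv (adm M x)) measureU//; try exact: discrete_measurable.
    by rewrite [X in _ = _ + X]mC adde0.
  by rewrite setICr.
move=> B mB; rewrite PS//; apply: ge0_ae_eq_integral => //.
- exact: mS.
- have -> : (fun x => mu x [set a | B (x, a)]) =
      (fun x => \sum_(n <oo) (v n x)%:E * \d_(a_ n) [set a | B (x, a)]).
    by apply/funext => x; rewrite muE.
  have := @measurable_fun_xsection_finite_kernel _ _ _ _ _ mu B.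
  rewrite inE => /(_ mB); congr measurable_fun; apply/funext => x.
  rewrite -muE; congr (mu x _).
  by apply/seteqP; split => y; rewrite /xsection /= inE.
- move: good_ae; apply: filterS => x gx _; rewrite muE.
  by apply: eq_eseriesr => n _; rewrite v_good.
Qed.

End disintegration.

(** * Stationary policies and the absence of a duality gap *)

Section stationary.
Context (R : realType) (dX dA : measure_display)
  (X : borelMeasurableType dX) (A : discreteBorelMeasurableType dA)
  (d : nat) (M : cmdp R X A d) (mu : R.-pker X ~> A).
Hypothesis mu_adm : forall x, mu x (adm M x) = 1.

Section decision.
Variable n : nat.

Definition stationary_decision : history X A n -> {measure set A -> \bar R} :=
  fun w => mu w.2.

Let measurable_decision B : measurable B ->
  measurable_fun [set: history X A n] (stationary_decision ^~ B).
Proof.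
move=> mB.
exact: (measurableT_comp (measurable_kernel mu B mB) (@measurable_state _ _ X A n)).
Qed.

HB.instance Definition _ :=
  isKernel.Build _ _ _ _ R stationary_decision measurable_decision.

Let decision_setT w : stationary_decision w setT = 1.
Proof. exact: prob_kernel. Qed.

HB.instance Definition _ :=
  Kernel_isProbability.Build _ _ _ _ R stationary_decision decision_setT.

End decision.

Definition stationary_policy : policy M :=
  @Policy _ _ _ _ _ _ M (fun n => @stationary_decision n) (fun n w => mu_adm w.2).

Context (p : probability X R) (P : probability (X * A)%type R).
Hypotheses (pE : forall B, measurable B -> p B = P (B `*` setT))
  (P_graph : forall B, measurable B -> P B = \int[p]_x mu x [set a | B (x, a)])
  (P_inv : forall B, measurable B ->
    P (B `*` setT) = \int[P]_z transition M z B).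

Lemma integral_graph (g : X * A -> \bar R) : (forall z, 0 <= g z) ->
  measurable_fun [set: X * A] g ->
  \int[p]_x \int[mu x]_a g (x, a) = \int[P]_z g z.
Proof. by move=> g0 mg; rewrite (ge0_integral_graph P_graph). Qed.

(** The state keeps the law [p], because [p] is invariant. *)
Lemma stationary_history_law n (g : X -> \bar R) :
  (forall x, 0 <= g x) -> measurable_fun [set: X] g ->
  \int[history_law stationary_policy p n]_w g w.2 = \int[p]_x g x.
Proof.
elim: n g => [|n IHn] g g0 mg.
  rewrite integral_init_law//.
  exact: (measurableT_comp mg (@measurable_state _ _ X A 0)).
have G0 z : 0 <= \int[transition M z]_y g y by exact: integral_ge0.
have mG : measurable_fun [set: X * A] (fun z => \int[transition M z]_y g y).
  apply: (@measurable_fun_integral_kernel _ _ _ _ _ (transition M)) => //.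
  by move=> U mU; exact: (measurable_kernel (transition M) U mU).
rewrite -action_expectation_next// /action_expectation.
rewrite (IHn (fun x => \int[mu x]_a \int[transition M (x, a)]_y g y)).
- rewrite (integral_graph G0 mG); apply/esym.
  apply: (@ge0_integral_mixture _ _ _ _ _ (transition M)) => //.
  + by move=> U mU; exact: (measurable_kernel (transition M) U mU).
  + by move=> z; exact: prob_kernel.
  + by move=> B mB; rewrite -P_inv// -pE.
- by move=> x; exact: integral_ge0.
- exact: (@measurable_fun_integral_finite_kernel _ _ _ _ _
    (fun z => \int[transition M z]_y g y) mu (fun=> G0 _) mG).
Qed.

Lemma stationary_expected_cost i n :
  expected_cost i stationary_policy p n = n%:R%:E * \int[P]_z cost M i z.
Proof.
have c0 := @cost_ge0 _ _ _ _ _ _ M i.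
have mc := @measurable_cost _ _ _ _ _ _ M i.
elim: n => [|n IHn]; first by rewrite expected_cost0 mul0e.
rewrite expected_costS IHn -natr1 EFinD ge0_muleDl// mul1e; congr (_ + _).
rewrite /action_expectation.
rewrite (stationary_history_law n (g := fun x => \int[mu x]_a cost M i (x, a))).
- exact: integral_graph.
- by move=> x; exact: integral_ge0.
- exact: (@measurable_fun_integral_finite_kernel _ _ _ _ _
    (cost M i) mu (fun=> c0 _) mc).
Qed.

Lemma stationary_average_cost i :
  average_cost i stationary_policy p = \int[P]_z cost M i z.
Proof.
rewrite /average_cost.
suff uc : (n%:R^-1)%:E * expected_cost i stationary_policy p n @[n --> \oo] -->
    \int[P]_z cost M i z.
  by rewrite is_cvg_limn_esupE; [exact: cvg_lim uc|apply/cvg_ex; eexists; exact: uc].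
apply: cvg_near_cst; exists 1%N => // n /= n0.
rewrite stationary_expected_cost muleA -EFinM mulVf ?mul1e// pnatr_eq0.
by rewrite -lt0n.
Qed.

End stationary.

Section no_duality_gap.
Context (R : realType) (dX dA : measure_display)
  (X : borelMeasurableType dX) (A : discreteBorelMeasurableType dA).
Hypotheses (X_borel : borel_space R X) (A_countable : countable [set: A]).
Context (d : nat) (M : cmdp R X A d) (Gam : nat -> set (X * A)).
Hypotheses (M_feasible : feasible M !=set0)
  (SU : cond_SU M Gam) (hM : cond_M M Gam).

(** The disintegration of an invariant frequency with costs at most [V] and [kappa]
    is a feasible stationary policy. *)
Theorem no_duality_gap (V : R) :
  (forall rho h beta, dual_feasible M rho h beta ->
    (dual_objective M rho beta <= V)%R) ->
  optimal_cost M <= V%:E.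
Proof.
move=> VP.
have [L [L_linear L_le L1 L_inv L_cost]] := finitely_additive_solution M_feasible VP.
have [gamma g_open g_compact] := exists_frequency X_borel L_linear L_le.
have [P [P_inv P_cost]] := invariant_frequency X_borel A_countable SU hM
  L_linear L_le L1 L_inv L_cost g_open g_compact.
(* Off the graph the cost is infinite, while its integral is finite. *)
have P_adm : P (~` adm_graph M) = 0.
  have mN : measurable (~` adm_graph M) by apply: measurableC; exact: measurable_adm.
  apply/eqP; rewrite -measure_le0 leNgt; apply/negP => N0.
  have := P_cost ord0; apply/negP; rewrite -ltNge.
  apply: (@lt_le_trans _ _ (\int[P]_(z in ~` adm_graph M) cost M ord0 z)).
    rewrite (eq_integral (cst +oo)) => [|z]; last first.
      by rewrite inE => Nz; exact: cost_pinfty.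
    by rewrite integral_cst// gt0_mulye ?ltry.
  apply: ge0_subset_integral => //; first exact: measurable_cost.
  by move=> z _; exact: cost_ge0.
have [p pE] : exists p : probability X R,
    forall B, measurable B -> p B = P (B `*` setT).
  pose fst_mfun : {mfun (X * A)%type >-> X} := HB.pack (fst : X * A -> X)
    (isMeasurableFun.Build _ _ _ _ (fst : X * A -> X) measurable_fst).
  exists (distribution P fst_mfun) => B _.
  transitivity (P (fst @^-1` B)); first by [].
  by congr (P _); apply/seteqP; split=> [z|z []].
have [mu [mu_adm P_graph]] := exists_disintegration A_countable P_adm pE.
have J i := stationary_average_cost mu_adm pE P_graph P_inv i.
apply: (@le_trans _ _ (average_cost ord0 (stationary_policy mu_adm) p)).
  apply: ereal_inf_lbound; exists (stationary_policy mu_adm, p) => //.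
  split=> [|i] /=; first by rewrite J (le_lt_trans (P_cost ord0))// ltry.
  by rewrite /constrained_cost J (le_trans (P_cost _))// cost_limit_lift.
by rewrite J (le_trans (P_cost _))// cost_limit0.
Qed.

End no_duality_gap.

(** * Boundedness of the multipliers *)

Section sensitivity.
Context (R : realType) (dX dA : measure_display)
  (X : borelMeasurableType dX) (A : discreteBorelMeasurableType dA)
  (d : nat) (M : cmdp R X A d).

Definition slack (pi : policy M) (zeta : probability X R) (j : 'I_d) : R :=
  (kappa M ord0 j - fine (constrained_cost j pi zeta))%R.

(** Weak duality with the weight [1] on the cost [0] and [- beta] on the others. *)
Lemma dual_objective_le (pi : policy M) (zeta : probability X R) rho h beta :
  dual_feasible M rho h beta -> (forall i, average_cost i pi zeta < +oo) ->
  (dual_objective M rho beta <= fine (average_cost ord0 pi zeta) +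
    \sum_(j < d) beta ord0 j * slack pi zeta j)%R.
Proof.
move=> [mh bh b0 hle] Jfin.
pose l i := oapp (fun j => - beta ord0 j)%R 1%R (unlift ord0 i).
have l0 i : (0 <= l i)%R by rewrite /l; case: unlift => //= j; rewrite oppr_ge0.
have l_ord0 : l ord0 = 1%R by rewrite /l unlift_none.
have l_lift j : l (lift ord0 j) = (- beta ord0 j)%R by rewrite /l liftK.
have := weak_duality mh bh l0 Jfin.
move=> /(_ rho); rewrite big_ord_recl l_ord0 mul1r.
have -> : (\sum_(j < d) l (lift ord0 j) * fine (average_cost (lift ord0 j) pi zeta) =
    - \sum_(j < d) beta ord0 j * fine (constrained_cost j pi zeta))%R.
  by rewrite -sumrN; apply: eq_bigr => j _; rewrite l_lift mulNr.
have -> : (\sum_(j < d) beta ord0 j * slack pi zeta j =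
    \sum_(j < d) beta ord0 j * kappa M ord0 j -
    \sum_(j < d) beta ord0 j * fine (constrained_cost j pi zeta))%R.
  by rewrite -sumrB; apply: eq_bigr => j _; rewrite mulrBr.
rewrite /dual_objective => H; suff : (rho <=
   fine (average_cost ord0 pi zeta) -
   \sum_(j < d) beta ord0 j * fine (constrained_cost j pi zeta))%R by lra.
apply: H => z Gz; have := hle z Gz.
have cE i : cost M i z = (fine (cost M i z))%:E by rewrite fineK// cost_fin_num.
rewrite transition_opE//.
have -> : \sum_(i < d) (beta ord0 i)%:E * cost M (lift ord0 i) z =
    (\sum_(i < d) beta ord0 i * fine (cost M (lift ord0 i) z))%:E.
  by rewrite -sumEFin; apply: eq_bigr => i _; rewrite cE EFinM.
rewrite big_ord_recl l_ord0 mul1e (cE ord0).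
have -> : \sum_(i < d) (l (lift ord0 i))%:E * cost M (lift ord0 i) z =
    (- \sum_(i < d) beta ord0 i * fine (cost M (lift ord0 i) z))%:E.
  rewrite -sumrN -sumEFin; apply: eq_bigr => i _.
  by rewrite l_lift cE -EFinM mulNr.
rewrite -!EFinD -?EFinB !lee_fin; lra.
Qed.

Lemma feasible_slack_ge0 pi zeta j : feasible M (pi, zeta) ->
  (0 <= slack pi zeta j)%R.
Proof.
move=> f; rewrite subr_ge0 -lee_fin fineK; first exact: f.2.
by rewrite ge0_fin_numE ?average_cost_ge0//; exact: feasible_finite.
Qed.

Lemma slack_gt0 pi zeta j : constrained_cost j pi zeta < (kappa M ord0 j)%:E ->
  (0 < slack pi zeta j)%R.
Proof.
move=> jk; rewrite subr_gt0 -lte_fin fineK//.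
by rewrite ge0_fin_numE ?average_cost_ge0// (lt_trans jk)// ltry.
Qed.

(** In [dual_objective_le] the terms other than the [j]-th are bounded above by [C],
    which leaves a lower bound for the [j]-th. *)
Lemma bounded_multiplier (rho : nat -> R) (h : nat -> X -> R)
    (beta : nat -> 'rV[R]_d) (w : R) (pi : policy M) (zeta : probability X R)
    (C : 'I_d -> R) (j : 'I_d) :
  (forall n, dual_feasible M (rho n) (h n) (beta n)) ->
  (forall n, (w <= dual_objective M (rho n) (beta n))%R) ->
  (forall i, average_cost i pi zeta < +oo) ->
  (forall i, 0 <= C i)%R ->
  (forall n i, (beta n ord0 i * slack pi zeta i <= C i)%R) ->
  (0 < slack pi zeta j)%R ->
  bounded_fun (fun n => beta n ord0 j).
Proof.
move=> feas wle Jfin C0 betaC sj.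
have bj n : (`|beta n ord0 j| <=
    (fine (average_cost ord0 pi zeta) + \sum_i C i - w) / slack pi zeta j)%R.
  have [_ _ b0 _] := feas n.
  rewrite ler0_norm// ler_pdivlMr//.
  have := le_trans (wle n) (dual_objective_le (feas n) Jfin).
  rewrite (bigD1 j)//= (bigD1 (F := C) j)//=.
  have : (\sum_(i < d | i != j) beta n ord0 i * slack pi zeta i <=
      \sum_(i < d | i != j) C i)%R by apply: ler_sum.
  by have := C0 j; lra.
apply/bounded_funP; eexists; last exact: bj.
exact: le_trans (normr_ge0 _) (bj 0%N).
Qed.

Lemma bounded_row (beta : nat -> 'rV[R]_d) :
  (forall j, bounded_fun (fun n => beta n ord0 j)) -> bounded_fun beta.
Proof.
move=> b; have ex j : exists H : R,
    (0 <= H)%R /\ forall n, (`|beta n ord0 j| <= H)%R.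
  by have /bounded_funP[H H0 hH] := b j; exists H.
have [H HP] := choice ex.
exists (\sum_j H j)%R; split => [|K HK n _ /=]; first exact: num_real.
apply: le_trans (ltW HK); rewrite [leLHS]mx_normrE.
apply: bigmax_le => [|[i j] _ /=]; first by apply: sumr_ge0 => j _; case: (HP j).
rewrite ord1 (bigD1 j)//= (le_trans ((HP j).2 n))// lerDl.
by apply: sumr_ge0 => k _; case: (HP k).
Qed.

End sensitivity.

Theorem proposition4p1
  (R : realType) (dX dA : measure_display)
  (X : borelMeasurableType dX) (A : discreteBorelMeasurableType dA)
  (X_borel : borel_space R X) (A_countable : countable [set: A])
  (d : nat) (M : cmdp R X A d)
  (G : feasible M !=set0)
  (Gam : nat -> set (X * A)) (SU : cond_SU M Gam) (hM : cond_M M Gam)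
  (rho : nat -> R) (h : nat -> X -> R) (beta : nat -> 'rV[R]_d)
  (hmax : maximizing_sequence M rho h beta) :
  [/\ (forall j : 'I_d, J0set M j -> bounded_fun (fun n => beta n ord0 j)),
      (forall j : 'I_d,
        (exists (mu : policy M) (p : probability X R),
          stationary_optimal_pair mu p /\
          constrained_cost j mu p < (kappa M ord0 j)%:E) ->
        beta n ord0 j @[n --> \oo] --> (0 : R)%R) &
      ((exists (pi : policy M) (zeta : probability X R),
          [/\ forall j : 'I_d, J1set M j ->
                constrained_cost j pi zeta < (kappa M ord0 j)%:E,
              forall j : 'I_d, J0set M j -> constrained_cost j pi zeta < +oo &
              average_cost ord0 pi zeta < +oo]) ->
        bounded_fun beta)].
Proof.
have [feas v_nd v_cvg] := hmax.
pose v n := dual_objective M (rho n) (beta n).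
have v0n n : (v 0%N <= v n)%R by exact: v_nd.
have beta_le0 n i : (beta n ord0 i <= 0)%R by case: (feas n).
have feasible_beta pi zeta n i : feasible M (pi, zeta) ->
    (beta n ord0 i * slack pi zeta i <= 0)%R.
  by move=> f; rewrite mulr_le0_ge0// feasible_slack_ge0.
have part_i j : J0set M j -> bounded_fun (fun n => beta n ord0 j).
  case=> -[pi zeta] f /slack_gt0 sj.
  apply: (bounded_multiplier (C := fun=> 0%R) feas v0n _ _ _ sj) => //.
  - by move=> i; exact: feasible_finite.
  - by move=> n i; exact: feasible_beta.
split=> // [j [mu [p [[mu_feas mu_opt _] /slack_gt0 sj]]]|].
- have J_fin i := feasible_finite i mu_feas.
  have dual_le r g b : dual_feasible M r g b -> 
      (dual_objective M r b)%:E <= dual_value M.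
    by move=> rgb; apply: ereal_sup_ubound; exists r, g, b.
  have dual_fin : dual_value M \is a fin_num.
    rewrite fin_real// (lt_le_trans _ (dual_le _ _ _ (feas 0%N))) ?ltNyr//=.
    apply: (@le_lt_trans _ _ (fine (average_cost ord0 mu p))%:E); last exact: ltry.
    apply: ge_ereal_sup => _ [r [g [b [rgb ->]]]]; rewrite lee_fin.
    apply: le_trans (dual_objective_le rgb J_fin) _.
    rewrite gerDl sumr_le0// => i _; rewrite mulr_le0_ge0//.
      by case: rgb.
    exact: feasible_slack_ge0.
  pose V := fine (dual_value M).
  have J_le : (fine (average_cost ord0 mu p) <= V)%R.
    rewrite -lee_fin fineK; last by rewrite ge0_fin_numE ?average_cost_ge0.
    rewrite mu_opt; apply: (no_duality_gap X_borel A_countable G SU hM) => r g b.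
    by move=> /dual_le; rewrite -(fineK dual_fin) lee_fin.
  have vV : v n @[n --> \oo] --> V.
    by move: v_cvg; rewrite -(fineK dual_fin) => /fine_cvg.
  (* [- slack * beta_{n,j}] lies between [0] and the gap [V - v n]. *)
  apply: (@squeeze_cvgr _ _ _ _ (fun n => (v n - V) / slack mu p j)%R (cst 0%R)).
  + near=> n; rewrite beta_le0 andbT ler_pdivrMr//.
    have := dual_objective_le (feas n) J_fin.
    rewrite (bigD1 j)//= -/(v n).
    have : (\sum_(i < d | i != j) beta n ord0 i * slack mu p i <= 0)%R.
      by apply: sumr_le0 => i _; exact: feasible_beta.
    by move: J_le; lra.
  + rewrite -[X in _ --> X](mul0r (slack mu p j)^-1%R); apply: cvgM; last exact: cvg_cst.
    by rewrite -(subrr V); apply: cvgB => //; exact: cvg_cst.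
  + exact: cvg_cst.
- move=> [pi [zeta [J1lt J0fin J00]]].
  have J_fin i : average_cost i pi zeta < +oo.
    have [j ->|->//] := unliftP ord0 i.
    have [j0|j1] := pselect (J0set M j); first exact: J0fin.
    by apply: lt_trans (J1lt j j1) _; rewrite ltry.
  have ex i : exists C : R,
      (0 <= C)%R /\ forall n, (beta n ord0 i * slack pi zeta i <= C)%R.
    have [i0|i1] := pselect (J0set M i).
      have /bounded_funP[H H0 hH] := part_i i i0.
      exists (H * `|slack pi zeta i|)%R; split; first exact: mulr_ge0.
      by move=> n; rewrite (le_trans (ler_norm _))// normrM ler_wpM2r.
    exists 0%R; split => // n; rewrite mulr_le0_ge0//.
    by apply/ltW/slack_gt0; exact: J1lt.
  have [C CP] := choice ex.
  apply: bounded_row => j; have [j0|j1] := pselect (J0set M j); first exact: part_i.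
  apply: (bounded_multiplier (C := C) feas v0n J_fin) => [i|n i|].
  + by case: (CP i).
  + by case: (CP i).
  + by apply: slack_gt0; exact: J1lt.
Unshelve. all: by end_near.
Qed.
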